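(* Let $\Omega=\mathbb R^2/\mathcal L$ be a flat torus, and let $v\in L^1((0,T);L^\infty(\Omega;\mathbb R^2))$ be one-sided Lipschitz, that is, $$\left(v(t,x)-v(t,y)\right)\cdot(x-y)\le L(t)|x-y|^2,\qquad L\ge0,\quad L\in L^1(0,T),$$ for almost every $t$ and all periodic representatives $x,y\in\mathbb R^2$. Let $\Phi$ be the forward Filippov flow of $v$. For $\varepsilon\in(0,1]$ let $v^\varepsilon:=\eta_\varepsilon*v$ be the periodic convolution in space, where $\eta_\varepsilon$ is a nonnegative symmetric smooth mollifier of integral one supported in $B(0,\varepsilon)$. For each $N\ge2$, set $h=\sqrt{|\Omega|/N}$, and take pairwise distinct initial generators $X^{h}(0)\in\Omega^N$ with $\mathscr F(X^h(0))\le C_1h^2$, where $C_1$ does not depend on $h$. Let $X^{h,\varepsilon}=(x_1^{h,\varepsilon},\dots,x_N^{h,\varepsilon})$ be the solution on $[0,T]$ of $$\dot x_i^{h,\varepsilon}(t)=v^\varepsilon(t,x_i^{h,\varepsilon}(t))+\frac{\mathscr G(X^{h,\varepsilon}(t))}{h^{5/2}}\left(c_i(X^{h,\varepsilon}(t))-x_i^{h,\varepsilon}(t)\right),\quad 1\le i\le N,\qquad X^{h,\varepsilon}(0)=X^h(0)$$ (this solution exists globally, is unique, and its generators remain distinct). Let $\rho_0\in L^1(\Omega)$, $\rho_0\ge0$, let $\mu(t):=\Phi(t,\cdot)_\#(\rho_0\,dx)$, and let $\mu^{h,\varepsilon}$ be the Voronoi histogram $$\mu^{h,\varepsilon}(t):=\sum_{i=1}^N\frac{M_i^h}{|\Omega_i(X^{h,\varepsilon}(t))|}\mathbf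 1_{\Omega_i(X^{h,\varepsilon}(t))}(x)\,dx,\qquad M_i^h:=\int_{\Omega_i(X^h(0))}\rho_0\,dx.$$ Then there is a constant $C$, depending only on $C_1$, $T$, $\Omega$, $\int_0^TL(t)\,dt$ and $\int_0^T\|v(t,\cdot)\|_{L^\infty}\,dt$, such that $$\sup_{t\in[0,T]}W_1\left(\mu^{h,\varepsilon}(t),\mu(t)\right)\le C\|\rho_0\|_{L^1}\left(h^{1/4}+\varepsilon^{1/2}\right)$$ for all $h,\varepsilon\in(0,1]$.
   Context: Domain. $T>0$ is finite. $\Omega=\mathbb R^2/\mathcal L$, where $\mathcal L=\mathbb Z\ell_1+\mathbb Z\ell_2$ with $\ell_1,\ell_2\in\mathbb R^2$ linearly independent. For points of $\Omega$, $|x-y|=\min_{k\in\mathcal L}|\tilde x-\tilde y-k|$ denotes the torus distance ($\tilde x,\tilde y\in\mathbb R^2$ representatives); in the one-sided Lipschitz condition, $v(t,\cdot)$ is regarded as an $\mathcal L$-periodic function on $\mathbb R^2$ and $|x-y|$ is Euclidean. Filippov flow. For a.e. $t$, $K[v](t,x)$ is the intersection, over the neighborhoods of $x$, of the closed convex hulls of the essential values of $v(t,\cdot)$ in the neighborhood. Trajectories of $v$ are absolutely continuous curves with $\dot x(t)\in K[v](t,x(t))$ for a.e. $t$; under the one-sided Lipschitz condition the forward trajectory from each initial point is unique, and $\Phi(t,x_0)$ denotes its value at time $t$. Voronoi tessellation. For $X=(x_1,\dots,x_N)\in\Omega^N$ with pairwise distinct entries (generators), $\Omega_i(X):=\{x\in\Omega: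 |x-x_i|<|x-x_j|\ \text{for all } j\ne i\}$ and $V_i(X):=|\Omega_i(X)|$. The displacement from $x_i$ to the centroid $c_i(X)$ of the cell is $c_i(X)-x_i=\frac1{V_i(X)}\int_{P_i}(y-x_i)\,dy\in\mathbb R^2$, where, for representatives $x_j\in\mathbb R^2$, $P_i:=\{y\in\mathbb R^2:\ |y-x_i|\le|y-x_j-k|\ \text{for all } 1\le j\le N,\ k\in\mathcal L\}$ (Euclidean norms); it does not depend on the chosen representatives. Indicators. $\mathscr F(X):=\sum_{i=1}^N\int_{\Omega_i(X)}|x-x_i|^2\,dx$ and $\mathscr G(X):=\sum_{i=1}^NV_i(X)|x_i-c_i(X)|^2$. Wasserstein distance. For nonnegative measures $\mu,\nu$ on $\Omega$ of equal mass, $W_1(\mu,\nu):=\inf_{\pi}\int_{\Omega\times\Omega}|x-y|\,d\pi(x,y)$ over nonnegative measures $\pi$ on $\Omega\times\Omega$ with marginals $\mu$ and $\nu$. *)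

(* Defs.v *)
From HB Require Import structures.
From mathcomp Require Import all_boot all_order all_algebra.
From mathcomp Require Import all_classical all_reals all_analysis.
From mathcomp Require Import ess_sup_inf.

Set Implicit Arguments.
Unset Strict Implicit.
Unset Printing Implicit Defensive.

Import Order.TTheory GRing.Theory Num.Theory.
Import numFieldNormedType.Exports.

Local Open Scope classical_set_scope.
Local Open Scope ring_scope.

(* The norm that R * R carries in the library is the sup norm; it is used here
   only through the topology and the derivatives it induces. All lengths are
   Euclidean, see [enorm]. *)
Notation plane R := (R * R)%type (only parsing).

Notation leb R := (@lebesgue_measure R).

Definition leb2 (R : realType) :
    set (measurableTypeR R * measurableTypeR R) -> \bar R :=
  (leb R \x leb R)%E.

HB.instance Definition _ (R : realType) := Measure.on (@leb2 R).

Lemma leb2_sigma_finite (R : realType) : sigma_finite setT (@leb2 R).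
Proof.
have /sigma_finiteP[F [TF ndF Foo]] := sigma_finiteT (leb R).
exists (fun n => F n `*` F n).
  rewrite -setXTT TF predeqE => -[x y]; split.
    move=> [/= [n _ Fnx] [k _ Gky]]; exists (maxn n k) => //; split.
    - by move: x Fnx; exact/subsetPset/ndF/leq_maxl.
    - by move: y Gky; exact/subsetPset/ndF/leq_maxr.
  by move=> [n _ []/= ? ?]; split; exists n.
move=> k; have [? ?] := Foo k.
split; first exact: measurableX.
by rewrite [X in (X < _)%E]product_measure1E// lte_mul_pinfty// ge0_fin_numE.
Qed.

HB.instance Definition _ (R : realType) :=
  Measure_isSigmaFinite.Build _ _ _ (@leb2 R) (@leb2_sigma_finite R).

Section Plane.
Context {R : realType}.
Implicit Types (x y : plane R) (S U : set (plane R)).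

Definition dotp x y : R := x.1 * y.1 + x.2 * y.2.

Definition enorm x : R := Num.sqrt (dotp x x).

Definition vintegral S (f : plane R -> plane R) : plane R :=
  (Rintegral (@leb2 R) S (fun y => (f y).1),
   Rintegral (@leb2 R) S (fun y => (f y).2)).

Definition abs_continuous (a b : R) (f : R -> plane R) : Prop :=
  forall e : R, 0 < e -> exists2 d : R, 0 < d &
    forall (n : nat) (l r : 'I_n -> R),
      (forall i, a <= l i /\ l i <= r i /\ r i <= b) ->
      trivIset setT (fun i => `]l i, r i[%classic : set R) ->
      \sum_i (r i - l i) < d ->
      \sum_i enorm (f (r i) - f (l i)) < e.

(* All iterated directional derivatives exist and are differentiable. *)
Definition smooth (f : plane R -> R) : Prop :=
  forall (us : seq (plane R)) x,
    differentiable (foldr (fun u g => 'D_u g) f us : plane R -> R) x.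

Definition mollifier (eps : R) (eta : plane R -> R) : Prop :=
  [/\ smooth eta,
      forall x, 0 <= eta x,
      forall x, eta (- x) = eta x,
      forall x, eps <= enorm x -> eta x = 0 &
      (\int[@leb2 R]_x (eta x)%:E = 1)%E].

Definition mollify (eta : plane R -> R) (v : R -> plane R -> plane R)
    (t : R) x : plane R :=
  vintegral setT (fun z => eta z *: v t (x - z)).

Definition closed_convex_hull S : set (plane R) :=
  \bigcap_(C in [set C : set (plane R) |
                [/\ closed C, convex_set C & S `<=` C]]) C.

(* [negligible] means contained in a null Borel set, so that this is the
   essential range of f on U also when f is only Lebesgue measurable. *)
Definition ess_values (f : plane R -> plane R) U : set (plane R) :=
  [set w | forall r : R, 0 < r ->
     ~ (@leb2 R).-negligible [set y | U y /\ enorm (f y - w) < r]].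

Definition filippov (v : R -> plane R -> plane R) (t : R) x : set (plane R) :=
  \bigcap_(U in nbhs x) closed_convex_hull (ess_values (v t) U).

Definition filippov_trajectory (T : R) (v : R -> plane R -> plane R)
    (x : R -> plane R) : Prop :=
  abs_continuous 0 T x /\
  {ae leb R, forall t : R, 0 < t < T ->
     exists2 w, is_derive t 1 x w & filippov v t (x t) w}.

(* Trajectories on the torus are represented by their lifts to the plane. *)
Definition filippov_flow (T : R) (v : R -> plane R -> plane R)
    (Phi : R -> plane R -> plane R) : Prop :=
  forall x0, Phi 0 x0 = x0 /\ filippov_trajectory T v (fun t => Phi t x0).

Definition Linf_norm (f : plane R -> plane R) : \bar R :=
  ess_sup (@leb2 R) (fun x => (enorm (f x))%:E).

(* Measurability on (0,T) x R^2 for the completed product measure. *)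
Definition lebesgue_measurable_field (T : R)
    (v : R -> plane R -> plane R) : Prop :=
  exists2 w : R * plane R -> plane R, measurable_fun setT w &
    {ae (leb R \x @leb2 R)%E, forall p, 0 < p.1 < T -> v p.1 p.2 = w p}.

Definition one_sided_lipschitz (T : R) (v : R -> plane R -> plane R)
    (L : R -> R) : Prop :=
  {ae leb R, forall t : R, 0 < t < T ->
     forall x y, dotp (v t x - v t y) (x - y) <= L t * enorm (x - y) ^+ 2}.

End Plane.

Section Torus.
Context {R : realType}.
Variables l1 l2 : plane R.
Implicit Types (x y : plane R).

Definition lin_indep : Prop :=
  forall a b : R, a *: l1 + b *: l2 = 0 -> a = 0 /\ b = 0.

Definition lattice : set (plane R) :=
  [set k | exists m n : int, k = m%:~R *: l1 + n%:~R *: l2].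

Definition lattice_periodic (A : Type) (f : plane R -> A) : Prop :=
  forall x k, lattice k -> f (x + k) = f x.

(* The quotient torus as a measurable space: functions on the torus are
   periodic functions on the plane, Borel sets of the torus are periodic Borel
   sets of the plane, and measures on the torus are measures on the
   sigma-algebra formed by the latter. *)
Definition periodic_borel : set (set (plane R)) :=
  [set A | measurable A /\ forall x k, lattice k -> A (x + k) <-> A x].

Definition torus := g_sigma_algebraType periodic_borel.

Definition fundamental_domain : set (plane R) :=
  [set x | exists a b : R,
     [/\ 0 <= a < 1, 0 <= b < 1 & x = a *: l1 + b *: l2]].

Definition tdist x y : R := inf [set enorm (x - y - k) | k in lattice].

Definition tvol (A : set (plane R)) : R :=
  fine (@leb2 R (A `&` fundamental_domain)).

Definition tintegral (A : set (plane R)) (f : plane R -> R) : R :=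
  Rintegral (@leb2 R) (A `&` fundamental_domain) f.

(* The measure on the torus with density rho. *)
Definition density_measure (rho : plane R -> R) : set torus -> \bar R :=
  fun A => (\int[@leb2 R]_(x in A `&` fundamental_domain) (rho x)%:E)%E.

Definition coupling (mu nu : set torus -> \bar R)
    (pi : {measure set (torus * torus)%type -> \bar R}) : Prop :=
  forall A : set torus, measurable A ->
    pi (A `*` setT) = mu A /\ pi (setT `*` A) = nu A.

Definition W1 (mu nu : set torus -> \bar R) : \bar R :=
  ereal_inf [set (\int[pi]_p (tdist p.1 p.2)%:E)%E |
    pi in [set pi : {measure set (torus * torus)%type -> \bar R} |
           coupling mu nu pi]].

Section Voronoi.
Variable N : nat.
Implicit Types (X : 'I_N -> plane R) (i : 'I_N).

Definition distinct X : Prop := forall i j, i != j -> ~ lattice (X i - X j).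

Definition cell X i : set (plane R) :=
  [set x | forall j, j != i -> tdist x (X i) < tdist x (X j)].

Definition cell_vol X i : R := tvol (cell X i).

Definition planar_cell X i : set (plane R) :=
  [set y | forall j k, lattice k -> enorm (y - X i) <= enorm (y - X j - k)].

(* The displacement from the generator to the centroid of its cell. *)
Definition centroid_disp X i : plane R :=
  (cell_vol X i)^-1 *: vintegral (planar_cell X i) (fun y => y - X i).

Definition quantization_energy X : R :=
  \sum_i tintegral (cell X i) (fun x => tdist x (X i) ^+ 2).

Definition centroid_defect X : R :=
  \sum_i cell_vol X i * enorm (centroid_disp X i) ^+ 2.

Definition mesh_size : R := Num.sqrt (tvol setT / N%:R).

(* Caratheodory solutions, lifted to the plane; the right-hand side is only
   defined on configurations of distinct generators. *)
Definition generator_solution (T : R) (w : R -> plane R -> plane R)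
    (X0 : 'I_N -> plane R) (X : R -> 'I_N -> plane R) : Prop :=
  [/\ X 0 = X0,
      forall t : R, 0 <= t <= T -> distinct (X t),
      forall i, abs_continuous 0 T (fun t => X t i) &
      {ae leb R, forall t : R, 0 < t < T -> forall i,
         is_derive t 1 (fun s => X s i)
           (w t (X t i) +
            (centroid_defect (X t) / mesh_size `^ (5 / 2)) *:
              centroid_disp (X t) i)}].

Definition histogram (rho0 : plane R -> R) (X0 X : 'I_N -> plane R) x : R :=
  \sum_i tintegral (cell X0 i) rho0 / cell_vol X i * \1_(cell X i) x.

End Voronoi.

End Torus.

Arguments density_measure {R} l1 l2 rho _.
Arguments W1 {R} l1 l2 mu nu.

(* Main.v *)
Require Import Defs.
From HB Require Import structures.
From mathcomp Require Import all_boot all_order all_algebra.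
From mathcomp Require Import all_classical all_reals all_analysis.
From mathcomp Require Import measurable_realfun ess_sup_inf.
From mathcomp Require Import zify ring lra.

Set Implicit Arguments.
Unset Strict Implicit.
Unset Printing Implicit Defensive.

Import Order.TTheory GRing.Theory Num.Theory.
Import numFieldNormedType.Exports.

Local Open Scope classical_set_scope.
Local Open Scope ring_scope.

(* Let E(X) be the integral over the torus of the squared distance to the nearest generator.
   Freezing the Voronoi cells gives a quadratic majorant of E that touches it at X, so along
   the generator system E' <= 4 L E - 2 G^2 / H with H = h^(5/2): the one-sided Lipschitz
   condition, integrated by parts against the squared distance, controls the transport term,
   and the centroid term dissipates. Hence E stays of order h^2; a point at distance r from all
   generators forces E >= c r^4, so all cells keep a radius of order h^(1/2).

   For a Filippov trajectory starting in the initial cell i, the distance to the lifted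
   generator x_i, regularized at scale eps^(1/2), grows at rate 2 L up to the mollification
   error and the forcing (G / H) |c_i - x_i|, of order h^(1/2) G / H. By Young's inequality
   that forcing is absorbed in the dissipation of a multiple of E, at the cost h^(1/4). Sending
   the mass of each initial cell uniformly onto the corresponding cell at time t, against its
   image under the flow, couples the two measures at distance of order h^(1/4) + eps^(1/2). *)

(** The exponents come from one balance. The cells have radius of order h^(1/2), so with H = h^(5/2)
    and Young parameter lambda the centroid forcing leaves the two terms h^(1/2) lambda / H and
    h^(1/2) h^2 / lambda; they agree at lambda = h^(9/4), where both equal h^(1/4). Two obstacles
    shape the proof. In time, the energy, an integral of a minimum, is never differentiated, and the
    field is controlled only at almost every time. Each estimate therefore says that a functional,
    weighted by exponentials of the primitive of L, is nonincreasing; this follows from absolute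
    continuity and from differentiable majorants touching it at almost every time. In space, [v] is
    evaluated pointwise at the generators but is measurable only up to null sets; integrals use a
    Borel version [u], and one passes between the open cells of the torus and the closed cells of
    the plane outside the null set of bisectors. *)

Lemma plane_eq (R : realType) (x y : plane R) : x.1 = y.1 -> x.2 = y.2 -> x = y.
Proof. by case: x y => [a b] [c d] /= -> ->. Qed.

Ltac vec := apply: plane_eq; rewrite /= /GRing.scale /=; ring.

(** * Euclidean norm and inner product on the plane *)

Section Euclid.
Context {R : realType}.
Implicit Types (x y z : plane R) (a : R).

Lemma dotpC x y : dotp x y = dotp y x.
Proof. by rewrite /dotp mulrC [x.2 * _]mulrC. Qed.

Lemma dotpDl x y z : dotp (x + y) z = dotp x z + dotp y z.
Proof. by rewrite /dotp /=; ring. Qed.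

Lemma dotpNl x y : dotp (- x) y = - dotp x y.
Proof. by rewrite /dotp /=; ring. Qed.

Lemma dotpBl x y z : dotp (x - y) z = dotp x z - dotp y z.
Proof. by rewrite dotpDl dotpNl. Qed.

Lemma dotpZl a x y : dotp (a *: x) y = a * dotp x y.
Proof. by rewrite /dotp /= /GRing.scale /=; ring. Qed.

Lemma dotpDr x y z : dotp x (y + z) = dotp x y + dotp x z.
Proof. by rewrite dotpC dotpDl !(dotpC x). Qed.

Lemma dotpBr x y z : dotp x (y - z) = dotp x y - dotp x z.
Proof. by rewrite dotpC dotpBl !(dotpC x). Qed.

Lemma dotpZr a x y : dotp x (a *: y) = a * dotp x y.
Proof. by rewrite dotpC dotpZl dotpC. Qed.

Lemma dotp_ge0 x : 0 <= dotp x x.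
Proof. by rewrite addr_ge0// -expr2 sqr_ge0. Qed.

Lemma enorm_ge0 x : 0 <= enorm x.
Proof. exact: sqrtr_ge0. Qed.

Lemma enorm_sqr x : enorm x ^+ 2 = dotp x x.
Proof. by rewrite sqr_sqrtr// dotp_ge0. Qed.

Lemma enorm_le x a : 0 <= a -> (enorm x <= a) = (dotp x x <= a ^+ 2).
Proof. by move=> a0; rewrite -enorm_sqr ler_sqr// nnegrE enorm_ge0. Qed.

Lemma dotp_le x y : dotp x y <= enorm x * enorm y.
Proof.
have : dotp x y ^+ 2 <= (enorm x * enorm y) ^+ 2.
  rewrite exprMn !enorm_sqr /dotp -subr_ge0.
  rewrite (_ : _ - _ = (x.1 * y.2 - x.2 * y.1) ^+ 2) ?sqr_ge0//; ring.
have p0 : 0 <= enorm x * enorm y by rewrite mulr_ge0// enorm_ge0.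
have [d0|d0] := leP 0 (dotp x y); first by rewrite ler_sqr.
by move=> _; rewrite (le_trans (ltW d0)).
Qed.

Lemma enormN x : enorm (- x) = enorm x.
Proof. by rewrite /enorm /dotp /= !mulrNN. Qed.

Lemma enormB x y : enorm (x - y) = enorm (y - x).
Proof. by rewrite -enormN opprB. Qed.

Lemma enormD x y : enorm (x + y) <= enorm x + enorm y.
Proof.
rewrite enorm_le ?addr_ge0 ?enorm_ge0// dotpDl !dotpDr sqrrD !enorm_sqr.
by have := dotp_le x y; rewrite (dotpC y); lra.
Qed.

Lemma enorm_triangle z x y : enorm (x - y) <= enorm (x - z) + enorm (z - y).
Proof. by rewrite (le_trans _ (enormD _ _))// addrA subrK. Qed.

Lemma dotp_ler_norm x y : `|dotp x y| <= enorm x * enorm y.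
Proof. by rewrite ler_norml dotp_le andbT lerNl -dotpNl -(enormN x) dotp_le. Qed.

Lemma enorm0 : enorm (0 : plane R) = 0.
Proof. by rewrite /enorm /dotp mulr0 addr0 sqrtr0. Qed.

Lemma enormZ a x : enorm (a *: x) = `|a| * enorm x.
Proof. by rewrite /enorm dotpZl dotpZr mulrA -expr2 sqrtrM ?sqr_ge0// sqrtr_sqr. Qed.

Lemma norm1_le_enorm x : `|x.1| <= enorm x.
Proof.
rewrite -(sqrtr_sqr x.1) ler_wsqrtr// /dotp expr2 lerDl.
by rewrite -expr2 sqr_ge0.
Qed.

Lemma norm2_le_enorm x : `|x.2| <= enorm x.
Proof.
rewrite -(sqrtr_sqr x.2) ler_wsqrtr// /dotp expr2 lerDr.
by rewrite -expr2 sqr_ge0.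
Qed.

Lemma enorm_eq0 x : enorm x = 0 -> x = 0.
Proof.
move=> x0; apply: plane_eq; apply/eqP; rewrite -normr_le0 -x0.
  exact: norm1_le_enorm.
exact: norm2_le_enorm.
Qed.

Lemma enorm_le_norm12 x : enorm x <= `|x.1| + `|x.2|.
Proof.
rewrite enorm_le ?addr_ge0// sqrrD !real_normK ?num_real// /dotp -!expr2.
by rewrite lerD// lerDl mulrn_wge0// mulr_ge0.
Qed.

Lemma enorm_sqrD x y : enorm (x + y) ^+ 2 = enorm x ^+ 2 + 2 * dotp x y + enorm y ^+ 2.
Proof. by rewrite !enorm_sqr /dotp /=; ring. Qed.

Lemma enorm_lerB_dist x y : `|enorm x - enorm y| <= enorm (x - y).
Proof.
rewrite ler_norml; apply/andP; split.
  by rewrite lerNl opprB lerBlDr enormB (le_trans _ (enormD _ _))// subrK.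
by rewrite lerBlDr (le_trans _ (enormD _ _))// subrK.
Qed.

End Euclid.

Lemma le_mu d (T : measurableType d) (R : realType)
    (mu : {measure set T -> \bar R}) (A B : set T) :
  measurable A -> measurable B -> A `<=` B -> (mu A <= mu B)%E.
Proof. by move=> mA mB AB; apply: le_measure; rewrite ?inE. Qed.

Lemma is_derive_approx (R : realType) (V : normedModType R) (g : R -> V) (c : R) k (e : R) :
  is_derive c 1 g k -> 0 < e -> exists2 r, 0 < r &
    forall s, `|s - c| < r -> `|g s - g c - (s - c) *: k| <= e * `|s - c|.
Proof.
move=> [gd gk] e0.
have : (fun h : R => h^-1 *: (g (h *: 1 + c) - g c)) @ 0^' --> k by rewrite -gk.
move=> /cvgrPdist_le /(_ e e0) [r /= r0 rP]; exists r => // s sc.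
have [->|sc0] := eqVneq s c; first by rewrite !subrr scale0r subrr !normr0 mulr0.
have h0 : s - c != 0 by rewrite subr_eq0.
have := rP (s - c); rewrite /= sub0r normrN => /(_ sc h0).
rewrite /GRing.scale/= mulr1 subrK -[`|k - _|]normrN opprB => rk.
rewrite (_ : g s - g c - _ = (s - c) *: ((s - c)^-1 *: (g s - g c) - k)).
  by rewrite normrZ mulrC ler_wpM2r.
by rewrite scalerBr scalerA divff// scale1r.
Qed.

(** * Absolute continuity *)

Section AbsoluteContinuity.
Context {R : realType}.
Variable T : R.
Implicit Types (w : R -> R -> R) (f : R -> R).

(* For an interval function [w]; [abs_continuous 0 T f] is the case
   [w l r = enorm (f r - f l)]. *)
Definition ac w : Prop :=
  forall e : R, 0 < e -> exists2 d : R, 0 < d &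
    forall (n : nat) (l r : 'I_n -> R),
      (forall i, 0 <= l i /\ l i <= r i /\ r i <= T) ->
      trivIset setT (fun i => `]l i, r i[%classic : set R) ->
      \sum_i (r i - l i) < d ->
      \sum_i w (l i) (r i) < e.

Lemma ac_le w1 w2 :
  (forall l r, 0 <= l -> l <= r -> r <= T -> w1 l r <= w2 l r) -> ac w2 -> ac w1.
Proof.
move=> w12 w2ac e e0; have [d d0 dP] := w2ac e e0; exists d => // n l r lr tlr sd.
apply: le_lt_trans (dP n l r lr tlr sd); apply: ler_sum => i _.
by have [? [? ?]] := lr i; exact: w12.
Qed.

Lemma acD w1 w2 : ac w1 -> ac w2 -> ac (fun l r => w1 l r + w2 l r).
Proof.
move=> a1 a2 e e0; have e20 : 0 < e / 2 by rewrite divr_gt0.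
have [d1 d10 d1P] := a1 _ e20; have [d2 d20 d2P] := a2 _ e20.
exists (Num.min d1 d2); first by rewrite lt_min d10.
move=> n l r lr tlr; rewrite lt_min => /andP[sd1 sd2].
by rewrite big_split/= (splitr e) ltrD// ?d1P ?d2P.
Qed.

Lemma acZ (K : R) w : 0 <= K -> ac w -> ac (fun l r => K * w l r).
Proof.
move=> K0 aw e e0; have K1 : 0 < K + 1 by rewrite ltr_wpDl.
have [d d0 dP] := aw (e / (K + 1)) (divr_gt0 e0 K1); exists d => // n l r lr tlr sd.
have := dP n l r lr tlr sd; rewrite -mulr_sumr ltr_pdivlMr// => s.
have [s0|s0] := leP 0 (\sum_(i < n) w (l i) (r i)); first by rewrite (le_lt_trans _ s)//; nra.
by rewrite (le_lt_trans _ e0)// mulr_ge0_le0// ltW.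
Qed.

Lemma ac_id : ac (fun l r => r - l).
Proof. by move=> e e0; exists e. Qed.

Lemma ac_sum (I : finType) (w : I -> R -> R -> R) :
  (forall i, ac (w i)) -> ac (fun l r => \sum_i w i l r).
Proof.
move=> aw; rewrite -[index_enum I]/(index_enum _).
elim: (index_enum I) => [|i s IHs].
  by move=> e e0; exists 1 => // n l r _ _ _; rewrite big1// => i _; rewrite big_nil.
apply: (@ac_le _ (fun l r => w i l r + \sum_(j <- s) w j l r)).
  by move=> l r _ _ _; rewrite big_cons.
exact: acD.
Qed.

Lemma ac_cont f : ac (fun l r => `|f r - f l|) ->
  forall e, 0 < e -> exists2 d, 0 < d &
    forall l r, 0 <= l -> l <= r -> r <= T -> r - l < d -> `|f r - f l| < e.
Proof.
move=> af e e0; have [d d0 dP] := af e e0; exists d => // l r l0 lr rT rld.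
have := dP 1%N (fun=> l) (fun=> r); rewrite !big_ord_recl !big_ord0 !addr0; apply => //.
by move=> i j _ _ _; rewrite !ord1.
Qed.

(* The derivative is only controlled through majorants touching [f] from above. The
   exceptional times are covered by an open set [U] of small measure, [phi s] bounds the
   variation of [f] on the part of [U] before [s], and the inequality
   [f s <= f 0 + h * s + phi s] propagates along [0, T]. *)
Lemma ac_nonincreasing f : 0 < T -> ac (fun l r => `|f r - f l|) ->
  {ae leb R, forall t, 0 < t < T -> exists (g : R -> R) c,
     [/\ forall s, t <= s <= T -> f s <= g s, g t = f t, is_derive t 1 g c & c <= 0]} ->
  forall t, 0 <= t <= T -> f t <= f 0.
Proof.
move=> T0 fac aef t tT.
suff H (h e : R) : 0 < h -> 0 < e -> f t <= f 0 + h * t + e.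
  apply/ler_addgt0Pr => e e0; case/andP: tT => t0 tT.
  have p : 0 < 2 * (t + 1) by rewrite mulr_gt0// ltr_wpDl.
  have := H (e / (2 * (t + 1))) (e / 2) (divr_gt0 e0 p) (divr_gt0 e0 (ltr0Sn _ 1)).
  have : e / (2 * (t + 1)) * t <= e / 2.
    by rewrite mulrAC ler_pdivrMr//; nra.
  by lra.
move=> h0 e0; have [d d0 dP] := fac e e0.
have [N [mN N0 aeN]] := aef.
(* At the initial time no majorant is given; putting 0 into the exceptional set makes [U] a
   neighborhood of it. *)
have mN0 : measurable (N `|` [set 0]) by exact: measurableU.
have N00 : leb R (N `|` [set 0]) = 0%E.
  apply/eqP; rewrite -measure_le0 (le_trans (measureU2 _ _ _))//.
  by rewrite [X in (X + _)%E]N0 [X in (_ + X)%E]lebesgue_measure_set1 adde0.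
have [U [oU NU Ud]] := lebesgue_regularity_outer mN0 (eq_ind_r (fun x => (x < +oo)%E) (ltry 0) N00) d0.
have mU : measurable U by exact: open_measurable.
have {}Ud : (leb R U < d%:E)%E.
  rewrite -(setDUK NU) measureU//; last 2 first.
  - exact: measurableD.
  - by rewrite setDIK.
  by rewrite [X in (X + _)%E]N00 add0e.
pose m s := fine (leb R (U `&` `[0, s])).
have mUs s : @measurable _ (measurableTypeR R) (U `&` `[0, s]) by exact: measurableI.
have leU s : (leb R (U `&` `[0%R, s]) <= leb R U)%E by apply: le_mu; [exact: mUs|exact: mU|move=> x []].
have finU s : leb R (U `&` `[0, s]) \is a fin_num.
  by rewrite ge0_fin_numE// (le_lt_trans (leU s))// (lt_trans Ud) ?ltry.
have m0 s : 0 <= m s by rewrite fine_ge0.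
have md s : m s < d by rewrite -lte_fin fineK// (le_lt_trans (leU s)).
have mm s s' : s <= s' -> m s <= m s'.
  move=> ss'; rewrite fine_le//; apply: le_mu; [exact: mUs|exact: mUs|].
  by apply: setIS => x /=; rewrite !in_itv/= => /andP[-> xs]; rewrite (le_trans xs).
have mU' a b : 0 <= a -> a <= b -> `[a, b] `<=` U -> m a + (b - a) <= m b.
  move=> a0 ab abU.
  have disj : (U `&` `[0, a]) `&` `]a, b] = set0.
    by apply/seteqP; split => // x [[_ /=]]; rewrite !in_itv/= => /andP[_ xa] /andP[/lt_le_trans/(_ xa)]; rewrite ltxx.
  have -> : b - a = fine (leb R `]a, b]).
    rewrite lebesgue_measure_itv/= lte_fin; case: ltP => [_|ba] /=; first by [].
    by have -> : a = b by [apply/eqP; rewrite eq_le ab]; rewrite subrr.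
  have fab : leb R `]a, b] \is a fin_num.
    by rewrite lebesgue_measure_itv/=; case: ifP => // _; rewrite -EFinD.
  have eU : leb R (U `&` `[0%R, a] `|` `]a, b]) = (leb R (U `&` `[0%R, a]) + leb R `]a, b])%E.
    by rewrite measureU//; exact: mUs.
  rewrite /m -fineD// -eU.
  rewrite fine_le//.
    by rewrite eU fin_numD fab finU.
  apply: le_mu; [by apply: measurableU => //; exact: mUs|exact: mUs|].
  move=> x [[Ux /=]|/=]; rewrite !in_itv/= => /andP[x1 x2].
    by split=> //; rewrite x1 (le_trans x2).
  split; first by apply: abU; rewrite /= in_itv/= x2 ltW.
  by rewrite x2 andbT (le_trans a0)// ltW.
(* The intervals need not lie in [U]: only their total length is limited, by [m s]. As [m s < d],
   absolute continuity bounds every such sum by [e]; and appending an interval of [U] is always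
   affordable, since [m] grows by at least its length. *)
pose Fam s := [set x | exists n (l r : 'I_n -> R),
   [/\ forall i, 0 <= l i /\ l i <= r i /\ r i <= s,
      trivIset setT (fun i => `]l i, r i[%classic : set R),
      \sum_i (r i - l i) <= m s & x = \sum_i `|f (r i) - f (l i)|]].
have Fam0 s : Fam s 0.
  exists 0%N, (fun=> 0), (fun=> 0); split => //; last by rewrite big_ord0.
  - by move=> [].
  - by move=> [].
  - by rewrite big_ord0.
have Fame s x : s <= T -> Fam s x -> x <= e.
  move=> sT [n [l [r [lr tlr sm ->]]]]; apply/ltW/dP => //.
    by move=> i; have [? [? rs]] := lr i; split; [|split; [|exact: le_trans sT]].
  exact: le_lt_trans sm (md s).
have Famsup s : s <= T -> has_sup (Fam s).
  by move=> sT; split; [exists 0|exists e => x; exact: Fame].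
pose phi s := sup (Fam s).
have phi0 s : s <= T -> 0 <= phi s by move=> sT; exact/ub_le_sup/Fam0/(Famsup s sT).2.
have phie s : s <= T -> phi s <= e by move=> sT; apply: ge_sup => [|x]; [exists 0|exact: Fame].
have phim a b : a <= b -> b <= T -> phi a <= phi b.
  move=> ab bT; apply: ge_sup => [|x Fx]; [by exists 0|apply: ub_le_sup; first exact: (Famsup b bT).2].
  have [n [l [r [lr tlr sm ->]]]] := Fx; exists n, l, r; split => //.
    by move=> i; have [? [? rs]] := lr i; split; [|split; [|exact: le_trans ab]].
  exact: le_trans sm (mm _ _ ab).
have phiU a b : 0 <= a -> a <= b -> b <= T -> `[a, b] `<=` U -> phi a + `|f b - f a| <= phi b.
  move=> a0 ab bT abU; rewrite -lerBrDr; apply: ge_sup => [|x Fx]; [by exists 0|].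
  rewrite lerBrDr; apply: ub_le_sup; first exact: (Famsup b bT).2.
  have [n [l [r [lr tlr sm ->]]]] := Fx.
  exists n.+1, (fun i => oapp l a (unlift ord0 i)), (fun i => oapp r b (unlift ord0 i)); split.
  - move=> i; case: unliftP => [j _|_] /=; last by [].
    by have [? [? rs]] := lr j; split; [|split; [|exact: le_trans ab]].
  - move=> i j _ _; case: unliftP => [i' ->|->]; case: unliftP => [j' ->|->] //=.
    + by move=> /tlr => /(_ I I) ->.
    + move=> [x0 [/=]]; rewrite !in_itv/= => /andP[_ x1] /andP[x2 _].
      have [_ [_ ra]] := lr i'.
      by have := lt_trans x2 (lt_le_trans x1 ra); rewrite ltxx.
    + move=> [x0 [/=]]; rewrite !in_itv/= => /andP[x2 _] /andP[_ x1].
      have [_ [_ ra]] := lr j'.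
      by have := lt_trans x2 (lt_le_trans x1 ra); rewrite ltxx.
  - rewrite big_ord_recl unlift_none/= addrC.
    rewrite (le_trans _ (mU' _ _ a0 ab abU))// lerD2r.
    by under eq_bigr do rewrite liftK.
  - rewrite big_ord_recl unlift_none/= addrC; congr (_ + _).
    by under [RHS]eq_bigr do rewrite liftK.
pose P s := f s <= f 0 + h * s + phi s.
suff HP : forall s, 0 <= s <= T -> P s.
  by case/andP: (tT) => _ tT'; rewrite (le_trans (HP t tT))// lerD2l phie.
(* Continuous induction: the inequality passes to the supremum [c] of [S] by continuity of [f] and
   monotonicity of [phi], and would extend beyond [c] if [c < T]. *)
pose S := [set s | 0 <= s <= T /\ forall s', 0 <= s' <= s -> P s'].
have S0 : S 0.
  split; first by rewrite lexx ltW.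
  move=> s' s'0; have -> : s' = 0 by apply/eqP; rewrite eq_le andbC.
  by rewrite /P mulr0 addr0 lerDl phi0// ltW.
have Ssup : has_sup S by split; [exists 0|exists T => x [/andP[]]].
pose c := sup S.
have c0 : 0 <= c by apply: ub_le_sup => //; exact: Ssup.2.
have cT : c <= T by apply: ge_sup => [|x [/andP[]]//]; exists 0.
have Pc' s : 0 <= s < c -> P s.
  move=> /andP[s0 sc]; have [x [_ Sx] sx] := sup_gt Ssup.1 sc.
  by apply: Sx; rewrite s0 ltW.
have Pc : P c.
  rewrite /P leNgt; apply/negP => Pc.
  have := Pc; rewrite -subr_gt0 => /(ac_cont fac)[r r0 rP].
  have c1 : 0 < c.
    rewrite lt_neqAle c0 andbT; apply/eqP => c00; move: Pc; rewrite -c00 mulr0 addr0.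
    by apply/negP; rewrite -leNgt lerDl phi0// ltW.
  pose s := Num.max 0 (c - r / 2).
  have sc : s < c by rewrite /s gt_max c1/= ltrBlDr ltrDl divr_gt0.
  have s0 : 0 <= s by rewrite /s le_max lexx.
  have scr : c - s < r by rewrite /s ltrBlDr -ltrBlDl lt_max; apply/orP; right; lra.
  have := rP s c s0 (ltW sc) cT scr.
  have := Pc' s; rewrite s0 sc => /(_ isT); rewrite /P => Ps fsc.
  have := phim s c (ltW sc) cT.
  have := ler_norm (f c - f s); nra.
have Scc : forall s', 0 <= s' <= c -> P s'.
  move=> s' /andP[s'0]; rewrite le_eqVlt => /predU1P[->//|s'c].
  by apply: Pc'; rewrite s'0.
move=> s0 s0T; have [cT'|] := ltP c T; last first.
  by move=> Tc; apply: Scc; case/andP: s0T => -> /le_trans; apply.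
exfalso.
suff [r r0 rP] : exists2 r, 0 < r & forall s, c <= s <= c + r -> s <= T -> P s.
  pose s := Num.min (c + r) T.
  have cs : c < s by rewrite lt_min cT' ltrDl r0.
  suff : S s by move=> /(ub_le_sup Ssup.2); rewrite leNgt cs.
  split; first by rewrite (le_trans c0 (ltW cs))/= /s ge_min lexx orbT.
  move=> s' /andP[s'0 s's]; have [s'c|cs'] := leP s' c; first by apply: Scc; rewrite s'0.
  move: s's; rewrite le_min => /andP[a1 a2].
  by apply: rP => //; rewrite (ltW cs').
(* Inside [U] the increment of [f] is charged to [phi]. Outside, the majorant at [c] has slope at
   most 0, and the error of its first-order expansion is at most [h * (s - c)]. *)
have [Uc|Uc] := pselect (U c).
  have [r /= r0 rU] : \forall x \near c, U x by exact: open_nbhs_nbhs.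
  exists (r / 2); first by rewrite divr_gt0.
  move=> s /andP[cs sr] sT.
  have csU : `[c, s] `<=` U.
    move=> x; rewrite /= in_itv/= => /andP[cx xs]; apply: rU => /=.
    by rewrite ler0_norm ?subr_le0// opprB; lra.
  have := phiU c s c0 cs sT csU; move: Pc; rewrite /P.
  have := ler_norm (f s - f c); nra.
have c00 : 0 < c.
  rewrite lt_neqAle c0 andbT; apply/eqP => c00; apply: Uc; apply: NU; right.
  by rewrite -c00.
have [g [k [fg gc dg k0]]] : exists (g : R -> R) k,
     [/\ forall s, c <= s <= T -> f s <= g s, g c = f c, is_derive c 1 g k & k <= 0].
  apply: contrapT => ng; apply: Uc; apply: NU; left; apply: aeN => /= /(_ _)H.
  by apply: ng; apply: H; rewrite c00.
have [r r0 rP] := is_derive_approx dg h0.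
exists (r / 2); first by rewrite divr_gt0.
move=> s /andP[cs sr] sT; have sc0 : 0 <= s - c by rewrite subr_ge0.
have := rP s; rewrite ger0_norm// => /(_ _)/le_trans-/(_ _ _ (lexx _)) H.
have {}H : `|g s - g c - (s - c) *: k| <= h * (s - c) by apply: H; lra.
have := ler_norm (g s - g c - (s - c) *: k).
have := fg s; rewrite cs sT => /(_ isT).
have := phim c s cs sT; move: Pc; rewrite /P -gc /GRing.scale/=.
have : (s - c) * k <= 0 by rewrite mulr_ge0_le0.
nra.
Qed.

End AbsoluteContinuity.

(** * Measure-theoretic preliminaries on the plane *)

Section Ae.
Context d (T : measurableType d) (R : realType) (mu : {measure set T -> \bar R}).

Lemma aeS (P Q : T -> Prop) : (forall x, P x -> Q x) ->
  {ae mu, forall x, P x} -> {ae mu, forall x, Q x}.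
Proof. by move=> PQ; apply: filterS. Qed.

Lemma aeI (P Q : T -> Prop) :
  {ae mu, forall x, P x} -> {ae mu, forall x, Q x} -> {ae mu, forall x, P x /\ Q x}.
Proof. by apply: filterS2. Qed.

Lemma ae_forall_nat (P : nat -> T -> Prop) :
  (forall n, {ae mu, forall x, P n x}) -> {ae mu, forall x, forall n, P n x}.
Proof.
move=> /negligible_bigcup; apply: negligibleS => x /=.
by move=> /existsNP[n Pn]; exists n.
Qed.

Lemma ae_forall_count (I : countType) (P : I -> T -> Prop) :
  (forall i, {ae mu, forall x, P i x}) -> {ae mu, forall x, forall i, P i x}.
Proof.
move=> H; have : forall n, {ae mu, forall x, forall i, unpickle n = Some i -> P i x}.
  move=> n; case: (unpickle n) => [i|]; last by apply: aeW.
  by apply: aeS (H i) => x Px j [<-].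
move=> /ae_forall_nat; apply: aeS => x Px i.
by apply: (Px (pickle i)); rewrite pickleK.
Qed.

End Ae.

Section AeIntegral.
Context d (T : measurableType d) (R : realType) (mu : {measure set T -> \bar R}).
Import HBNNSimple.

(** The integral of a nonnegative function is a supremum over the simple functions below it,
    measurable or not; such a simple function is cut to zero on the null set where the inequality
    fails. This serves integrands not known to be measurable: those containing [v t], and the
    transport cost on the torus. *)
Lemma ge0_le_integral_nomeas (f g : T -> \bar R) : (forall x, 0 <= f x)%E -> (forall x, 0 <= g x)%E ->
  {ae mu, forall x, (f x <= g x)%E} -> (\int[mu]_x f x <= \int[mu]_x g x)%E.
Proof.
move=> f0 g0 [N [mN N0 sN]]; rewrite ge0_integralTE// ge0_integralTE//.
apply: ge_ereal_sup => _ [h /= hf <-].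
have mNC : measurable (~` N) by exact: measurableC.
pose k := mul_nnsfun h (indic_nnsfun R mNC).
have -> : sintegral mu h = sintegral mu k.
  have S (l : {nnsfun T >-> R}) : sintegral mu l = (\int[mu]_x (l x)%:E)%E.
    by rewrite integral_nnsfun// patch_setT.
  rewrite !S.
  apply: ae_eq_integral => //; [exact/measurable_EFinP|exact/measurable_EFinP|].
  exists N; split => // x /= /not_implyP[_ hk]; apply: contrapT => Nx; apply: hk.
  by rewrite /k /= mindicE mem_set// mulr1.
apply: ereal_sup_ubound; exists k => //= x.
rewrite /k /= mindicE; have [Nx|Nx] := boolP (x \in ~` N).
  rewrite mulr1 (le_trans (hf x))//.
  by apply: contrapT => fg; move: Nx; rewrite inE; apply; exact: sN.
by rewrite mulr0.
Qed.

Lemma ae_eq_integral_nomeas (D : set T) (f g : T -> \bar R) :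
  {ae mu, forall x, D x -> f x = g x} -> (\int[mu]_(x in D) f x = \int[mu]_(x in D) g x)%E.
Proof.
move=> fg.
suff H (u v : T -> \bar R) : (forall x, 0 <= u x)%E -> (forall x, 0 <= v x)%E ->
    {ae mu, forall x, u x = v x} -> (\int[mu]_x u x = \int[mu]_x v x)%E.
  rewrite integralE [RHS]integralE; congr (_ - _)%E; rewrite integral_mkcond [RHS]integral_mkcond.
    apply: H => [x|x|]; [by apply: erestrict_ge0|by apply: erestrict_ge0|].
    apply: filterS fg => x fg; rewrite !patchE; case: ifPn => //; rewrite inE => /fg.
    by move=> e; rewrite !funeposE e.
  apply: H => [x|x|]; [by apply: erestrict_ge0|by apply: erestrict_ge0|].
  apply: filterS fg => x fg; rewrite !patchE; case: ifPn => //; rewrite inE => /fg.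
  by move=> e; rewrite !funenegE e.
by move=> u0 v0 uv; apply/eqP; rewrite eq_le !ge0_le_integral_nomeas//; apply: aeS uv => x ->.
Qed.

End AeIntegral.

Section Plane.
Context {R : realType}.
Notation mP := (measurableTypeR R * measurableTypeR R)%type.

Lemma measurable_translate1 (a : R) :
  measurable_fun [set: measurableTypeR R] ((fun x => x + a) : measurableTypeR R -> measurableTypeR R).
Proof. exact: (measurable_funD (f := id) (g := cst a)). Qed.

Lemma leb_translate (a : R) (A : set (measurableTypeR R)) : measurable A ->
  leb R ((fun x => x + a) @^-1` A) = leb R A.
Proof.
move=> mA.
pose F : {mfun measurableTypeR R >-> measurableTypeR R} :=
  HB.pack_for {mfun measurableTypeR R >-> measurableTypeR R}
    ((fun x => x + a) : measurableTypeR R -> measurableTypeR R)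
    (isMeasurableFun.Build _ _ _ _ _ (measurable_translate1 a)).
symmetry; apply: (@lebesgue_measure_unique R (pushforward (leb R) F)) => //= _ [[b c]] _ <-.
rewrite /pushforward (_ : _ @^-1` _ = `]b - a, c - a]%classic); last first.
  by apply/seteqP; split => x /=; rewrite !in_itv/= ltrBlDr lerBrDr.
rewrite [RHS]lebesgue_measure_itv [LHS]lebesgue_measure_itv/= !lte_fin ltrD2r -!EFinB.
by congr (if _ then _ else _); congr EFin; ring.
Qed.

Lemma measurable_translate2 (a : plane R) :
  measurable_fun [set: mP] ((fun x => x + a) : mP -> mP).
Proof.
apply/measurable_fun_pairP; split.
  exact: (measurable_funD (f := fst) (g := cst a.1) measurable_fst).
exact: (measurable_funD (f := snd) (g := cst a.2) measurable_snd).
Qed.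

Lemma measurable_opp2 : measurable_fun [set: mP] ((fun x => - x) : mP -> mP).
Proof.
apply/measurable_fun_pairP; split.
  exact: (measurable_funN (f := fst) measurable_fst).
exact: (measurable_funN (f := snd) measurable_snd).
Qed.

(** Rectangles determine the product measure, and on them the claim is one-dimensional. *)
Lemma leb2_translate (a : plane R) (A : set mP) : measurable A ->
  @leb2 R ((fun x => x + a) @^-1` A) = @leb2 R A.
Proof.
move=> mA.
pose F : {mfun mP >-> mP} :=
  HB.pack_for {mfun mP >-> mP} ((fun x => x + a) : mP -> mP)
    (isMeasurableFun.Build _ _ _ _ _ (measurable_translate2 a)).
symmetry; apply: (@product_measure_unique _ _ _ _ R (leb R) (leb R) (pushforward (@leb2 R) F)) => //.
move=> B C mB mC.
rewrite -[LHS]/(@leb2 R (((fun x => x + a.1) @^-1` B) `*` ((fun x => x + a.2) @^-1` C))).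
rewrite [LHS]product_measure1E.
- by congr (_ * _)%E; exact: leb_translate.
- by rewrite -[X in measurable X]setTI; exact: measurable_translate1.
- by rewrite -[X in measurable X]setTI; exact: measurable_translate1.
Qed.

Lemma leb2_opp (A : set mP) : measurable A ->
  @leb2 R ((fun x => - x) @^-1` A) = @leb2 R A.
Proof.
move=> mA.
pose F : {mfun mP >-> mP} :=
  HB.pack_for {mfun mP >-> mP} ((fun x => - x) : mP -> mP)
    (isMeasurableFun.Build _ _ _ _ _ measurable_opp2).
symmetry; apply: (@product_measure_unique _ _ _ _ R (leb R) (leb R) (pushforward (@leb2 R) F)) => //.
move=> B C mB mC.
rewrite -[LHS]/(@leb2 R ((-%R @^-1` B) `*` (-%R @^-1` C))).
have mN (D : set (measurableTypeR R)) : measurable D -> @measurable _ (measurableTypeR R) (-%R @^-1` D).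
  by move=> mD; rewrite -[X in measurable X]setTI; exact: oppr_measurable.
rewrite [LHS]product_measure1E; [|exact: mN|exact: mN].
by congr (_ * _)%E; exact: lebesgue_measureN.
Qed.

(** The sigma-algebra of [mP] is the product one, so openness enters through a countable union of
    rational squares. *)
Lemma open_measurable2 (U : set (plane R)) : open U -> @measurable _ mP U.
Proof.
move=> oU.
pose B (q : rat * rat * rat) : set mP := `]ratr q.1.1 - ratr q.2, ratr q.1.1 + ratr q.2[%classic `*`
   `]ratr q.1.2 - ratr q.2, ratr q.1.2 + ratr q.2[%classic.
have -> : U = \bigcup_q (if pselect (B q `<=` U) then B q else set0).
  apply/seteqP; split => [x Ux|x [q _]]; last by case: (pselect (B q `<=` U)) => [BU /BU|].
  have /nbhs_ballP[e /= e0 eU] : nbhs x U by exact: open_nbhs_nbhs.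
  have e20 : 0 < e / 2 by rewrite divr_gt0.
  have [p] := rat_in_itvoo e20.
  rewrite in_itv /= => /andP[p0 pe].
  have x1p : x.1 - ratr p < x.1 + ratr p by lra.
  have [q1] := rat_in_itvoo x1p.
  rewrite in_itv /= => /andP[q1x xq1].
  have x2p : x.2 - ratr p < x.2 + ratr p by lra.
  have [q2] := rat_in_itvoo x2p.
  rewrite in_itv /= => /andP[q2x xq2].
  have BU : B (q1, q2, p) `<=` U.
    move=> y [/=]; rewrite !in_itv/= => /andP[y1 y2] /andP[y3 y4]; apply: eU.
    by split; rewrite /ball/= ltr_norml; apply/andP; split; lra.
  exists (q1, q2, p) => //; case: (pselect (B (q1, q2, p) `<=` U)) => [h|//]; split; rewrite /= in_itv/=; apply/andP; split; lra.
apply: countable_bigcupT_measurable => // q; case: (pselect (B q `<=` U)) => h /=; [exact: measurableX|exact: measurable0].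
Qed.

Lemma continuous_measurable2 (f : plane R -> R) : continuous f -> measurable_fun [set: mP] (f : mP -> R).
Proof.
move=> cf; apply: (measurability _ (RGenOpens.measurableE R)) => _ [_ [a [b ->]] <-].
by rewrite setTI; apply: open_measurable2; apply: open_comp => //; exact: interval_open.
Qed.

Lemma measurable_preimage2 (f : plane R -> R) (B : set (measurableTypeR R)) :
  continuous f -> measurable B -> @measurable _ mP (f @^-1` B).
Proof.
move=> cf mB; rewrite -[X in measurable X]setTI.
by have := continuous_measurable2 cf measurableT mB.
Qed.

Lemma ge0_integral_preserving (phi : mP -> mP) (f : mP -> \bar R) :
  measurable_fun [set: mP] phi ->
  (forall A : set mP, measurable A -> @leb2 R (phi @^-1` A) = @leb2 R A) ->
  measurable_fun [set: mP] f -> (forall x, 0 <= f x)%E ->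
  (\int[@leb2 R]_x f (phi x) = \int[@leb2 R]_x f x)%E.
Proof.
move=> mphi phiE mf f0.
pose F : {mfun mP >-> mP} :=
  HB.pack_for {mfun mP >-> mP} phi (isMeasurableFun.Build _ _ _ _ _ mphi).
transitivity (\int[pushforward (@leb2 R) F]_x f x)%E.
  by rewrite (ge0_integral_pushforward mphi (@leb2 R) measurableT) // preimage_setT.
by apply: (@eq_measure_integral _ _ _ _ (@leb2 R) (pushforward (@leb2 R) F)) => A mA _; exact: phiE.
Qed.

Lemma ge0_integral_translate2 (a : plane R) (f : mP -> \bar R) :
  measurable_fun [set: mP] f -> (forall x, 0 <= f x)%E ->
  (\int[@leb2 R]_x f ((x : plane R) + a)%R = \int[@leb2 R]_x f x)%E.
Proof.
by apply: ge0_integral_preserving; [exact: measurable_translate2|exact: leb2_translate].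
Qed.

Lemma ae_translate2 (a : plane R) (P : plane R -> Prop) :
  {ae @leb2 R, forall x, P x} -> {ae @leb2 R, forall x, P (x + a)}.
Proof.
move=> [N [mN N0 sN]]; exists ((fun x => x + a) @^-1` N); split.
- by rewrite -[X in measurable X]setTI; exact: measurable_translate2.
- by rewrite leb2_translate.
- by move=> x /= Px; exact: sN.
Qed.

Lemma ae_opp2 (P : plane R -> Prop) :
  {ae @leb2 R, forall x, P x} -> {ae @leb2 R, forall x, P (- x)}.
Proof.
move=> [N [mN N0 sN]]; exists ((fun x => - x) @^-1` N); split.
- by rewrite -[X in measurable X]setTI; exact: measurable_opp2.
- by rewrite leb2_opp.
- by move=> x /= Px; exact: sN.
Qed.

Lemma ae_sub2 (a : plane R) (P : plane R -> Prop) :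
  {ae @leb2 R, forall x, P x} -> {ae @leb2 R, forall x, P (a - x)}.
Proof.
move=> /(ae_translate2 a)/ae_opp2; apply: aeS => x.
by rewrite addrC.
Qed.

Lemma continuous_fst2 : continuous (fst : plane R -> R).
Proof. by move=> x; exact: cvg_fst. Qed.

Lemma continuous_snd2 : continuous (snd : plane R -> R).
Proof. by move=> x; exact: cvg_snd. Qed.

Lemma continuous_dotpl (a : plane R) : continuous (fun x => dotp x a).
Proof.
move=> x; apply: cvgD; apply: cvgMr_tmp; [exact: cvg_fst|exact: cvg_snd].
Qed.

Lemma lipschitz_continuous2 (K : R) (f : plane R -> R) :
  (forall x y, `|f x - f y| <= K * enorm (x - y)) -> continuous f.
Proof.
move=> fK x; apply/cvgrPdist_lt => e e0.
have K0 : 0 < `|K| + 1 by rewrite ltr_wpDl.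
have d0 : 0 < e / (2 * (`|K| + 1)) by rewrite divr_gt0// mulr_gt0.
exists (ball x.1 (e / (2 * (`|K| + 1))), ball x.2 (e / (2 * (`|K| + 1)))) => /=.
  by split; exact: nbhsx_ballx.
move=> y [/= y1 y2]; rewrite (le_lt_trans (fK _ _))//.
have := enorm_le_norm12 (x - y); have := enorm_ge0 (x - y); have := ler_norm K.
move: y1 y2; rewrite /ball/= !ltr_pdivlMr ?mulr_gt0//; nra.
Qed.

(** A vertical line is a product with a null factor; on any other line the vertical sections are
    single points. Bisectors of generators are null for this reason. *)
Lemma negligible_line (n : plane R) (c : R) : n != 0 ->
  (@leb2 R).-negligible [set x | dotp x n = c].
Proof.
move=> n0.
have mL : @measurable _ mP [set x | dotp x n = c].
  rewrite -[X in measurable X]setTI.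
  exact: (continuous_measurable2 (@continuous_dotpl n) measurableT (measurable_set1 c)).
apply/negligibleP => //.
have [n2|n2] := eqVneq n.2 0.
  have n1 : n.1 != 0.
    by apply: contra n0 => /eqP n1; rewrite [n]surjective_pairing n1 n2.
  rewrite (_ : mkset _ = [set c / n.1] `*` setT).
    rewrite -[LHS]/(@leb2 R _) [LHS]product_measure1E//.
    by rewrite [X in (X * _)%E]lebesgue_measure_set1 mul0e.
  apply/seteqP; split => x /=; rewrite /dotp n2 mulr0 addr0.
    by move=> <-; split => //=; rewrite mulfK.
  by move=> [-> _]; rewrite divfK.
rewrite -[LHS]/(\int[leb R]_x (leb R \o xsection _) x)%E integral0_eq// => x _ /=.
rewrite (_ : xsection _ _ = [set (c - x * n.1) / n.2]) ?lebesgue_measure_set1//.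
apply/seteqP; split => y; rewrite /xsection /= inE /= /dotp /=.
  by move=> <-; rewrite addrAC subrr add0r mulfK.
by move=> ->; rewrite divfK// addrC subrK.
Qed.

(** Measurability of the field is assumed jointly in time and space; the section of a null Borel set
    at almost every time is null, which gives a Borel version of the field at a fixed time. *)
Lemma ae_xsection (P : R * plane R -> Prop) :
  {ae (leb R \x @leb2 R)%E, forall p, P p} ->
  {ae leb R, forall t, {ae @leb2 R, forall x, P (t, x)}}.
Proof.
move=> [N [mN N0 sN]].
have mNx : measurable_fun setT (@leb2 R \o xsection N) by exact: measurable_fun_xsection.
have : ae_eq (leb R) setT (@leb2 R \o xsection N) (cst 0%E).
  apply/ae_eq_integral_abs => //.
  by rewrite -[RHS]N0; apply: eq_integral => t _ /=; rewrite gee0_abs.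
apply: aeS => t /(_ I) /= Nt; exists (xsection N t); split => //.
  exact: measurable_xsection.
by move=> x /= Px; rewrite /xsection/= inE; apply: sN.
Qed.

End Plane.

(** * Lattice geometry and unfolding of integrals *)

Section Lattice.
Context {R : realType}.
Notation mP := (measurableTypeR R * measurableTypeR R)%type.
Variables l1 l2 : plane R.
Hypothesis li : lin_indep l1 l2.

Let det : R := l1.1 * l2.2 - l1.2 * l2.1.

Let det_neq0 : det != 0.
Proof.
apply/eqP => d0.
have /li[l22 l12] : l2.2 *: l1 + (- l1.2) *: l2 = 0.
  by apply: plane_eq; move: d0; rewrite /det /= /GRing.scale/=; [lra|move=> _; ring].
have /li[l21 l11] : (- l2.1) *: l1 + l1.1 *: l2 = 0.
  by apply: plane_eq; move: d0; rewrite /det /= /GRing.scale/=; [move=> _; ring|lra].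
have /li[] : 1 *: l1 + 0 *: l2 = 0.
  rewrite scale0r addr0 scale1r [l1]surjective_pairing l11.
  by move/eqP: l12; rewrite oppr_eq0 => /eqP ->.
by move/eqP; rewrite oner_eq0.
Qed.

Definition coord1 (x : plane R) : R := (x.1 * l2.2 - x.2 * l2.1) / det.
Definition coord2 (x : plane R) : R := (l1.1 * x.2 - l1.2 * x.1) / det.

Lemma coordE x : x = coord1 x *: l1 + coord2 x *: l2.
Proof.
by apply: plane_eq; rewrite /coord1 /coord2 /= /GRing.scale/=; move: det_neq0;
  rewrite /det => ?; field.
Qed.

Lemma coord1K (a b : R) : coord1 (a *: l1 + b *: l2) = a.
Proof.
rewrite /coord1 /= /GRing.scale/= -[RHS](mulfK det_neq0); congr (_ / _).
by rewrite /det; ring.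
Qed.

Lemma coord2K (a b : R) : coord2 (a *: l1 + b *: l2) = b.
Proof.
rewrite /coord2 /= /GRing.scale/= -[RHS](mulfK det_neq0); congr (_ / _).
by rewrite /det; ring.
Qed.

Lemma coord1D x y : coord1 (x + y) = coord1 x + coord1 y.
Proof. by rewrite /coord1 -mulrDl; congr (_ / _) => /=; ring. Qed.

Lemma coord2D x y : coord2 (x + y) = coord2 x + coord2 y.
Proof. by rewrite /coord2 -mulrDl; congr (_ / _) => /=; ring. Qed.

(** A common Lipschitz constant of the two lattice coordinates. Its inverse bounds the nonzero
    lattice vectors from below. *)
Definition coord_cst : R := (enorm l1 + enorm l2) / `|det|.

Lemma coord_cst_ge0 : 0 <= coord_cst.
Proof. by rewrite divr_ge0// addr_ge0// enorm_ge0. Qed.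

Lemma coord1_le x : `|coord1 x| <= coord_cst * enorm x.
Proof.
rewrite /coord1 normrM normfV /coord_cst mulrAC ler_pM2r ?invr_gt0 ?normr_gt0 ?det_neq0//.
have -> : x.1 * l2.2 - x.2 * l2.1 = dotp x (l2.2, - l2.1) by rewrite /dotp /=; ring.
rewrite (le_trans (dotp_ler_norm _ _))// mulrC ler_wpM2r ?enorm_ge0//.
rewrite (_ : enorm (l2.2, - l2.1) = enorm l2) ?lerDr ?enorm_ge0//.
by congr Num.sqrt; rewrite /dotp /=; ring.
Qed.

Lemma coord2_le x : `|coord2 x| <= coord_cst * enorm x.
Proof.
rewrite /coord2 normrM normfV /coord_cst mulrAC ler_pM2r ?invr_gt0 ?normr_gt0 ?det_neq0//.
have -> : l1.1 * x.2 - l1.2 * x.1 = dotp x (- l1.2, l1.1) by rewrite /dotp /=; ring.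
rewrite (le_trans (dotp_ler_norm _ _))// mulrC ler_wpM2r ?enorm_ge0//.
rewrite (_ : enorm (- l1.2, l1.1) = enorm l1) ?lerDl ?enorm_ge0//.
by congr Num.sqrt; rewrite /dotp /=; ring.
Qed.

Definition latp (p : int * int) : plane R := p.1%:~R *: l1 + p.2%:~R *: l2.

Notation lat := (lattice l1 l2).

Lemma latpP p : lat (latp p).
Proof. by exists p.1, p.2. Qed.

Lemma latticeE k : lat k -> exists p, k = latp p.
Proof. by move=> [m [n ->]]; exists (m, n). Qed.

Lemma latp_inj : injective latp.
Proof.
move=> p q pq; rewrite [p]surjective_pairing [q]surjective_pairing; congr pair.
  have := congr1 coord1 pq; rewrite !coord1K => /eqP.
  by rewrite eqr_int => /eqP.
have := congr1 coord2 pq; rewrite !coord2K => /eqP.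
by rewrite eqr_int => /eqP.
Qed.

Lemma lattice0 : lat 0.
Proof. by exists 0, 0; rewrite !scale0r addr0. Qed.

Lemma latticeN k : lat k -> lat (- k).
Proof. by move=> [m [n ->]]; exists (- m), (- n); rewrite !mulrNz !scaleNr opprD. Qed.

Lemma latticeD k k' : lat k -> lat k' -> lat (k + k').
Proof.
move=> [m [n ->]] [m' [n' ->]]; exists (m + m'), (n + n').
by rewrite !intrD !scalerDl addrACA.
Qed.

Lemma latticeB k k' : lat k -> lat k' -> lat (k - k').
Proof. by move=> kl k'l; apply: latticeD => //; exact: latticeN. Qed.

(** One of the two integer coordinates is nonzero, hence at least 1 in absolute value. *)
Lemma lattice_enorm_ge k : lat k -> k != 0 -> 1 <= coord_cst * enorm k.
Proof.
move=> /latticeE[p ->] p0.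
have H (n : int) : n != 0 -> 1 <= `|n%:~R : R|.
  by move=> n0; rewrite -intr_norm ler1z; lia.
have [p1|p1] := eqVneq p.1 0; last first.
  by rewrite (le_trans _ (coord1_le _))// coord1K H.
have [p2|p2] := eqVneq p.2 0; last first.
  by rewrite (le_trans _ (coord2_le _))// coord2K H.
by move: p0; rewrite /latp p1 p2 !scale0r addr0 eqxx.
Qed.

Lemma tdist_has_inf x y : has_inf [set enorm (x - y - k) | k in lat].
Proof.
split; first by exists (enorm (x - y - 0)); exists 0 => //; exact: lattice0.
by exists 0 => _ [k _ <-]; exact: enorm_ge0.
Qed.

Notation td := (tdist l1 l2).

Lemma tdist_le x y k : lat k -> td x y <= enorm (x - y - k).
Proof. by move=> kl; apply: ge_inf; [exact: (tdist_has_inf x y).2|exists k]. Qed.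

Lemma tdist_le_enorm x y : td x y <= enorm (x - y).
Proof. by rewrite (le_trans (tdist_le x y lattice0))// subr0. Qed.

Lemma le_tdist x y a : (forall k, lat k -> a <= enorm (x - y - k)) -> a <= td x y.
Proof.
move=> H; apply: lb_le_inf; first exact: (tdist_has_inf x y).1.
by move=> _ [k kl <-]; exact: H.
Qed.

Lemma tdist_ge0 x y : 0 <= td x y.
Proof. by apply: le_tdist => k _; exact: enorm_ge0. Qed.

Lemma tdist_attained x y : exists2 k, lat k & td x y = enorm (x - y - k).
Proof.
(* A lattice vector [k] that beats 0 has |k| <= 2 |x - y|, so both its coordinates are at most [b]:
   the infimum is a minimum over finitely many index pairs. *)
pose b : R := coord_cst * (enorm (x - y) + enorm (x - y)).
have b0 : 0 <= b by rewrite mulr_ge0 ?coord_cst_ge0// addr_ge0 ?enorm_ge0.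
pose B := (Num.trunc b).+1.
have bB : b < B%:R by rewrite /B Num.Theory.truncnS_gt.
pose I := ('I_(2 * B).+1 * 'I_(2 * B).+1)%type.
pose p (i : I) : int * int := ((i.1 : nat)%:Z - B%:Z, (i.2 : nat)%:Z - B%:Z).
have pE (q : int * int) : `|q.1| <= B%:Z -> `|q.2| <= B%:Z -> exists i, p i = q.
  rewrite !ler_norml => /andP[q1 q1'] /andP[q2 q2'].
  have H (n : int) : - B%:Z <= n -> n <= B%:Z -> exists i : 'I_(2 * B).+1, (i : nat)%:Z - B%:Z = n.
    move=> n1 n2; have ub : (`|(n + B%:Z)%R| < (2 * B).+1)%N by lia.
    by exists (Ordinal ub) => /=; lia.
  have [i1 i1E] := H _ q1 q1'; have [i2 i2E] := H _ q2 q2'.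
  by exists (i1, i2); rewrite /p /= i1E i2E -surjective_pairing.
have [i0 i0E] : exists i, p i = (0, 0) by apply: pE.
have [i _ iP] := arg_minP (fun i => enorm (x - y - latp (p i))) (erefl : xpredT i0).
exists (latp (p i)); first exact: latpP.
apply/eqP; rewrite eq_le tdist_le/=; last exact: latpP.
apply: le_tdist => k kl; rewrite leNgt; apply/negP => kx.
have [q kq] := latticeE kl.
have kb : enorm k <= enorm (x - y) + enorm (x - y).
  have -> : k = (x - y) - (x - y - k) by rewrite opprB addrCA subrr addr0.
  rewrite (le_trans (enormD _ _))// enormN lerD2l (le_trans (ltW kx))//.
  by rewrite (le_trans (iP i0 isT))// i0E /latp !scale0r addr0 subr0.
have kb' : coord_cst * enorm k < B%:R.
  by rewrite (le_lt_trans _ bB)// ler_wpM2l ?coord_cst_ge0.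
have q1 : `|q.1| <= B%:Z.
  have := coord1_le k; rewrite kq coord1K => /le_lt_trans/(_ (eq_rect _ (fun k => _ * enorm k < _) kb' _ kq)).
  by rewrite -intr_norm -[B%:R]/((B%:Z)%:~R) ltr_int => /ltW.
have q2 : `|q.2| <= B%:Z.
  have := coord2_le k; rewrite kq coord2K => /le_lt_trans/(_ (eq_rect _ (fun k => _ * enorm k < _) kb' _ kq)).
  by rewrite -intr_norm -[B%:R]/((B%:Z)%:~R) ltr_int => /ltW.
have [j jE] := pE q q1 q2.
by have := iP j isT; rewrite jE -kq leNgt kx.
Qed.

Lemma tdistDl x y k : lat k -> td (x + k) y = td x y.
Proof.
move=> kl; apply/eqP; rewrite eq_le; apply/andP; split; apply: le_tdist => k' k'l.
  by rewrite (le_trans (tdist_le _ _ (latticeD kl k'l)))// le_eqVlt; apply/orP; left; apply/eqP; congr enorm; vec.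
rewrite (le_trans (tdist_le _ _ (latticeB k'l kl)))//.
by rewrite le_eqVlt; apply/orP; left; apply/eqP; congr enorm; vec.
Qed.

Lemma tdistC x y : td x y = td y x.
Proof.
apply/eqP; rewrite eq_le; apply/andP; split; apply: le_tdist => k kl.
  rewrite (le_trans (tdist_le _ _ (latticeN kl)))// -enormN !opprD !opprK.
  by rewrite le_eqVlt; apply/orP; left; apply/eqP; congr enorm; vec.
rewrite (le_trans (tdist_le _ _ (latticeN kl)))// -enormN !opprD !opprK.
by rewrite le_eqVlt; apply/orP; left; apply/eqP; congr enorm; vec.
Qed.

Lemma tdist_triangle y x z : td x z <= td x y + td y z.
Proof.
have [k kl ->] := tdist_attained x y; have [k' k'l ->] := tdist_attained y z.
rewrite (le_trans (tdist_le _ _ (latticeD kl k'l)))// (le_trans _ (enormD _ _))//.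
rewrite le_eqVlt; apply/orP; left; apply/eqP; congr enorm.
by vec.
Qed.

Lemma tdist_lip_l x y z : `|td x z - td y z| <= enorm (x - y).
Proof.
rewrite ler_norml lerBlDr; apply/andP; split.
  rewrite lerNl opprB lerBlDr (le_trans (tdist_triangle x _ _))// lerD2r enormB.
  exact: tdist_le_enorm.
by rewrite (le_trans (tdist_triangle y _ _))// lerD2r tdist_le_enorm.
Qed.

Definition red (x : plane R) : int * int := (Num.floor (coord1 x), Num.floor (coord2 x)).

Notation FD := (fundamental_domain l1 l2).

Lemma FDE x : FD x <-> 0 <= coord1 x < 1 /\ 0 <= coord2 x < 1.
Proof.
split=> [[a [b [a01 b01 ->]]]|[x1 x2]]; first by rewrite coord1K coord2K.
by exists (coord1 x), (coord2 x); split => //; exact: coordE.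
Qed.

Lemma FD_red x p : FD (x - latp p) <-> p = red x.
Proof.
have e1 q : coord1 (x - latp q) = coord1 x - q.1%:~R.
  by apply/eqP; rewrite eq_sym subr_eq -{1}[x](subrK (latp q)) coord1D coord1K.
have e2 q : coord2 (x - latp q) = coord2 x - q.2%:~R.
  by apply/eqP; rewrite eq_sym subr_eq -{1}[x](subrK (latp q)) coord2D coord2K.
rewrite FDE e1 e2 !subr_ge0 !ltrBlDl; split => [[x1 x2]|->].
  rewrite [p]surjective_pairing /red; congr pair; apply/esym/floor_def; by rewrite intrD.
by rewrite /red /=; split; have := floor_itv; [move=> /(_ _ (coord1 x))|move=> /(_ _ (coord2 x))]; rewrite intrD.
Qed.

Definition cover_radius : R := enorm l1 + enorm l2.

Lemma tdist_le_cover x y : td x y <= cover_radius.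
Proof.
have := (FD_red (x - y) (red (x - y))).2 erefl => - [a [b [/andP[a0 a1] /andP[b0 b1] E]]].
rewrite (le_trans (tdist_le x y (latpP (red (x - y)))))// E.
rewrite (le_trans (enormD _ _))// !enormZ !ger0_norm// lerD// ler_piMl ?enorm_ge0//; exact: ltW.
Qed.

Lemma continuous_coord1 : continuous coord1.
Proof.
move=> x; rewrite /coord1; apply: cvgMr_tmp; apply: cvgB; apply: cvgMr_tmp.
  exact: cvg_fst.
exact: cvg_snd.
Qed.

Lemma continuous_coord2 : continuous coord2.
Proof.
move=> x; rewrite /coord2; apply: cvgMr_tmp; apply: cvgB; apply: cvgMl_tmp.
  exact: cvg_snd.
exact: cvg_fst.
Qed.

Lemma measurable_FD : @measurable _ mP FD.
Proof.
have -> : FD = (coord1 @^-1` `[0, 1[) `&` (coord2 @^-1` `[0, 1[).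
  apply/seteqP; split => x; first by move=> /FDE[]; rewrite /= !in_itv.
  by rewrite /= !in_itv/= => -[? ?]; apply/FDE.
apply: measurableI.
  exact: (measurable_preimage2 continuous_coord1 (measurable_itv `[0, 1[)).
exact: (measurable_preimage2 continuous_coord2 (measurable_itv `[0, 1[)).
Qed.

Lemma FD_enorm x : FD x -> enorm x <= cover_radius.
Proof.
move=> [a [b [/andP[a0 a1] /andP[b0 b1] ->]]].
rewrite (le_trans (enormD _ _))// !enormZ !ger0_norm// lerD// ler_piMl ?enorm_ge0//; exact: ltW.
Qed.

Lemma leb2_bounded_lty (A : set mP) (r : R) : measurable A -> (forall x, A x -> enorm x <= r) ->
  (@leb2 R A < +oo)%E.
Proof.
move=> mA Ar; apply: (@le_lt_trans _ _ (@leb2 R (`[- r, r] `*` `[- r, r]))).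
  apply: le_mu => //; first exact: measurableX.
  move=> x /Ar xr; split; rewrite /= in_itv/= -ler_norml (le_trans _ xr)//.
    exact: norm1_le_enorm.
  exact: norm2_le_enorm.
rewrite [X in (X < _)%E]product_measure1E// lte_mul_pinfty//.
  by rewrite ge0_fin_numE// [X in (X < _)%E]lebesgue_measure_itv/=; case: ifP => _; rewrite ?ltry// -EFinB ltry.
by rewrite [X in (X < _)%E]lebesgue_measure_itv/=; case: ifP => _; rewrite ?ltry// -EFinB ltry.
Qed.

Lemma FD_lty : (@leb2 R FD < +oo)%E.
Proof. by apply: (leb2_bounded_lty measurable_FD); exact: FD_enorm. Qed.

End Lattice.

(** An enumeration of the lattice indices behind an opaque proof: it never unfolds, and only the two
    stated properties can be used. *)
Lemma lat_index_subproof : {e : nat -> option (int * int) & {r : int * int -> nat |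
  (forall p, e (r p) = Some p) /\ (forall n p, e n = Some p -> n = r p)}}.
Proof.
exists pickle_inv, pickle; split => [p|n p np]; first exact: pickleK_inv.
by move/(congr1 (oapp pickle n)): np; rewrite /= pickle_invK.
Qed.

Definition lat_index := projT1 lat_index_subproof.
Definition lat_rank := sval (projT2 lat_index_subproof).

Lemma lat_indexK p : lat_index (lat_rank p) = Some p.
Proof. by rewrite /lat_rank; case: (svalP (projT2 lat_index_subproof)). Qed.

Lemma lat_index_inv n p : lat_index n = Some p -> n = lat_rank p.
Proof. by rewrite /lat_rank; case: (svalP (projT2 lat_index_subproof)) => _; apply. Qed.

Section Unfold.
Context {R : realType}.
Notation mP := (measurableTypeR R * measurableTypeR R)%type.
Variables l1 l2 : plane R.
Hypothesis li : lin_indep l1 l2.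
Notation lat := (lattice l1 l2).
Notation FD := (fundamental_domain l1 l2).
Notation latp := (latp l1 l2).
Implicit Types (A C : set mP).

(** Naturals that code no pair contribute 0, which turns the sum over the lattice into a series
    indexed by [nat]. *)
Definition orbit_weight A (x : plane R) (n : nat) : \bar R :=
  if lat_index n is Some p then (\1_A (x + latp p))%:E else 0%E.

Definition orbit_count A (x : plane R) : \bar R := (\sum_(n <oo) orbit_weight A x n)%E.

Lemma orbit_weight_ge0 A x n : (0 <= orbit_weight A x n)%E.
Proof. by rewrite /orbit_weight; case: lat_index => // p; rewrite lee_fin. Qed.

Lemma orbit_count_unique A x p : A (x + latp p) ->
  (forall q, A (x + latp q) -> q = p) -> orbit_count A x = 1%E.
Proof.
move=> Ap Aq; rewrite /orbit_count (@nneseriesD1 _ _ (lat_rank p))//; last first.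
  by move=> n _; exact: orbit_weight_ge0.
rewrite {1}/orbit_weight lat_indexK indicE mem_set// eseries0 ?adde0// => n _ np.
rewrite /orbit_weight; case E: (lat_index n) => [q|//].
rewrite indicE memNset// => /Aq qp; move: np.
by rewrite (lat_index_inv E) qp eqxx.
Qed.

Lemma orbit_count_none A x : (forall q, ~ A (x + latp q)) -> orbit_count A x = 0%E.
Proof.
move=> Aq; rewrite /orbit_count eseries0// => n _ _.
by rewrite /orbit_weight; case: lat_index => [q|//]; rewrite indicE memNset//.
Qed.

Lemma measurable_orbit_weight A n : measurable A -> measurable_fun [set: mP] (orbit_weight A ^~ n : mP -> \bar R).
Proof.
move=> mA; rewrite /orbit_weight; case: lat_index => [p|]; last exact: measurable_cst.
apply/measurable_EFinP.
have mB : @measurable _ mP ((fun x => x + latp p) @^-1` A).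
  by rewrite -[X in measurable X]setTI; have := measurable_translate2 (latp p) measurableT mA.
apply: (eq_measurable_fun (\1_((fun x => x + latp p) @^-1` A) : mP -> R)) => [x _|].
  by rewrite !indicE; congr (_%:R); congr nat_of_bool; apply/idP/idP; rewrite !inE.
exact: measurable_indic.
Qed.

(** [A] is cut along the translates of the fundamental domain and every piece is moved back into it.
    Periodicity is only asked almost everywhere, because [g] will contain the Borel version of a
    periodic field. *)
Lemma ge0_integral_unfold A (g : mP -> R) :
  measurable A -> measurable_fun [set: mP] g -> (forall x, 0 <= g x) ->
  (forall k, lat k -> {ae @leb2 R, forall x, g (x + k) = g x}) ->
  (\int[@leb2 R]_(x in A) (g x)%:E = \int[@leb2 R]_(x in FD) (orbit_count A x * (g x)%:E))%E.
Proof.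
move=> mA mg g0 gper; have mg' := (measurable_EFinP setT g).2 mg.
pose F n : set mP := if lat_index n is Some p then A `&` [set x | FD ((x : plane R) - latp p)] else set0.
have mF n : measurable (F n).
  rewrite /F; case: lat_index => [p|]; last exact: measurable0.
  apply: measurableI => //; rewrite -[X in measurable X]setTI.
  by have := measurable_translate2 (- latp p) measurableT (measurable_FD li).
have tF : trivIset setT F.
  move=> i j _ _ [x []]; rewrite /F; case Ei : (lat_index i) => [p|//] [_ /= Fp].
  case Ej : (lat_index j) => [q|//] [_ /= Fq].
  rewrite (lat_index_inv Ei) (lat_index_inv Ej).
  by rewrite ((FD_red li _ _).1 Fp) ((FD_red li _ _).1 Fq).
have UF : \bigcup_n F n = A.
  apply/seteqP; split => x; first by move=> [n _]; rewrite /F; case: lat_index => // p [].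
  move=> Ax; exists (lat_rank (red l1 l2 x)) => //; rewrite /F lat_indexK; split => //.
  exact: (FD_red li x _).2.
rewrite -[in LHS]UF ge0_integral_bigcup//; last 2 first.
- exact: measurable_funTS.
- by move=> x _; rewrite lee_fin.
transitivity (\sum_(n <oo) (\int[@leb2 R]_(x in FD) ((g x)%:E * orbit_weight A x n)))%E; last first.
  rewrite -integral_nneseries//.
  - apply: eq_integral => x _; rewrite muleC /orbit_count -nneseriesZl//.
    by move=> n _; exact: orbit_weight_ge0.
  - exact: measurable_FD.
  - move=> n; apply: measurable_funTS; apply: emeasurable_funM => //.
    exact: measurable_orbit_weight.
  - by move=> n x _; rewrite mule_ge0 ?lee_fin ?orbit_weight_ge0.
apply: eq_eseriesr => n _; rewrite /F /orbit_weight.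
case E : (lat_index n) => [p|]; last first.
  by rewrite integral_set0; under eq_integral do rewrite mule0; rewrite integral0.
have mFn : measurable (A `&` [set x : mP | FD ((x : plane R) - latp p)]).
  by have := mF n; rewrite /F E.
rewrite integral_mkcond.
rewrite -(ge0_integral_translate2 (latp p)); last 2 first.
- by apply/(measurable_restrictT _ mFn); exact: measurable_funTS.
- by move=> x; apply: erestrict_ge0 => y _; rewrite lee_fin.
rewrite [RHS]integral_mkcond; apply: ae_eq_integral_nomeas.
apply: aeS (gper (latp p) (latpP _ _ p)) => x gx _.
rewrite !patchE /= in_setI indicE.
have -> : (x + latp p \in [set x0 : mP | FD ((x0 : plane R) - latp p)]) = (x \in FD).
  by apply/idP/idP; rewrite !inE /= addrK.
by case: (x \in FD); rewrite ?andbF// andbT; case: ifPn => _; rewrite ?mule1 ?mule0 ?gx.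
Qed.

(** The multiplicity in the unfolding is almost everywhere 1 on [C] and 0 elsewhere. The main
    instance is a planar cell [A] with the torus cell [C]; planar cells are closed, so the
    correspondence can fail on bisectors. *)
Lemma ge0_integral_tile A C (g : mP -> R) :
  measurable A -> measurable C -> measurable_fun [set: mP] g -> (forall x, 0 <= g x) ->
  (forall k, lat k -> {ae @leb2 R, forall x, g (x + k) = g x}) ->
  {ae @leb2 R, forall x, (C x -> exists2 k, lat k & A (x + k)) /\
     (forall k, lat k -> A (x + k) -> C x) /\
     (forall k k', lat k -> lat k' -> A (x + k) -> A (x + k') -> k = k')} ->
  (\int[@leb2 R]_(x in A) (g x)%:E = \int[@leb2 R]_(x in C `&` FD) (g x)%:E)%E.
Proof.
move=> mA mC mg g0 gper aeAC; rewrite ge0_integral_unfold//.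
rewrite setIC integral_mkcondr; apply: ae_eq_integral_nomeas.
apply: aeS aeAC => x [CA [AC Auniq]] _; rewrite patchE; case: ifPn.
  rewrite inE => /CA[k /latticeE[p ->] Ap]; rewrite (orbit_count_unique Ap) ?mul1e//.
  move=> q Aq; apply: (latp_inj li); apply: Auniq => //; exact: latpP.
rewrite notin_setE => nC; rewrite orbit_count_none ?mul0e// => q Aq; apply: nC.
by apply: AC Aq; exact: latpP.
Qed.

Lemma ge0_integral_packing A (g : mP -> R) :
  measurable A -> measurable_fun [set: mP] g -> (forall x, 0 <= g x) ->
  (forall k, lat k -> {ae @leb2 R, forall x, g (x + k) = g x}) ->
  (forall x k k', lat k -> lat k' -> A (x + k) -> A (x + k') -> k = k') ->
  (\int[@leb2 R]_(x in A) (g x)%:E <= \int[@leb2 R]_(x in FD) (g x)%:E)%E.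
Proof.
move=> mA mg g0 gper Auniq; rewrite ge0_integral_unfold//.
apply: ge0_le_integral => //.
- exact: measurable_FD.
- by move=> x _; rewrite mule_ge0 ?lee_fin// nneseries_ge0// => n _ _; exact: orbit_weight_ge0.
- apply: emeasurable_funM; last by apply: measurable_funTS; exact/measurable_EFinP.
  apply: measurable_funTS; rewrite /orbit_count.
  apply: ge0_emeasurable_sum => n; [by move=> x _ _; exact: orbit_weight_ge0|move=> _; exact: measurable_orbit_weight].
- by apply: measurable_funTS; exact/measurable_EFinP.
- move=> x _; have [[q Aq]|nA] := pselect (exists q, A (x + latp q)).
    rewrite (orbit_count_unique Aq) ?mul1e// => r Ar; apply: (latp_inj li).
    by apply: Auniq Ar Aq; exact: latpP.
  rewrite orbit_count_none ?mul0e ?lee_fin// => q Aq; apply: nA; by exists q.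
Qed.

(** Unfolding the constant 1 over the whole plane: a null fundamental domain would make the plane
    null. *)
Lemma FD_gt0 : (0 < @leb2 R FD)%E.
Proof.
rewrite lt_neqAle measure_ge0 andbT; apply/eqP => /esym FD0.
have := @ge0_integral_unfold setT (cst 1) measurableT (measurable_cst _) (fun=> ler01) (fun _ _ => aeW _ (fun=> erefl)).
rewrite [LHS](_ : _ = @leb2 R setT); last first.
  by rewrite -(mul1e (@leb2 R setT)) -integral_cst.
rewrite [RHS](_ : _ = 0%E); last first.
  rewrite -(integral0 (@leb2 R) FD); apply: ae_eq_integral_nomeas.
  exists FD; split => //; first exact: measurable_FD.
  by move=> x /= /not_implyP[].
move=> T0; have : (@leb2 R (`[0%R, 1%R] `*` `[0%R, 1%R]) <= @leb2 R setT)%E.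
  by apply: le_mu => //; exact: measurableX.
rewrite T0 leNgt => /negP; apply.
rewrite [X in (_ < X)%E]product_measure1E//.
by rewrite [X in (_ < X * _)%E]lebesgue_measure_itv [X in (_ < _ * X)%E]lebesgue_measure_itv/= lte_fin ltr01 -EFinB subr0 mule1 lte_fin.
Qed.

End Unfold.

(** * Integrals of bounded measurable functions over sets of finite measure *)

Section BoundedMeasurable.
Context {R : realType}.
Notation mP := (measurableTypeR R * measurableTypeR R)%type.
Implicit Types (A B : set mP) (f g : mP -> R).

(** A class stable under sums, products and powers, so that integrability over sets of finite
    measure is obtained from the shape of the integrand. *)
Definition bmeas A f : Prop :=
  measurable_fun A f /\ exists M : R, forall x, A x -> `|f x| <= M.

Definition finset2 A : Prop := measurable A /\ (@leb2 R A < +oo)%E.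

Lemma bmeas_integrable A f : finset2 A -> bmeas A f -> (@leb2 R).-integrable A (EFin \o f).
Proof.
move=> [mA Afin] [mf [M fM]]; apply: measurable_bounded_integrable => //.
by exists M; split; [exact: num_real|move=> y My x Ax; apply: (le_trans (fM x Ax)); exact: ltW].
Qed.

Lemma bmeas_cst A (c : R) : bmeas A (fun=> c).
Proof. by split; [exact: measurable_cst|exists `|c|]. Qed.

Lemma bmeasD A f g : bmeas A f -> bmeas A g -> bmeas A (fun x => f x + g x).
Proof.
move=> [mf [M fM]] [mg [K gK]]; split; first exact: measurable_funD.
by exists (M + K) => x Ax; rewrite (le_trans (ler_normD _ _))// lerD ?fM ?gK.
Qed.

Lemma bmeasM A f g : bmeas A f -> bmeas A g -> bmeas A (fun x => f x * g x).
Proof.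
move=> [mf [M fM]] [mg [K gK]]; split; first exact: measurable_funM.
by exists (M * K) => x Ax; rewrite normrM ler_pM ?fM ?gK.
Qed.

Lemma bmeasZ A f (c : R) : bmeas A f -> bmeas A (fun x => c * f x).
Proof. by move=> bf; apply: bmeasM => //; exact: bmeas_cst. Qed.

Lemma bmeasN A f : bmeas A f -> bmeas A (fun x => - f x).
Proof.
move=> [mf [M fM]]; split; first exact: measurable_funN.
by exists M => x Ax; rewrite normrN fM.
Qed.

Lemma bmeasB A f g : bmeas A f -> bmeas A g -> bmeas A (fun x => f x - g x).
Proof. by move=> bf bg; apply: bmeasD => //; exact: bmeasN. Qed.

Lemma bmeasX A f n : bmeas A f -> bmeas A (fun x => f x ^+ n).
Proof.
move=> bf; elim: n => [|n IH]; first exact: (bmeas_cst A 1).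
by under eq_fun do rewrite exprS; exact: bmeasM.
Qed.

Lemma bmeas_sum A (I : finType) (f : I -> mP -> R) :
  (forall i, bmeas A (f i)) -> bmeas A (fun x => \sum_i f i x).
Proof.
move=> bf; rewrite -[index_enum I]/(index_enum _).
elim: (index_enum I) => [|i s IHs].
  by under eq_fun do rewrite big_nil; exact: bmeas_cst.
by under eq_fun do rewrite big_cons; exact: bmeasD.
Qed.

Lemma bmeasS A B f : measurable B -> A `<=` B -> bmeas B f -> bmeas A f.
Proof.
move=> mB AB [mf [M fM]]; split; first exact: measurable_funS mf.
by exists M => x /AB; exact: fM.
Qed.

Lemma bmeas_setT A f M : measurable A -> measurable_fun [set: mP] f -> (forall x, A x -> `|f x| <= M) -> bmeas A f.
Proof. by move=> mA mf fM; split; [exact: measurable_funTS|exists M]. Qed.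

Notation Int A f := (Rintegral (@leb2 R) A f).

Lemma IntE A f : finset2 A -> bmeas A f -> (\int[@leb2 R]_(x in A) (f x)%:E)%E = (Int A f)%:E.
Proof.
move=> fA bf; rewrite fineK//; apply: integrable_fin_num; [exact: fA.1|].
exact: bmeas_integrable.
Qed.

Lemma IntD A f g : finset2 A -> bmeas A f -> bmeas A g ->
  Int A (fun x => f x + g x) = Int A f + Int A g.
Proof.
move=> fA bf bg; rewrite RintegralD//; first exact: fA.1; exact: bmeas_integrable.
Qed.

Lemma IntZ A f (c : R) : finset2 A -> bmeas A f -> Int A (fun x => c * f x) = c * Int A f.
Proof. by move=> fA bf; rewrite RintegralZl//; [exact: fA.1|exact: bmeas_integrable]. Qed.

Lemma IntB A f g : finset2 A -> bmeas A f -> bmeas A g ->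
  Int A (fun x => f x - g x) = Int A f - Int A g.
Proof.
move=> fA bf bg; rewrite RintegralB//; first exact: fA.1; exact: bmeas_integrable.
Qed.

Lemma Int_cst A (c : R) : finset2 A -> Int A (fun=> c) = c * fine (@leb2 R A).
Proof. by move=> fA; rewrite Rintegral_cst//; exact: fA.1. Qed.

Lemma Int_ae_le A f g : finset2 A -> bmeas A f -> bmeas A g ->
  {ae @leb2 R, forall x, A x -> f x <= g x} -> Int A f <= Int A g.
Proof.
move=> fA bf bg fg; rewrite -subr_ge0 -IntB// fine_ge0//.
have -> : (\int[@leb2 R]_(x in A) (g x - f x)%:E = \int[@leb2 R]_(x in A) (Num.max 0 (g x - f x))%:E)%E.
  apply: ae_eq_integral_nomeas; apply: aeS fg => x fg Ax; congr EFin.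
  by rewrite max_r// subr_ge0 fg.
by apply: integral_ge0 => x _; rewrite lee_fin le_max lexx.
Qed.

Lemma Int_le A f g : finset2 A -> bmeas A f -> bmeas A g ->
  (forall x, A x -> f x <= g x) -> Int A f <= Int A g.
Proof. by move=> fA bf bg fg; apply: Int_ae_le => //; apply: aeW. Qed.

End BoundedMeasurable.

Notation Int A f := (Rintegral (@leb2 _) A f).

(** * Voronoi cells and the quantization energy *)

Section Voronoi.
Context {R : realType}.
Notation mP := (measurableTypeR R * measurableTypeR R)%type.
Variables l1 l2 : plane R.
Hypothesis li : lin_indep l1 l2.
Notation lat := (lattice l1 l2).
Notation FD := (fundamental_domain l1 l2).
Notation latp := (latp l1 l2).
Notation td := (tdist l1 l2).
Variable N : nat.
Hypothesis N0 : (0 < N)%N.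
Implicit Types (X : 'I_N -> plane R).
Notation P := (planar_cell l1 l2).
Notation cell := (cell l1 l2).

(** A minimum over generators instead of a distance defined cell by cell: it makes sense for every
    configuration, also on cell boundaries, and is Lipschitz both in the point and in the
    generators. The energy below inherits this. *)
Definition vdist X x : R := inf [set td x (X i) | i in setT].

Lemma vdist_has_inf X x : has_inf [set td x (X i) | i in setT].
Proof.
split; first by exists (td x (X (Ordinal N0))), (Ordinal N0).
by exists 0 => _ [i _ <-]; exact: tdist_ge0.
Qed.

Lemma vdist_le X x i : vdist X x <= td x (X i).
Proof. by apply: ge_inf; [exact: (vdist_has_inf X x).2|exists i]. Qed.

Lemma le_vdist X x a : (forall i, a <= td x (X i)) -> a <= vdist X x.
Proof.
move=> H; apply: lb_le_inf; first exact: (vdist_has_inf X x).1.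
by move=> _ [i _ <-]; exact: H.
Qed.

Lemma vdist_attained X x : exists i, vdist X x = td x (X i).
Proof.
have [i _ iP] := arg_minP (fun i => td x (X i)) (erefl : xpredT (Ordinal N0)).
by exists i; apply/eqP; rewrite eq_le vdist_le/=; apply: le_vdist => j; exact: iP.
Qed.

Lemma vdist_ge0 X x : 0 <= vdist X x.
Proof. by apply: le_vdist => i; exact: tdist_ge0. Qed.

Lemma vdist_le_cover X x : vdist X x <= cover_radius l1 l2.
Proof. by rewrite (le_trans (vdist_le X x (Ordinal N0)))// tdist_le_cover. Qed.

Lemma vdist_periodic X x k : lat k -> vdist X (x + k) = vdist X x.
Proof. by move=> kl; rewrite /vdist; congr inf; apply: eq_imagel => i _; rewrite tdistDl. Qed.

Lemma vdist_lip X x y : `|vdist X x - vdist X y| <= enorm (x - y).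
Proof.
have H u v : vdist X u - vdist X v <= enorm (u - v).
  have [i ->] := vdist_attained X v; rewrite lerBlDr (le_trans (vdist_le X u i))//.
  rewrite (le_trans (tdist_triangle li v _ _))// lerD2r.
  exact: tdist_le_enorm.
by rewrite ler_norml lerNl opprB enormB H enormB H.
Qed.

Lemma vdist_lip_gen X Y x : `|vdist X x - vdist Y x| <= \sum_i enorm (X i - Y i).
Proof.
have H U V : vdist U x - vdist V x <= \sum_i enorm (U i - V i).
  have [i ->] := vdist_attained V x; rewrite lerBlDr (le_trans (vdist_le U x i))//.
  rewrite (le_trans (tdist_triangle li (V i) _ _))// addrC lerD2r tdistC//.
  rewrite (le_trans (tdist_le_enorm _ _ _ _))// (bigD1 i)//= lerDl sumr_ge0// => j _; exact: enorm_ge0.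
rewrite ler_norml lerNl opprB H andbT.
by under eq_bigr do rewrite enormB; exact: H.
Qed.

Lemma continuous_vdist X : continuous (vdist X).
Proof. by apply: (@lipschitz_continuous2 _ 1) => x y; rewrite mul1r vdist_lip. Qed.

Lemma continuous_enormB (a : plane R) : continuous (fun x : plane R => enorm (x - a)).
Proof.
apply: (@lipschitz_continuous2 _ 1) => x y; rewrite mul1r.
by rewrite (le_trans (enorm_lerB_dist _ _))// opprB addrA subrK.
Qed.

Lemma continuous_tdist (a : plane R) : continuous (fun x : plane R => td x a).
Proof. by apply: (@lipschitz_continuous2 _ 1) => x y; rewrite mul1r tdist_lip_l. Qed.

Lemma planar_cellE X i y : P X i y <-> enorm (y - X i) <= vdist X y.
Proof.
split => [Py|yv j k kl].
  by apply: le_vdist => j; apply: le_tdist => k kl; exact: Py.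
by rewrite (le_trans yv)// (le_trans (vdist_le X y j))// tdist_le.
Qed.

Lemma planar_cell_vdist X i y : P X i y -> vdist X y = enorm (y - X i).
Proof.
move=> /planar_cellE Py; apply/eqP; rewrite eq_le Py andbT.
by rewrite (le_trans (vdist_le X y i))// tdist_le_enorm.
Qed.

Lemma planar_cell_bounded X i y : P X i y -> enorm (y - X i) <= cover_radius l1 l2.
Proof. by move=> /planar_cell_vdist <-; exact: vdist_le_cover. Qed.

Lemma measurable_planar_cell X i : @measurable _ mP (P X i).
Proof.
have -> : P X i = (fun y => enorm (y - X i) - vdist X y) @^-1` `]-oo, 0].
  by apply/seteqP; split => y; rewrite /= in_itv/= subr_le0 => /planar_cellE.
apply: measurable_preimage2 => //.
by move=> y; apply: cvgB; [exact: continuous_enormB|exact: continuous_vdist].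
Qed.

Lemma finset2_planar_cell X i : finset2 (P X i).
Proof.
split; first exact: measurable_planar_cell.
apply: (@leb2_bounded_lty _ _ (cover_radius l1 l2 + enorm (X i))).
  exact: measurable_planar_cell.
move=> y /planar_cell_bounded Py; rewrite -(subrK (X i) y).
by rewrite (le_trans (enormD _ _))// lerD2r.
Qed.

Lemma finset2_FD : finset2 FD.
Proof. by split; [exact: measurable_FD|exact: FD_lty]. Qed.

Lemma measurable_cell X i : @measurable _ mP (cell X i).
Proof.
have -> : cell X i = ~` \bigcup_j (if j == i then set0 else (fun y => td y (X j) - td y (X i)) @^-1` `]-oo, 0]).
  apply/seteqP; split => [y cy [j _]|y cy j ji].
    by case: ifPn => //= ji; rewrite in_itv/= subr_le0 leNgt cy.
  rewrite ltNge; apply/negP => yji; apply: cy; exists j => //.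
  by rewrite (negbTE ji) /= in_itv/= subr_le0.
apply: measurableC; apply: fin_bigcup_measurable; [exact: finite_finset|move=> j _; case: ifP => _ //].
apply: measurable_preimage2 => //.
by move=> y; apply: cvgB; exact: continuous_tdist.
Qed.

Lemma cell_disjoint X i j x : cell X i x -> cell X j x -> i = j.
Proof.
move=> ci cj; apply/eqP/contraT => ij.
by have := lt_trans (ci j (_ : j != i)) (cj i ij); rewrite ltxx eq_sym => /(_ ij).
Qed.

(** Distinct lifts of generators are never equidistant from such a point, so there the strict
    inequalities of [cell] and the weak ones of [planar_cell] agree modulo the lattice. *)
Definition generic X x : Prop := forall i j p q, X i - latp p <> X j - latp q ->
  enorm (x - (X i - latp p)) <> enorm (x - (X j - latp q)).

Lemma ae_bisector (a b : plane R) : a <> b -> {ae @leb2 R, forall x, enorm (x - a) <> enorm (x - b)}.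
Proof.
move=> ab; have n0 : b - a != 0 by rewrite subr_eq0; apply/eqP => ba; exact: ab.
apply: negligibleS (negligible_line ((dotp b b - dotp a a) / 2) n0).
move=> x /= /contrapT /(congr1 (fun r => r ^+ 2)); rewrite !enorm_sqr /dotp /= => H; lra.
Qed.

Lemma ae_generic X : {ae @leb2 R, forall x, generic X x}.
Proof.
suff : {ae @leb2 R, forall x : plane R, forall t : 'I_N * 'I_N * (int * int) * (int * int),
   X t.1.1.1 - latp t.1.2 <> X t.1.1.2 - latp t.2 ->
   enorm (x - (X t.1.1.1 - latp t.1.2)) <> enorm (x - (X t.1.1.2 - latp t.2))}.
  by apply: aeS => x H i j p q; exact: (H (i, j, p, q)).
apply: ae_forall_count => -[[[i j] p] q] /=.
have [e|ne] := pselect (X i - latp p = X j - latp q); first exact: aeW.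
by apply: aeS (ae_bisector ne).
Qed.

Section Distinct.
Variable X : 'I_N -> plane R.
Hypothesis dX : distinct l1 l2 X.

Lemma distinct_lat i j p q : i != j -> X i - latp p <> X j - latp q.
Proof.
move=> ij e; apply: (dX ij).
rewrite (_ : X i - X j = latp p - latp q); first by apply: (latticeB (latpP _ _ _) (latpP _ _ _)).
by transitivity ((X i - latp p) + latp p - X j); [vec|rewrite e; vec].
Qed.

Lemma cell_planar i x : cell X i x -> exists2 k, lat k & P X i (x + k).
Proof.
move=> cx; have [k kl tk] := tdist_attained li x (X i).
exists (- k); first exact: latticeN.
apply/planar_cellE; rewrite vdist_periodic; last exact: latticeN.
rewrite addrAC -tk; apply: le_vdist => j.
by have [->//|ji] := eqVneq j i; rewrite ltW// cx.
Qed.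

Lemma generic_planar_cell i x k : generic X x -> lat k -> P X i (x + k) -> cell X i x.
Proof.
move=> gx /latticeE[p ->] Px j ji; have [_ /latticeE[q ->] ->] := tdist_attained li x (X j).
rewrite (le_lt_trans (tdist_le _ _ (latticeN (latpP _ _ p))))//.
rewrite opprK addrAC lt_neqAle; apply/andP; split; last first.
  rewrite (le_trans (Px j _ (latticeD (latpP l1 l2 q) (latpP l1 l2 p))))// le_eqVlt; apply/orP; left.
  by apply/eqP; congr enorm; vec.
apply/eqP.
have ij : i != j by rewrite eq_sym.
have := @gx i j p (- q.1, - q.2) (@distinct_lat _ _ p (- q.1, - q.2) ij).
have e1 : x - (X i - latp p) = x + latp p - X i by vec.
have e2 : x - (X j - latp (- q.1, - q.2)) = x - X j - latp q.
  by rewrite /latp /= !mulrNz !scaleNr; vec.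
by rewrite e1 e2.
Qed.

(** Two translates of [x] in one planar cell would be equally far from [X i], making [x] equidistant
    from two lifts of [X i]. *)
Lemma generic_planar_uniq i x k k' : generic X x -> lat k -> lat k' ->
  P X i (x + k) -> P X i (x + k') -> k = k'.
Proof.
move=> gx /latticeE[p ->] /latticeE[q ->] Pp Pq.
have := planar_cell_vdist Pp; have := planar_cell_vdist Pq.
rewrite !vdist_periodic; [|exact: latpP|exact: latpP].
move=> e1 e2; apply: contrapT => pq.
apply: (gx i i p q).
  by move/(addrI _)/oppr_inj.
have e3 : x - (X i - latp p) = x + latp p - X i by vec.
have e4 : x - (X i - latp q) = x + latp q - X i by vec.
by rewrite e3 e4 -e1 -e2.
Qed.

Lemma generic_cover x : generic X x -> exists i, cell X i x.
Proof.
move=> gx; have [i xi] := vdist_attained X x; exists i.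
have [k kl tk] := tdist_attained li x (X i).
apply: (generic_planar_cell gx (latticeN kl)).
apply/planar_cellE; rewrite vdist_periodic; last exact: latticeN.
by rewrite xi tk addrAC.
Qed.

Variable g : mP -> R.
Hypotheses (mg : measurable_fun [set: mP] g) (g0 : forall x, 0 <= g x)
  (gper : forall k, lat k -> {ae @leb2 R, forall x, g (x + k) = g x}).

Lemma ge0_integral_planar_cell i :
  (\int[@leb2 R]_(x in P X i) (g x)%:E = \int[@leb2 R]_(x in cell X i `&` FD) (g x)%:E)%E.
Proof.
apply: (ge0_integral_tile li) => //; [exact: measurable_planar_cell|exact: measurable_cell|].
apply: aeS (ae_generic X) => x gx; split; [exact: cell_planar|split].
  by move=> k; exact: generic_planar_cell.
by move=> k k'; exact: generic_planar_uniq.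
Qed.

End Distinct.

Lemma ge0_integral_cells X (g : mP -> \bar R) : distinct l1 l2 X ->
  measurable_fun FD g -> (forall x, FD x -> 0 <= g x)%E ->
  (\sum_i \int[@leb2 R]_(x in cell X i `&` FD) g x = \int[@leb2 R]_(x in FD) g x)%E.
Proof.
move=> dX mg g0.
transitivity (\int[@leb2 R]_(x in FD) (\sum_i (g \_ (cell X i)) x))%E.
  rewrite ge0_integral_sum//; last 3 first.
  - exact: measurable_FD.
  - move=> i; apply: (measurable_restrict g (measurable_cell X i) (measurable_FD li)).1.
    by apply: measurable_funS mg => //; exact: measurable_FD.
  - by move=> i x Fx; rewrite patchE; case: ifP => // _; exact: g0.
  by apply: eq_bigr => i _; rewrite setIC integral_mkcondr.
apply: ae_eq_integral_nomeas; apply: aeS (ae_generic X) => x gx Fx.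
have [i ci] := generic_cover dX gx.
rewrite (bigD1 i)//= patchE mem_set// big1 ?adde0// => j ji.
rewrite patchE memNset// => cj; move: ji; by rewrite (cell_disjoint cj ci) eqxx.
Qed.

End Voronoi.

(** * The energy as a function of the generators: transport, lower bound, envelope *)

Section Energy.
Context {R : realType}.
Notation mP := (measurableTypeR R * measurableTypeR R)%type.
Variables l1 l2 : plane R.
Hypothesis li : lin_indep l1 l2.
Notation lat := (lattice l1 l2).
Notation FD := (fundamental_domain l1 l2).
Notation latp := (latp l1 l2).
Notation td := (tdist l1 l2).
Variable N : nat.
Hypothesis N0 : (0 < N)%N.
Implicit Types (X : 'I_N -> plane R).
Notation P := (planar_cell l1 l2).
Notation cell := (cell l1 l2).
Notation vdist := (vdist l1 l2).

Definition energy X : R := Int FD (fun x => vdist X x ^+ 2).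

Lemma measurable_vdist X : measurable_fun [set: mP] (vdist X : mP -> R).
Proof. by apply: continuous_measurable2; exact: continuous_vdist. Qed.

Lemma bmeas_vdist A X : measurable A -> bmeas A (vdist X : mP -> R).
Proof.
move=> mA; apply: (bmeas_setT (M := cover_radius l1 l2)) => //; first exact: measurable_vdist.
by move=> x _; rewrite ger0_norm ?vdist_ge0// vdist_le_cover.
Qed.

Lemma bmeas_vdist2 A X : measurable A -> bmeas A (fun x => vdist X x ^+ 2).
Proof. by move=> mA; apply: bmeasX; exact: bmeas_vdist. Qed.

Lemma energy_ge0 X : 0 <= energy X.
Proof. by apply: Rintegral_ge0 => x _; exact: sqr_ge0. Qed.

Lemma Int_cells X (g : mP -> R) : distinct l1 l2 X -> bmeas setT g -> (forall x, 0 <= g x) ->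
  (forall k, lat k -> {ae @leb2 R, forall x, g (x + k) = g x}) ->
  \sum_i Int (P X i) g = Int FD g.
Proof.
move=> dX bg g0 gper; apply: EFin_inj; rewrite -sumEFin -IntE; last 2 first.
- exact: finset2_FD.
- exact: bmeasS bg.
rewrite -(ge0_integral_cells li N0 dX)//; last 2 first.
- by apply/measurable_EFinP; apply: measurable_funTS; exact: bg.1.
- by move=> x _; rewrite lee_fin.
apply: eq_bigr => i _; rewrite -IntE; [|exact: finset2_planar_cell|exact: bmeasS bg].
by apply: ge0_integral_planar_cell => //; exact: bg.1.
Qed.

Lemma quantization_energyE X : distinct l1 l2 X -> quantization_energy l1 l2 X = energy X.
Proof.
move=> dX; apply: EFin_inj; have bv := bmeas_vdist2 X (measurable_FD li).
rewrite -IntE//; last exact: finset2_FD.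
rewrite -(ge0_integral_cells li N0 dX)//; last 2 first.
- by apply/measurable_EFinP; apply: (bmeas_vdist2 X (measurable_FD li)).1.
- by move=> x _; rewrite lee_fin sqr_ge0.
rewrite /quantization_energy -sumEFin; apply: eq_bigr => i _.
have fc : finset2 (cell X i `&` FD).
  split; first by apply: measurableI; [exact: measurable_cell|exact: measurable_FD].
  apply: le_lt_trans (FD_lty li); apply: le_mu => //; last exact: measurable_FD.
  by apply: measurableI; [exact: measurable_cell|exact: measurable_FD].
rewrite IntE//; last exact: bmeas_vdist2 fc.1.
congr EFin; rewrite /tintegral; apply: eq_Rintegral => x; rewrite inE => -[cx _].
congr (_ ^+ 2); apply/eqP; rewrite eq_le vdist_le// andbT; apply: le_vdist => // j.
by have [->//|ji] := eqVneq j i; rewrite ltW// cx.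
Qed.

Lemma FD_uniq (x k k' : plane R) : lat k -> lat k' -> FD (x + k) -> FD (x + k') -> k = k'.
Proof.
have H q : lat q -> FD (x + q) -> q = - latp (red l1 l2 x).
  move=> /latticeE[p ->]; have -> : x + latp p = x - latp (- p.1, - p.2).
    by rewrite /latp /= !mulrNz !scaleNr; vec.
  by move=> /(FD_red li) <-; rewrite /latp /= !mulrNz !scaleNr; vec.
by move=> kl k'l Fk Fk'; rewrite (H k)// (H k').
Qed.

(** A translate of the fundamental domain still meets every lattice orbit exactly once, so it tiles
    the torus as well. *)
Lemma ge0_integral_FD_translate (a : plane R) (g : mP -> R) :
  measurable_fun [set: mP] g -> (forall x, 0 <= g x) ->
  (forall k, lat k -> {ae @leb2 R, forall x, g (x + k) = g x}) ->
  (\int[@leb2 R]_(x in FD) (g ((x : plane R) + a)%R)%:E = \int[@leb2 R]_(x in FD) (g x)%:E)%E.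
Proof.
move=> mg g0 gper; pose A : set mP := [set x | FD ((x : plane R) - a)].
have mA : measurable A.
  rewrite -[X in measurable X]setTI.
  by have := measurable_translate2 (- a) measurableT (measurable_FD li).
rewrite -[X in (_ = \int[_]_(_ in X) _)%E]setTI -(ge0_integral_tile li (A := A))//; last first.
  apply: aeW => x; split => [_|].
    exists (- latp (red l1 l2 (x - a))); first exact/latticeN/latpP.
    by rewrite /A /= addrAC; apply/(FD_red li).
  split => // k k' kl k'l; rewrite /A /= (addrAC x k) (addrAC x k') => Fk Fk'.
  exact: FD_uniq Fk Fk'.
rewrite integral_mkcond [RHS]integral_mkcond.
rewrite -[RHS](ge0_integral_translate2 a); last 2 first.
- apply/(measurable_restrictT _ mA); apply: measurable_funTS; exact/measurable_EFinP.
- by move=> x; apply: erestrict_ge0 => y _; rewrite lee_fin.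
apply: eq_integral => x _; rewrite !patchE.
have -> : (x + a \in A) = (x \in FD) by apply/idP/idP; rewrite !inE /A /= addrK.
by [].
Qed.

Lemma bmeas_enormB X i : bmeas (P X i) (fun y => enorm (y - X i)).
Proof.
apply: (bmeas_setT (M := cover_radius l1 l2)); first exact: measurable_planar_cell.
  by apply: continuous_measurable2; exact: continuous_enormB.
by move=> y Py; rewrite ger0_norm ?enorm_ge0// (planar_cell_bounded li N0 Py).
Qed.

Lemma bmeas_dotpB X i (e : plane R) : bmeas (P X i) (fun y => dotp (y - X i) e).
Proof.
apply: (bmeas_setT (M := cover_radius l1 l2 * enorm e)); first exact: measurable_planar_cell.
  have -> : (fun y => dotp (y - X i) e) = (fun y => dotp y e - dotp (X i) e).
    by apply/funext => y; rewrite dotpBl.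
  apply: measurable_funB; last exact: measurable_cst.
  by apply: continuous_measurable2; exact: continuous_dotpl.
move=> y Py; rewrite (le_trans (dotp_ler_norm _ _))// ler_wpM2r ?enorm_ge0//.
exact: (planar_cell_bounded li N0 Py).
Qed.

Lemma bmeas_vdist_shift X (a : plane R) A : measurable A -> bmeas A (fun y => vdist X (y + a)).
Proof.
move=> mA; apply: (bmeas_setT (M := cover_radius l1 l2)) => //.
  by have := measurableT_comp (measurable_vdist X) (measurable_translate2 a).
by move=> x _; rewrite ger0_norm ?vdist_ge0// vdist_le_cover.
Qed.

(* Integration by parts against [vdist X ^ 2] with difference quotients: the translation by
   [s *: e] is moved from the weight [b] to the squared distance, which is bounded on each
   cell by the squared distance to the fixed generator. *)
Lemma transport_energy X (b : mP -> R) (e : plane R) (L B : R) : distinct l1 l2 X ->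
  measurable_fun [set: mP] b -> (forall x, 0 <= b x <= B) ->
  (forall k, lat k -> {ae @leb2 R, forall x, b (x + k) = b x}) ->
  (forall s : R, 0 < s -> {ae @leb2 R, forall x, b x - L * s <= b ((x : plane R) - s *: e)}) ->
  - (L * energy X) <= 2 * \sum_i Int (P X i) (fun y => dotp (y - X i) e * b y).
Proof.
move=> dX mb bB bper bs.
have bb A : measurable A -> bmeas A b.
  move=> mA; apply: (bmeas_setT (M := B)) => // x _.
  by have /andP[b0 b1] := bB x; rewrite ger0_norm.
have b0 x : 0 <= b x by have /andP[] := bB x.
have fP i := finset2_planar_cell li N0 X i.
have fF := finset2_FD li.
set S := \sum_i _.
pose K := \sum_i Int (P X i) (fun y => enorm e ^+ 2 * b y).
pose Eb := Int FD (fun y => vdist X y ^+ 2 * b y).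
have EbE : Eb = \sum_i Int (P X i) (fun y => enorm (y - X i) ^+ 2 * b y).
  rewrite /Eb -(Int_cells dX).
  - apply: eq_bigr => i _; apply: eq_Rintegral => y; rewrite inE => Py.
    by rewrite (planar_cell_vdist N0 Py).
  - by apply: bmeasM; [exact: bmeas_vdist2|exact: bb].
  - by move=> x; rewrite mulr_ge0// sqr_ge0.
  - by move=> k kl; apply: aeS (bper k kl) => x ->; rewrite vdist_periodic.
(* The inequality for the difference quotient of step [s]. Expanding the square leaves the
   second-order term [s * K], which disappears as [s] tends to 0 at the end. *)
have key s : 0 < s -> - (L * energy X) <= 2 * S + s * K.
  move=> s0; pose a := s *: e.
  have mbs : measurable_fun [set: mP] (fun y => b ((y : plane R) - a)).
    by have := measurableT_comp mb (measurable_translate2 (- a)).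
  have bbs A : measurable A -> bmeas A (fun y => b (y - a)).
    move=> mA; apply: (bmeas_setT (M := B)) => // x _.
    by have /andP[b00 b1] := bB (x - a); rewrite ger0_norm.
  have e1 : Int FD (fun y => vdist X y ^+ 2 * b (y - a)) = Int FD (fun y => vdist X (y + a) ^+ 2 * b y).
    rewrite /Rintegral -(@ge0_integral_FD_translate a (fun y => vdist X y ^+ 2 * b (y - a))).
    - by congr fine; apply: eq_integral => y _; rewrite addrK.
    - by apply: measurable_funM => //; exact: (bmeas_vdist2 X measurableT).1.
    - by move=> x; rewrite mulr_ge0// sqr_ge0.
    - move=> k kl; apply: aeS (ae_translate2 (- a) (bper k kl)) => x bx.
      by rewrite vdist_periodic// addrAC bx.
  have e2 : Eb - L * s * energy X <= Int FD (fun y => vdist X y ^+ 2 * b (y - a)).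
    rewrite /Eb /energy -IntZ//; last exact: bmeas_vdist2 fF.1.
    have bv := bmeas_vdist2 X fF.1; have bvb := bmeasM bv (bb _ fF.1).
    have bvL := bmeasZ (L * s) bv.
    rewrite -(IntB fF bvb bvL).
    apply: (Int_ae_le fF (bmeasB bvb bvL) (bmeasM bv (bbs _ fF.1))).
    apply: aeS (bs s s0) => x bx _; rewrite [L * s * _]mulrC -mulrBr.
    by rewrite ler_wpM2l ?sqr_ge0.
  have e3 : Int FD (fun y => vdist X (y + a) ^+ 2 * b y) = \sum_i Int (P X i) (fun y => vdist X (y + a) ^+ 2 * b y).
    rewrite -(Int_cells dX)//.
    - by apply: bmeasM; [apply: bmeasX; exact: bmeas_vdist_shift|exact: bb].
    - by move=> x; rewrite mulr_ge0// sqr_ge0.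
    - by move=> k kl; apply: aeS (bper k kl) => x ->; rewrite (addrAC x k a) (vdist_periodic _ _ kl).
  have e4 i : Int (P X i) (fun y => vdist X (y + a) ^+ 2 * b y) <=
      Int (P X i) (fun y => enorm (y - X i) ^+ 2 * b y) +
      (2 * s * Int (P X i) (fun y => dotp (y - X i) e * b y) + s ^+ 2 * Int (P X i) (fun y => enorm e ^+ 2 * b y)).
    have mPi := (fP i).1.
    have c1 : bmeas (P X i) (fun y => enorm (y - X i) ^+ 2 * b y).
      by apply: bmeasM; [apply: bmeasX; exact: bmeas_enormB|exact: bb].
    have c2 : bmeas (P X i) (fun y => dotp (y - X i) e * b y).
      by apply: bmeasM; [exact: bmeas_dotpB|exact: bb].
    have c3 : bmeas (P X i) (fun y => enorm e ^+ 2 * b y) by apply: bmeasZ; exact: bb.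
    have z2 := bmeasZ (2 * s) c2; have z3 := bmeasZ (s ^+ 2) c3.
    rewrite -(IntZ (2 * s) (fP i) c2) -(IntZ (s ^+ 2) (fP i) c3).
    rewrite -(IntD (fP i) z2 z3) -(IntD (fP i) c1 (bmeasD z2 z3)).
    apply: (Int_le (fP i) _ (bmeasD c1 (bmeasD z2 z3))).
      by apply: bmeasM; [apply: bmeasX; exact: bmeas_vdist_shift|exact: bb].
    move=> y Py.
    have -> : enorm (y - X i) ^+ 2 * b y + (2 * s * (dotp (y - X i) e * b y) + s ^+ 2 * (enorm e ^+ 2 * b y)) =
       enorm (y - X i + a) ^+ 2 * b y.
      by rewrite (enorm_sqrD (y - X i) a) /a dotpZr !enorm_sqr dotpZl dotpZr; ring.
    rewrite ler_wpM2r// ler_sqr ?nnegrE ?enorm_ge0 ?vdist_ge0//.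
    rewrite addrAC (le_trans (vdist_le _ _ N0 X _ i))//; exact: tdist_le_enorm.
  have : Eb - L * s * energy X <= Eb + (2 * s * S + s ^+ 2 * K).
    rewrite (le_trans e2)// e1 e3 (le_trans (ler_sum _ (fun i _ => e4 i)))//.
    by rewrite !big_split/= -!mulr_sumr -EbE.
  rewrite -lerBlDl addrAC subrr add0r => H.
  have : s * - (L * energy X) <= s * (2 * S + s * K).
    by rewrite (_ : s * _ = - (L * s * energy X)) ?(le_trans H)// ?le_eqVlt; [apply/orP; left; apply/eqP|]; ring.
  by rewrite ler_pM2l.
apply/ler_addgt0Pr => d d0.
have K1 : 0 < `|K| + 1 by rewrite ltr_wpDl.
rewrite (le_trans (key (d / (`|K| + 1)) (divr_gt0 d0 K1)))// lerD2l.
rewrite mulrAC ler_pdivrMr// ler_pM2l//; have := ler_norm K; lra.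
Qed.

Lemma tdist_neq0 x y : ~ lat (x - y) -> 0 < td x y.
Proof.
move=> nl; have [k kl ->] := tdist_attained li x y.
rewrite lt_neqAle enorm_ge0 andbT eq_sym; apply/eqP => /enorm_eq0/eqP.
by rewrite subr_eq0 => /eqP e0; apply: nl; rewrite e0.
Qed.

(** Squares replace Euclidean balls because their area is a product of two lengths; the price is the
    factor 2 in [box_enorm]. *)
Definition box (x : plane R) (s : R) : set mP :=
  `[x.1 - s, x.1 + s]%classic `*` `[x.2 - s, x.2 + s]%classic.

Lemma measurable_box x s : measurable (box x s).
Proof. exact: measurableX. Qed.

Lemma leb2_box x s : 0 < s -> @leb2 R (box x s) = ((2 * s) ^+ 2)%:E.
Proof.
move=> s0; rewrite [LHS]product_measure1E//.
have H (a : R) : leb R `[a - s, a + s]%classic = (2 * s)%:E.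
  rewrite lebesgue_measure_itv/= lte_fin ifT; last lra.
  by rewrite -EFinB; congr EFin; ring.
by rewrite [X in (X * _)%E]H [X in (_ * X)%E]H -EFinM.
Qed.

Lemma box_enorm x s y : box x s y -> enorm (y - x) <= 2 * s.
Proof.
move=> [/=]; rewrite !in_itv/= => /andP[a1 a2] /andP[b1 b2].
rewrite (le_trans (enorm_le_norm12 _))//.
have : `|(y - x).1| <= s by rewrite ler_norml /=; apply/andP; split; lra.
have : `|(y - x).2| <= s by rewrite ler_norml /=; apply/andP; split; lra.
by lra.
Qed.

Lemma box_packing x s y k k' : coord_cst l1 l2 * (4 * s) < 1 -> lat k -> lat k' ->
  box x s (y + k) -> box x s (y + k') -> k = k'.
Proof.
move=> s1 kl k'l /box_enorm b1 /box_enorm b2; apply/eqP; rewrite -subr_eq0; apply/contraT => kk'.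
have := lattice_enorm_ge li (latticeB kl k'l) kk'.
have : enorm (k - k') <= 4 * s.
  have -> : k - k' = (y + k - x) - (y + k' - x) by vec.
  rewrite (le_trans (enormD _ _))// enormN; lra.
move=> /(ler_wpM2l (coord_cst_ge0 l1 l2)) => h1 h2; lra.
Qed.

(* With [s = radius_cst * vdist X y], the box of half-side [s] around [y] embeds in the torus
   and stays at distance [vdist X y / 2] from all generators. *)
Definition radius_cst : R := (4 + 8 * coord_cst l1 l2 * cover_radius l1 l2)^-1.

Lemma cover_radius_ge0 : 0 <= cover_radius l1 l2.
Proof. by rewrite addr_ge0// enorm_ge0. Qed.

Lemma radius_cst_gt0 : 0 < radius_cst.
Proof.
by rewrite invr_gt0 ltr_wpDr// mulr_ge0 ?cover_radius_ge0// mulr_ge0 ?coord_cst_ge0.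
Qed.

Lemma vdist_energy X y : radius_cst ^+ 2 * vdist X y ^+ 4 <= energy X.
Proof.
have [r0|r0] := ltP 0 (vdist X y); last first.
  have -> : vdist X y = 0 by apply/eqP; rewrite eq_le r0 vdist_ge0.
  by rewrite expr0n/= mulr0 energy_ge0.
have k0 := radius_cst_gt0; have c0 := coord_cst_ge0 l1 l2.
set r := vdist X y in r0 *; pose s := radius_cst * r.
have s0 : 0 < s by rewrite mulr_gt0.
have kE : radius_cst * (4 + 8 * coord_cst l1 l2 * cover_radius l1 l2) = 1.
  by rewrite mulVf// gt_eqF// -invr_gt0.
have rc : r <= cover_radius l1 l2 by exact: vdist_le_cover.
have kc : 0 <= radius_cst * coord_cst l1 l2 by rewrite mulr_ge0// ltW.
have kcD : radius_cst * coord_cst l1 l2 * r <= radius_cst * coord_cst l1 l2 * cover_radius l1 l2.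
  by rewrite ler_wpM2l.
have kcr : 0 <= radius_cst * coord_cst l1 l2 * cover_radius l1 l2.
  by rewrite mulr_ge0// cover_radius_ge0.
have k4 : radius_cst <= 1 / 4 by lra.
have pack : coord_cst l1 l2 * (4 * s) < 1 by rewrite /s; nra.
have sr : 2 * s <= r / 2 by rewrite /s; nra.
have fB : finset2 (box y s) by split; [exact: measurable_box|rewrite leb2_box// ltry].
have mV := (bmeas_vdist2 X measurableT).1.
apply: (@le_trans _ _ (Int (box y s) (fun x => vdist X x ^+ 2))); last first.
  rewrite -lee_fin /energy -IntE//; last exact: bmeas_vdist2 fB.1.
  rewrite -IntE; [|exact: finset2_FD|exact: bmeas_vdist2 (measurable_FD li)].
  apply: (ge0_integral_packing li) => //.
  - exact: measurable_box.
  - by move=> x; exact: sqr_ge0.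
  - by move=> k kl; apply: aeW => x; rewrite (vdist_periodic _ _ kl).
  - by move=> x k k'; exact: box_packing.
(* The area (2 s)^2 times the squared distance (r / 2)^2 is s^2 r^2, and s is [radius_cst] times
   r. *)
have -> : radius_cst ^+ 2 * r ^+ 4 = Int (box y s) (fun=> (r / 2) ^+ 2).
  by rewrite Int_cst// (leb2_box _ s0) /s /=; field.
apply: Int_le => //; [exact: bmeas_cst|exact: bmeas_vdist2 fB.1|].
move=> x /box_enorm bx; rewrite ler_sqr ?nnegrE ?vdist_ge0 ?divr_ge0 ?(ltW r0)//.
have : r - vdist X x <= 2 * s.
  by rewrite (le_trans (ler_norm _))// (le_trans (vdist_lip li N0 X y x))// enormB.
lra.
Qed.

(** A lower bound for the distance from [X i] to every other lift: the minimum handles the other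
    generators, and its starting value lies below the length of every nonzero lattice vector, hence
    handles the lifts of [X i] itself. It is not uniform in the mesh and only yields positive cell
    volumes. *)
Definition sep_cst X i : R :=
  \big[Num.min/ (coord_cst l1 l2 + 1)^-1]_(j | j != i) td (X i) (X j).

Lemma sep_cst_gt0 X i : distinct l1 l2 X -> 0 < sep_cst X i.
Proof.
move=> dX; have c1 : 0 < (coord_cst l1 l2 + 1)^-1.
  by rewrite invr_gt0 ltr_wpDl ?coord_cst_ge0.
by apply: lt_bigmin => // j ji; apply: tdist_neq0; apply: dX; rewrite eq_sym.
Qed.

Lemma box_planar_cell X i : distinct l1 l2 X -> box (X i) (sep_cst X i / 8) `<=` P X i.
Proof.
move=> dX y /box_enorm yb; have d0 := sep_cst_gt0 i dX.
have dj j : j != i -> sep_cst X i <= td (X i) (X j) by move=> ji; exact: bigmin_le_cond.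
have dc : sep_cst X i <= (coord_cst l1 l2 + 1)^-1 by exact: bigmin_le_id.
move=> j k kl; have [->|ji] := eqVneq j i; last first.
  have := dj j ji; have := tdist_le (X i) (X j) kl.
  have := enorm_triangle y (X i) (X j + k).
  have -> : X i - (X j + k) = X i - X j - k by vec.
  have -> : y - (X j + k) = y - X j - k by vec.
  rewrite (enormB (X i) y); lra.
have [->|k0] := eqVneq k 0; first by rewrite subr0.
have c0 := coord_cst_ge0 l1 l2.
have c1 : 0 < coord_cst l1 l2 + 1 by rewrite ltr_wpDl.
have k1 := lattice_enorm_ge li kl k0.
have : sep_cst X i <= enorm k.
  rewrite (le_trans dc)// -[_^-1]mul1r ler_pdivrMr//.
  rewrite (le_trans k1)// mulrC ler_wpM2l ?enorm_ge0//; lra.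
have : enorm k <= enorm (y - X i) + enorm (y - X i - k).
  have -> : k = (y - X i) - (y - X i - k) by vec.
  by rewrite (le_trans (enormD _ _))// enormN; have -> : y - X i - (y - X i - k) = k by vec.
lra.
Qed.

Lemma cell_volE X i : distinct l1 l2 X -> cell_vol l1 l2 X i = fine (@leb2 R (P X i)).
Proof.
move=> dX; rewrite /cell_vol /tvol; congr fine.
rewrite -[RHS]mul1e -[LHS]mul1e -!integral_cst//; last first.
- by apply: measurableI; [exact: measurable_cell|exact: measurable_FD].
- exact: measurable_planar_cell.
rewrite -(ge0_integral_planar_cell li N0 dX (g := cst 1))//.
by move=> k kl; exact: aeW.
Qed.

Lemma cell_vol_gt0 X i : distinct l1 l2 X -> 0 < cell_vol l1 l2 X i.
Proof.
move=> dX; rewrite cell_volE//; apply: fine_gt0.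
have d0 : 0 < sep_cst X i / 8 by rewrite divr_gt0 ?sep_cst_gt0.
have fP := finset2_planar_cell li N0 X i.
rewrite fP.2 andbT; apply: (@lt_le_trans _ _ (@leb2 R (box (X i) (sep_cst X i / 8)))).
  by rewrite leb2_box// lte_fin exprn_gt0// mulr_gt0.
by apply: le_mu; [exact: measurable_box|exact: fP.1|exact: box_planar_cell].
Qed.

Lemma vintegral_dotp X i (c : plane R) :
  dotp (vintegral (P X i) (fun y => y - X i)) c = Int (P X i) (fun y => dotp (y - X i) c).
Proof.
have fP := finset2_planar_cell li N0 X i.
have b1 : bmeas (P X i) (fun y : plane R => (y - X i).1).
  rewrite (_ : (fun y : plane R => (y - X i).1) = (fun y => dotp (y - X i) (1, 0))); first exact: bmeas_dotpB.
  apply/funext => y.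
  by rewrite /dotp /=; ring.
have b2 : bmeas (P X i) (fun y : plane R => (y - X i).2).
  rewrite (_ : (fun y : plane R => (y - X i).2) = (fun y => dotp (y - X i) (0, 1))); first exact: bmeas_dotpB.
  apply/funext => y.
  by rewrite /dotp /=; ring.
rewrite /vintegral {1}/dotp /= mulrC -(IntZ c.1 fP b1) mulrC -(IntZ c.2 fP b2).
rewrite -(IntD fP (bmeasZ c.1 b1) (bmeasZ c.2 b2)); apply: eq_Rintegral => y _.
by rewrite /dotp /= mulrC [c.2 * _]mulrC.
Qed.

Lemma centroid_dotp X i (c : plane R) : distinct l1 l2 X ->
  cell_vol l1 l2 X i * dotp (centroid_disp l1 l2 X i) c = Int (P X i) (fun y => dotp (y - X i) c).
Proof.
move=> dX; rewrite /centroid_disp dotpZl vintegral_dotp mulVKf// gt_eqF//.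
exact: cell_vol_gt0.
Qed.

(** The displacement d is tested against itself: V |d|^2 is the integral of (y - X i) . d over the
    cell, at most V r |d|. *)
Lemma centroid_disp_le X i (r : R) : distinct l1 l2 X -> 0 <= r ->
  (forall y, P X i y -> enorm (y - X i) <= r) -> enorm (centroid_disp l1 l2 X i) <= r.
Proof.
move=> dX r0 Pr; set d := centroid_disp _ _ _ _.
have V0 := cell_vol_gt0 i dX.
have fP := finset2_planar_cell li N0 X i.
have [->|d0] := eqVneq (enorm d) 0; first by [].
have dp : 0 < enorm d by rewrite lt_neqAle eq_sym d0 enorm_ge0.
rewrite -(ler_pM2r dp) -expr2 enorm_sqr -(ler_pM2l V0) centroid_dotp//.
rewrite [leRHS]mulrC cell_volE// -Int_cst//.
apply: (Int_le fP (bmeas_dotpB _ _ _) (bmeas_cst _ _)) => y Py.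
by rewrite (le_trans (dotp_le _ _))// ler_wpM2r ?enorm_ge0// Pr.
Qed.

(** On the cell of [X i] a point is charged its distance to [Y i], which is at least [vdist Y].
    Nothing is asked of [Y], and the motion of the cells never enters. *)
Lemma energy_envelope X Y : distinct l1 l2 X ->
  energy Y <= energy X -
    2 * (\sum_i cell_vol l1 l2 X i * dotp (centroid_disp l1 l2 X i) (Y i - X i)) +
    \sum_i cell_vol l1 l2 X i * enorm (Y i - X i) ^+ 2.
Proof.
move=> dX.
have E Z : energy Z = \sum_i Int (P X i) (fun y => vdist Z y ^+ 2).
  rewrite /energy -(Int_cells dX)//; [exact: bmeas_vdist2|by move=> x; exact: sqr_ge0|].
  by move=> k kl; apply: aeW => x; rewrite (vdist_periodic _ _ kl).
rewrite (E X) (E Y) mulr_sumr -sumrB -big_split/=; apply: ler_sum => i _.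
have fP := finset2_planar_cell li N0 X i.
set D := Y i - X i.
rewrite centroid_dotp// cell_volE// [_ * enorm D ^+ 2]mulrC -Int_cst//.
have b1 := bmeas_vdist2 X fP.1; have b2 := bmeas_dotpB X i D.
have b3 := bmeas_cst (P X i) (enorm D ^+ 2).
rewrite -(IntZ 2 fP b2) -(IntB fP b1 (bmeasZ 2 b2)) -(IntD fP (bmeasB b1 (bmeasZ 2 b2)) b3).
apply: (Int_le fP (bmeas_vdist2 Y fP.1) (bmeasD (bmeasB b1 (bmeasZ 2 b2)) b3)) => y Py.
rewrite (planar_cell_vdist N0 Py).
have -> : enorm (y - X i) ^+ 2 - 2 * dotp (y - X i) D + enorm D ^+ 2 = enorm (y - Y i) ^+ 2.
  by rewrite !enorm_sqr /D /dotp /=; ring.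
rewrite ler_sqr ?nnegrE ?enorm_ge0 ?vdist_ge0//.
rewrite (le_trans (vdist_le _ _ N0 Y _ i))//; exact: tdist_le_enorm.
Qed.

(** This transfers absolute continuity in time from the generators to the energy. The difference of
    squares factors, and both distances are at most the covering radius. *)
Lemma energy_lipschitz X Y :
  `|energy X - energy Y| <= 2 * cover_radius l1 l2 * fine (@leb2 R FD) * \sum_i enorm (X i - Y i).
Proof.
have fF := finset2_FD li; have c0 := cover_radius_ge0.
suff H U V : energy U - energy V <= 2 * cover_radius l1 l2 * fine (@leb2 R FD) * \sum_i enorm (U i - V i).
  rewrite ler_norml H andbT lerNl opprB.
  by under eq_bigr do rewrite enormB; exact: H.
rewrite /energy -(IntB fF (bmeas_vdist2 U fF.1) (bmeas_vdist2 V fF.1)) mulrAC -Int_cst//.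
apply: (Int_le fF (bmeasB (bmeas_vdist2 U fF.1) (bmeas_vdist2 V fF.1)) (bmeas_cst _ _)) => y _.
rewrite subr_sqr; have u0 := vdist_ge0 l1 l2 N0 U y; have v0 := vdist_ge0 l1 l2 N0 V y.
have uc := vdist_le_cover li N0 U y; have vc := vdist_le_cover li N0 V y.
have := vdist_lip_gen li N0 U V y; rewrite ler_norml => /andP[_ uv].
have s0 : 0 <= \sum_i enorm (U i - V i) by apply: sumr_ge0 => i _; exact: enorm_ge0.
rewrite mulrC (le_trans (ler_wpM2l (addr_ge0 u0 v0) uv))// ler_wpM2r//; lra.
Qed.

End Energy.

(** * One-sided Lipschitz fields *)

Section Field.
Context {R : realType}.
Notation mP := (measurableTypeR R * measurableTypeR R)%type.
Variables l1 l2 : plane R.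
Hypothesis li : lin_indep l1 l2.
Notation lat := (lattice l1 l2).
Notation P := (planar_cell l1 l2).
Implicit Types (v : plane R -> plane R) (u : mP -> mP) (L V : R).

(* [u] is a bounded Borel version of the everywhere defined field [v]. *)
Definition osl_field v u L V : Prop :=
  [/\ lattice_periodic l1 l2 v,
      forall x y, dotp (v x - v y) (x - y) <= L * enorm (x - y) ^+ 2,
      measurable_fun [set: mP] u,
      forall x, enorm (u x) <= V &
      {ae @leb2 R, forall x, v x = u x} /\ 0 <= L /\ 0 <= V].

Lemma osl_field_translate v u L V z :
  osl_field v u L V -> osl_field (fun x => v (x - z)) (fun x : plane R => u (x - z)) L V.
Proof.
move=> [vp vL mu uV [vu LV]]; split => //.
- by move=> x k kl; rewrite (addrAC x k) (vp _ _ kl).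
- by move=> x y; have := vL (x - z) (y - z); rewrite (_ : x - z - (y - z) = x - y)//; vec.
- by have := measurableT_comp mu (measurable_translate2 (- z)).
- by split => //; exact: (ae_translate2 (- z) vu).
Qed.

Lemma measurable_dotpr u (c : plane R) : measurable_fun [set: mP] u -> measurable_fun [set: mP] (fun y => dotp (u y) c).
Proof.
move=> mu; apply: measurable_funD; apply: measurable_funM => //.
  by have := measurableT_comp measurable_fst mu.
by have := measurableT_comp measurable_snd mu.
Qed.

Lemma norm_dotp_bounded u V (c : plane R) : (forall x, enorm (u x) <= V) ->
  forall x, `|dotp (u x) c| <= V * enorm c.
Proof. by move=> uV x; rewrite (le_trans (dotp_ler_norm _ _))// ler_wpM2r ?enorm_ge0. Qed.

Section EnergyField.
Variable N : nat.
Hypothesis N0 : (0 < N)%N.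
Variable X : 'I_N -> plane R.
Hypothesis dX : distinct l1 l2 X.

(** Up to a factor this is the derivative of the energy when all generators are translated together,
    which changes nothing. It is read off from [transport_energy] with a constant weight, for [e]
    and for [- e]. *)
Lemma momentum_zero (e : plane R) : \sum_i Int (P X i) (fun y => dotp (y - X i) e) = 0.
Proof.
have H (f : plane R) : 0 <= \sum_i Int (P X i) (fun y => dotp (y - X i) f).
  have := @transport_energy _ _ _ li _ N0 X (cst 1) f 0 1 dX.
  rewrite mul0r oppr0; under eq_bigr do under eq_Rintegral do rewrite mulr1.
  rewrite pmulr_rge0//; apply => [|x|k kl|s s0].
  - exact: measurable_cst.
  - by rewrite /= ler01 lexx.
  - exact: aeW.
  - by apply: aeW => x; rewrite /= mul0r subr0.
apply/eqP; rewrite eq_le H andbT -oppr_ge0 -sumrN.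
have := H (- e); congr (_ <= _); apply: eq_bigr => i _.
have := IntZ (-1) (finset2_planar_cell li N0 X i) (bmeas_dotpB li N0 X i e).
rewrite mulN1r => <-.
by apply: eq_Rintegral => y _; rewrite /dotp /=; ring.
Qed.

(** For a displacement along [e] the one-sided condition bounds the increment of the component along
    [e] and says nothing of the other one; this is what [transport_energy] asks of its weight. *)
Lemma field_energy_dir v u L V (e : plane R) : osl_field v u L V -> enorm e = 1 ->
  - (L * energy l1 l2 X) <= 2 * \sum_i Int (P X i) (fun y => dotp (y - X i) e * dotp (u y) e).
Proof.
move=> [vp vL mu uV [vu [L0 V0]]] e1.
have uVe x : `|dotp (u x) e| <= V by have := norm_dotp_bounded e uV x; rewrite e1 mulr1.
have mue := measurable_dotpr e mu.
(* By [momentum_zero] the constant [V], which makes the weight nonnegative, costs nothing. *)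
pose b : mP -> R := fun y => dotp (u y) e + V.
have -> : \sum_i Int (P X i) (fun y => dotp (y - X i) e * dotp (u y) e) =
    \sum_i Int (P X i) (fun y => dotp (y - X i) e * b y).
  transitivity (\sum_i Int (P X i) (fun y => dotp (y - X i) e * dotp (u y) e) +
     V * \sum_i Int (P X i) (fun y => dotp (y - X i) e)).
    by rewrite momentum_zero mulr0 addr0.
  rewrite mulr_sumr -big_split/=; apply: eq_bigr => i _.
  have fP := finset2_planar_cell li N0 X i.
  have b1 := bmeas_dotpB li N0 X i e.
  have b2 : bmeas (P X i) (fun y => dotp (u y) e).
    by apply: (bmeas_setT (M := V)) => //; exact: fP.1.
  rewrite -(IntZ V fP b1) -(IntD fP (bmeasM b1 b2) (bmeasZ V b1)).
  by apply: eq_Rintegral => y _; rewrite /b; ring.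
apply: (transport_energy li N0 (B := V + V) dX).
- by apply: measurable_funD => //; exact: measurable_cst.
- by move=> x; have := uVe x; rewrite ler_norml => /andP[? ?]; rewrite /b; apply/andP; split; lra.
- move=> k kl; apply: aeS (aeI vu (ae_translate2 k vu)) => x [vx vxk].
  by rewrite /b -vx -vxk vp.
- move=> s s0; apply: aeS (aeI vu (ae_translate2 (- (s *: e)) vu)) => x [vx vxs].
  rewrite /b -vx -vxs; have := vL x (x - s *: e).
  have -> : x - (x - s *: e) = s *: e by vec.
  rewrite enormZ e1 mulr1 (gtr0_norm s0) dotpZr dotpBl expr2 mulrA [L * s * s]mulrC.
  by rewrite ler_pM2l//; lra.
Qed.

(** The two coordinate directions together bound the total of (y - X i) . u y from below by - L E.
    On each cell the one-sided condition between [y] and [X i] replaces [v y] by [v (X i)] at the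
    cost L |y - X i|^2, another L E in total; hence the factor 2. *)
Lemma field_energy v u L V : osl_field v u L V ->
  - (2 * L * energy l1 l2 X) <=
  \sum_i cell_vol l1 l2 X i * dotp (centroid_disp l1 l2 X i) (v (X i)).
Proof.
move=> vu; have [vp vL mu uV [vuE [L0 V0]]] := vu.
have e10 : enorm ((1, 0) : plane R) = 1 by rewrite /enorm /dotp /= mulr0 addr0 mulr1 sqrtr1.
have e01 : enorm ((0, 1) : plane R) = 1 by rewrite /enorm /dotp /= mulr0 add0r mulr1 sqrtr1.
have h1 := field_energy_dir vu e10; have h2 := field_energy_dir vu e01.
have fP i := finset2_planar_cell li N0 X i.
have bd i e := bmeas_dotpB li N0 X i e.
have bu i e : bmeas (P X i) (fun y => dotp (u y) e).
  apply: (bmeas_setT (M := V * enorm e)); [exact: (fP i).1|exact: measurable_dotpr|].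
  by move=> x _; exact: norm_dotp_bounded.
have buu i : bmeas (P X i) (fun y : plane R => dotp (y - X i) (u y)).
  have := bmeasD (bmeasM (bd i (1, 0)) (bu i (1, 0))) (bmeasM (bd i (0, 1)) (bu i (0, 1))).
  congr bmeas; apply/funext => y; by rewrite /dotp /=; ring.
have h3 : - (L * energy l1 l2 X) <= \sum_i Int (P X i) (fun y : plane R => dotp (y - X i) (u y)).
  have -> : \sum_i Int (P X i) (fun y : plane R => dotp (y - X i) (u y)) =
     \sum_i Int (P X i) (fun y => dotp (y - X i) (1, 0) * dotp (u y) (1, 0)) +
     \sum_i Int (P X i) (fun y => dotp (y - X i) (0, 1) * dotp (u y) (0, 1)).
    rewrite -big_split/=; apply: eq_bigr => i _.
    rewrite -(IntD (fP i) (bmeasM (bd i (1, 0)) (bu i (1, 0))) (bmeasM (bd i (0, 1)) (bu i (0, 1)))).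
    by apply: eq_Rintegral => y _; rewrite /dotp /=; ring.
  by lra.
have h4 i : Int (P X i) (fun y : plane R => dotp (y - X i) (u y)) - L * Int (P X i) (fun y => enorm (y - X i) ^+ 2)
    <= cell_vol l1 l2 X i * dotp (centroid_disp l1 l2 X i) (v (X i)).
  rewrite centroid_dotp//.
  have be := bmeasX 2 (bmeas_enormB li N0 X i).
  rewrite -(IntZ L (fP i) be) -(IntB (fP i) (buu i) (bmeasZ L be)).
  apply: (Int_ae_le (fP i) (bmeasB (buu i) (bmeasZ L be)) (bd i _)).
  apply: aeS vuE => y vy _; rewrite -vy lerBlDr -lerBlDl -dotpBr.
  by rewrite dotpC (le_trans (vL _ _)).
have : \sum_i (Int (P X i) (fun y : plane R => dotp (y - X i) (u y)) - L * Int (P X i) (fun y => enorm (y - X i) ^+ 2))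
    <= \sum_i cell_vol l1 l2 X i * dotp (centroid_disp l1 l2 X i) (v (X i)).
  by apply: ler_sum => i _; exact: h4.
rewrite sumrB -mulr_sumr.
have -> : \sum_i Int (P X i) (fun y => enorm (y - X i) ^+ 2) = energy l1 l2 X.
  rewrite /energy -(Int_cells li N0 dX).
  - by apply: eq_bigr => i _; apply: eq_Rintegral => y; rewrite inE => Py; rewrite (planar_cell_vdist N0 Py).
  - exact: bmeas_vdist2.
  - by move=> x; exact: sqr_ge0.
  - by move=> k kl; apply: aeW => x; rewrite (vdist_periodic _ _ kl).
lra.
Qed.

End EnergyField.

Lemma nbhs_enorm (z : plane R) (d : R) : 0 < d -> nbhs z [set y | enorm (y - z) < d].
Proof.
move=> d0; have d20 : 0 < d / 2 by rewrite divr_gt0.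
exists (ball z.1 (d / 2), ball z.2 (d / 2)) => /=; first by split; exact: nbhsx_ballx.
move=> y [/=]; rewrite /ball /= => y1 y2.
by rewrite (le_lt_trans (enorm_le_norm12 _))//= (distrC y.1) (distrC y.2); lra.
Qed.

Lemma closed_lipschitz_le (K B : R) (f : plane R -> R) :
  (forall x y, `|f x - f y| <= K * enorm (x - y)) -> closed [set x | f x <= B].
Proof.
move=> fK; apply: (@closed_comp _ _ f [set t | t <= B]); last exact: closed_le.
by move=> x _; exact: (lipschitz_continuous2 fK).
Qed.

(** * Filippov sets of a one-sided Lipschitz field *)

Section Filippov.
Variables (v : plane R -> plane R) (u : mP -> mP) (L V : R).
Hypothesis vu : osl_field v u L V.

(** The conclusion describes a closed convex set of vectors [w], so it suffices to check essential
    values. These are limits of [v y] at points [y] of the ball where [v] and [u] agree, and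
    exchanging [z] for [y] costs a distance [d]. *)
Let filippov_ball (w z y0 a : plane R) (d : R) : 0 < d ->
  (forall y, dotp (v y - a) (y - y0) <= L * enorm (y - y0) ^+ 2) ->
  closed_convex_hull (ess_values v [set y | enorm (y - z) < d]) w ->
  dotp (w - a) (z - y0) <= L * (enorm (z - y0) + d) ^+ 2 + (V + enorm a) * d /\ enorm w <= V.
Proof.
move=> d0 va; have [vp vL mu uV [vuE [L0 V0]]] := vu.
set B := L * _ + _.
move=> /(_ [set w | dotp (w - a) (z - y0) <= B /\ enorm w <= V]); apply; split.
- apply: closedI.
    apply: (@closed_lipschitz_le (enorm (z - y0))) => x y.
    rewrite -dotpBl (_ : x - a - (y - a) = x - y); last by vec.
    by rewrite mulrC; exact: dotp_ler_norm.
  apply: (@closed_lipschitz_le 1) => x y.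
  by rewrite mul1r; exact: enorm_lerB_dist.
- move=> w1 w2 t; rewrite !inE /= => -[a1 b1] [a2 b2].
  rewrite -[conv t w1 w2]/(t%:num *: (w1 : plane R) + (1 - t%:num) *: (w2 : plane R)).
  have t0 : 0 <= t%:num by [].
  have t1 : 0 <= 1 - t%:num by rewrite subr_ge0.
  split.
    rewrite (_ : dotp _ _ = t%:num * dotp (w1 - a) (z - y0) + (1 - t%:num) * dotp (w2 - a) (z - y0)); last first.
      by rewrite /dotp /= /GRing.scale/=; ring.
    have := ler_wpM2l t0 a1; have := ler_wpM2l t1 a2; lra.
  rewrite (le_trans (enormD _ _))// !enormZ !ger0_norm//.
  have := ler_wpM2l t0 b1; have := ler_wpM2l t1 b2; lra.
- move=> w' ess /=.
  have near r : 0 < r -> exists y, [/\ enorm (y - z) < d, enorm (v y - w') < r & enorm (v y) <= V].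
    move=> r0; apply: contrapT => ny; apply: (ess r r0).
    apply: negligibleS vuE => y /= [yz yw] vy; apply: ny; exists y; split => //.
    by rewrite vy.
  have wV : enorm w' <= V.
    apply/ler_addgt0Pr => r r0; have [y [_ yw yV]] := near r r0.
    rewrite -(subrK (v y) w') (le_trans (enormD _ _))// enormB addrC; lra.
  split => //; apply/ler_addgt0Pr => r r0.
  have z1 : 0 < enorm (z - y0) + 1 by rewrite ltr_wpDl ?enorm_ge0.
  have [y [yz yw yV]] := near (r / (enorm (z - y0) + 1)) (divr_gt0 r0 z1).
  have -> : dotp (w' - a) (z - y0) = dotp (w' - v y) (z - y0) + (dotp (v y - a) (y - y0) + dotp (v y - a) (z - y)).
    by rewrite /dotp /=; ring.
  have t1 : dotp (w' - v y) (z - y0) <= r.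
    rewrite (le_trans (dotp_le _ _))// enormB.
    rewrite (le_trans (ler_wpM2r (enorm_ge0 _) (ltW yw)))// mulrAC ler_pdivrMr//.
    by rewrite ler_pM2l// lerDl.
  have t2 : dotp (v y - a) (y - y0) <= L * (enorm (z - y0) + d) ^+ 2.
    rewrite (le_trans (va y))// ler_wpM2l// ler_sqr ?nnegrE ?enorm_ge0//; last first.
      by rewrite addr_ge0 ?enorm_ge0// ltW.
    by rewrite (le_trans (enorm_triangle z _ _))// addrC lerD2l ltW.
  have t3 : dotp (v y - a) (z - y) <= (V + enorm a) * d.
    rewrite (le_trans (dotp_le _ _))// ler_pM ?enorm_ge0//.
      by rewrite (le_trans (enormD _ _))// enormN lerD2r.
    by rewrite enormB ltW.
  by rewrite /B; lra.
Qed.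

(** The radius of the ball tends to 0. The vector [a] is only required to be compatible with [v] at
    [y0], rather than equal to [v y0], so that the lemma can be applied again with [a] taken in the
    Filippov set at [y0]: this is how two Filippov values are compared. *)
Lemma filippov_osl (V' : R -> plane R -> plane R) t (w z y0 a : plane R) : V' t = v ->
  filippov V' t z w ->
  (forall y, dotp (v y - a) (y - y0) <= L * enorm (y - y0) ^+ 2) ->
  dotp (w - a) (z - y0) <= L * enorm (z - y0) ^+ 2.
Proof.
move=> Vv fw va; have [vp vL mu uV [vuE [L0 V0]]] := vu.
apply/ler_addgt0Pr => r r0; set q := enorm (z - y0).
have q0 : 0 <= q by exact: enorm_ge0.
(* For [d <= 1] the bound of [filippov_ball] exceeds [L * q ^+ 2] by at most [d * K]. *)
pose K := L * (2 * q + 1) + (V + enorm a).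
have K0 : 0 <= K by rewrite addr_ge0 ?mulr_ge0 ?addr_ge0 ?enorm_ge0// mulr_ge0.
pose d := Num.min 1 (r / (K + 1)).
have K1 : 0 < K + 1 by rewrite ltr_wpDl.
have d0 : 0 < d by rewrite lt_min ltr01 divr_gt0.
have d1 : d <= 1 by rewrite ge_min lexx.
have dK : d * (K + 1) <= r by rewrite -ler_pdivlMr// ge_min lexx orbT.
have : closed_convex_hull (ess_values v [set y | enorm (y - z) < d]) w.
  by rewrite -Vv; apply: fw; exact: nbhs_enorm.
move=> /(filippov_ball d0 va)[+ _]; rewrite -/q => H; apply: (le_trans H).
have : 0 <= L * (d * (1 - d)) by rewrite mulr_ge0// mulr_ge0 ?subr_ge0// ltW.
move: dK; rewrite /K; nra.
Qed.

Lemma filippov_le (V' : R -> plane R -> plane R) t (w z : plane R) : V' t = v ->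
  filippov V' t z w -> enorm w <= V.
Proof.
move=> Vv fw; have [vp vL mu uV [vuE [L0 V0]]] := vu.
have : closed_convex_hull (ess_values v [set y | enorm (y - z) < 1]) w.
  by rewrite -Vv; apply: fw; exact: nbhs_enorm.
by move=> /(filippov_ball ltr01 (fun y => vL y z))[].
Qed.

Lemma filippov_monotone (V' : R -> plane R -> plane R) t (w1 w2 z1 z2 : plane R) : V' t = v ->
  filippov V' t z1 w1 -> filippov V' t z2 w2 ->
  dotp (w1 - w2) (z1 - z2) <= L * enorm (z1 - z2) ^+ 2.
Proof.
move=> Vv f1 f2; apply: (filippov_osl Vv f1) => y.
have [vp vL _ _ _] := vu.
have := filippov_osl Vv f2 (fun y' => vL y' y).
by rewrite enormB; congr (_ <= _); rewrite /dotp /=; ring.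
Qed.

End Filippov.

(** * Mollified fields as averages of translates *)

Section Mollify.
Variables (eps : R) (eta : plane R -> R).
Hypothesis meta : mollifier eps eta.
Notation mol v x := (vintegral setT (fun z => eta z *: v (x - z))).

Let eta0 z : 0 <= eta z. Proof. by case: meta. Qed.

Lemma mollifier_measurable : measurable_fun [set: mP] (eta : mP -> R).
Proof.
apply: continuous_measurable2 => x; apply: differentiable_continuous.
by case: meta => /(_ [::] x).
Qed.

Lemma mollifier_integrable : (@leb2 R).-integrable setT (EFin \o eta).
Proof.
apply/integrableP; split.
  by apply/measurable_EFinP; exact: mollifier_measurable.
case: meta => _ _ _ _ eta1; rewrite [X in (X < _)%E](_ : _ = 1%E) ?ltry// -eta1.
by apply: eq_integral => x _ /=; rewrite ger0_norm.
Qed.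

(** The expectation for the probability density [eta]; estimates on translates of the field are
    averaged with it. *)
Definition eint (f : mP -> R) : R := Int setT (fun z => eta z * f z).

Lemma eint_integrable f : bmeas setT f -> (@leb2 R).-integrable setT (EFin \o (fun z => eta z * f z)).
Proof.
move=> [mf [M fM]].
have bf : [bounded f x | x in [set: mP]].
  exists M; split; [exact: num_real|move=> y My x _; apply: (le_trans (fM x I)); exact: ltW].
have := integrableMl measurableT mollifier_integrable mf bf.
by apply: eq_integrable => // x _ /=; rewrite EFinM.
Qed.

Lemma eintD f g : bmeas setT f -> bmeas setT g -> eint (fun z => f z + g z) = eint f + eint g.
Proof.
move=> bf bg; rewrite /eint -RintegralD//; [|exact: eint_integrable|exact: eint_integrable].
by apply: eq_Rintegral => z _; rewrite mulrDr.
Qed.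

Lemma eintZ f (c : R) : bmeas setT f -> eint (fun z => c * f z) = c * eint f.
Proof.
move=> bf; rewrite /eint -RintegralZl//; last exact: eint_integrable.
by apply: eq_Rintegral => z _; rewrite mulrCA.
Qed.

Lemma eint_cst (c : R) : eint (fun=> c) = c.
Proof.
have := @eintZ (fun=> 1) c (bmeas_cst _ _); rewrite /eint mulr1.
under [X in _ = _ * X -> _]eq_Rintegral do rewrite mulr1.
case: meta => _ _ _ _ eta1; rewrite [in X in _ = _ * X -> _]/Rintegral eta1/= mulr1.
by under eq_Rintegral do rewrite ?mulr1.
Qed.

Lemma eint_sum (I : finType) (f : I -> mP -> R) : (forall i, bmeas setT (f i)) ->
  eint (fun z => \sum_i f i z) = \sum_i eint (f i).
Proof.
move=> bf; rewrite -[index_enum I]/(index_enum _).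
elim: (index_enum I) => [|i s IHs].
  by rewrite big_nil -[RHS](eint_cst 0); congr eint; apply/funext => z; rewrite big_nil.
rewrite big_cons -IHs -eintD//.
  by congr eint; apply/funext => z; rewrite big_cons.
elim: s {IHs} => [|j s IHs]; first by under eq_fun do rewrite big_nil; exact: bmeas_cst.
by under eq_fun do rewrite big_cons; exact: bmeasD.
Qed.

Lemma eint_le f g : bmeas setT f -> bmeas setT g ->
  {ae @leb2 R, forall z, eta z != 0 -> f z <= g z} -> eint f <= eint g.
Proof.
move=> bf bg fg; rewrite -subr_ge0.
have -> : eint g - eint f = Int setT (fun z => eta z * (g z - f z)).
  rewrite /eint -RintegralB//; [|exact: eint_integrable|exact: eint_integrable].
  by apply: eq_Rintegral => z _; rewrite mulrBr.
rewrite fine_ge0//.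
have -> : (\int[@leb2 R]_x (eta x * (g x - f x))%:E = \int[@leb2 R]_x (Num.max 0 (eta x * (g x - f x)))%:E)%E.
  apply: ae_eq_integral_nomeas; apply: aeS fg => x fg _; congr EFin.
  rewrite max_r//; have [->|e0] := eqVneq (eta x) 0; first by rewrite mul0r.
  by rewrite mulr_ge0// subr_ge0 fg.
by apply: integral_ge0 => x _; rewrite lee_fin le_max lexx.
Qed.

Lemma mollify_dotp v u L V x (c : plane R) : osl_field v u L V ->
  dotp (mol v x) c = eint (fun z : plane R => dotp (u (x - z)) c).
Proof.
move=> [vp vL mu uV [vuE [L0 V0]]].
have mus : measurable_fun [set: mP] (fun z : plane R => u (x - z)).
  have m1 := measurableT_comp (measurable_translate2 x) measurable_opp2.
  have := measurableT_comp mu m1.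
  by congr measurable_fun; apply/funext => z /=; rewrite addrC.
have b1 : bmeas setT (fun z : plane R => (u (x - z)).1).
  apply: (bmeas_setT (M := V)) => //; first by have := measurableT_comp measurable_fst mus.
  by move=> z _; rewrite (le_trans (norm1_le_enorm _)).
have b2 : bmeas setT (fun z : plane R => (u (x - z)).2).
  apply: (bmeas_setT (M := V)) => //; first by have := measurableT_comp measurable_snd mus.
  by move=> z _; rewrite (le_trans (norm2_le_enorm _)).
have e1 : Int setT (fun z => (eta z *: v (x - z)).1) = eint (fun z : plane R => (u (x - z)).1).
  congr fine; apply: ae_eq_integral_nomeas; apply: aeS (ae_sub2 x vuE) => z vz _.
  by rewrite /= vz.
have e2 : Int setT (fun z => (eta z *: v (x - z)).2) = eint (fun z : plane R => (u (x - z)).2).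
  congr fine; apply: ae_eq_integral_nomeas; apply: aeS (ae_sub2 x vuE) => z vz _.
  by rewrite /= vz.
rewrite {1}/dotp /vintegral /= e1 e2 mulrC -eintZ// mulrC -eintZ// -eintD//; [|exact: bmeasZ|exact: bmeasZ].
by congr eint; apply/funext => z; rewrite /dotp mulrC [c.2 * _]mulrC.
Qed.

Lemma bmeas_shift_dotp v u L V x (c : plane R) : osl_field v u L V ->
  bmeas setT (fun z : plane R => dotp (u (x - z)) c).
Proof.
move=> [vp vL mu uV _].
have mus : measurable_fun [set: mP] (fun z : plane R => u (x - z)).
  have m1 := measurableT_comp (measurable_translate2 x) measurable_opp2.
  have := measurableT_comp mu m1.
  by congr measurable_fun; apply/funext => z /=; rewrite addrC.
apply: (bmeas_setT (M := V * enorm c)) => //; first exact: (measurable_dotpr c mus).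
by move=> z _; exact: (norm_dotp_bounded c uV).
Qed.

(** Each translate of the field by [z] satisfies [field_energy] with the same constants. Cells and
    displacements do not depend on [z], so averaging keeps the bound. *)
Lemma mollify_energy N (N0 : (0 < N)%N) (X : 'I_N -> plane R) v u L V :
  distinct l1 l2 X -> osl_field v u L V ->
  - (2 * L * energy l1 l2 X) <=
  \sum_i cell_vol l1 l2 X i * dotp (centroid_disp l1 l2 X i) (mol v (X i)).
Proof.
move=> dX vu; have [_ _ _ _ [vuE _]] := vu.
have b i := bmeas_shift_dotp (X i) (centroid_disp l1 l2 X i) vu.
have -> : \sum_i cell_vol l1 l2 X i * dotp (centroid_disp l1 l2 X i) (mol v (X i)) =
    eint (fun z : plane R => \sum_i cell_vol l1 l2 X i * dotp (u (X i - z)) (centroid_disp l1 l2 X i)).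
  rewrite eint_sum; last by move=> i; exact: bmeasZ.
  by apply: eq_bigr => i _; rewrite eintZ// dotpC (mollify_dotp _ _ vu).
rewrite -[leLHS]eint_cst; apply: eint_le => //.
- exact: bmeas_cst.
- by apply: bmeas_sum => i; exact: bmeasZ.
- have : {ae @leb2 R, forall z, forall i : 'I_N, v (X i - z) = u (X i - z)}.
    by apply: ae_forall_count => i; exact: (ae_sub2 (X i) vuE).
  apply: aeS => z vz _; have := field_energy N0 dX (osl_field_translate z vu).
  congr (_ <= _); apply: eq_bigr => i _; by rewrite vz dotpC.
Qed.

(** [w] is compared with each value [v (x + k - q)], |q| <= eps, that enters the average. The
    one-sided condition then sees p + q instead of p: its right-hand side is split by |p + q|^2 <= 2
    |p|^2 + 2 |q|^2, and removing q on the left costs 2 V eps by the speed bound. *)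
Lemma mollify_filippov (V' : R -> plane R -> plane R) t v u L V (w z x k : plane R) :
  osl_field v u L V -> V' t = v -> lat k -> 0 <= eps -> filippov V' t z w ->
  dotp (w - mol v x) (z - x - k) <= 2 * L * (enorm (z - x - k) ^+ 2 + eps ^+ 2) + 2 * V * eps.
Proof.
move=> vu Vv kl eps0 fw; have [vp vL _ uV [vuE [L0 V0]]] := vu.
set p := z - x - k; set B := _ + _.
rewrite dotpBl (mollify_dotp _ _ vu) lerBlDr -lerBlDl -[leLHS]eint_cst.
apply: eint_le; [exact: bmeas_cst|exact: bmeas_shift_dotp vu|].
apply: aeS (ae_sub2 x vuE) => q vq eq0.
have qe : enorm q <= eps.
  rewrite leNgt; apply/negP => /ltW qe; move: eq0.
  by case: meta => _ _ _ /(_ _ qe) -> _; rewrite eqxx.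
rewrite lerBlDl -lerBlDr -dotpBl -vq.
have vE : v (x - q) = v (x + k - q) by rewrite addrAC (vp _ _ kl).
rewrite vE.
have := filippov_osl vu Vv fw (fun y => vL y (x + k - q)).
have -> : z - (x + k - q) = p + q by rewrite /p; vec.
rewrite dotpDr enorm_sqrD => H.
have wV := filippov_le vu Vv fw.
have d1 : - dotp (w - v (x + k - q)) q <= 2 * V * eps.
  rewrite -dotpNl (le_trans (dotp_le _ _))// ler_pM ?enorm_ge0//.
  rewrite enormN (le_trans (enormD _ _))// enormN -vE vq.
  by have := uV (x - q); lra.
have d2 : 2 * dotp p q <= enorm p ^+ 2 + enorm q ^+ 2.
  have := sqr_ge0 (enorm (p - q)); rewrite enorm_sqrD enormN -(dotpC (- q)) dotpNl (dotpC q); lra.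
have d3 : enorm q ^+ 2 <= eps ^+ 2 by rewrite ler_sqr ?nnegrE ?enorm_ge0.
have : L * (enorm p ^+ 2 + 2 * dotp p q + enorm q ^+ 2) <= L * (2 * (enorm p ^+ 2 + eps ^+ 2)).
  by rewrite ler_wpM2l//; lra.
rewrite /B; lra.
Qed.

End Mollify.
End Field.

(** * Primitives in time and the speed bound *)

Section Primitive.
Context {R : realType}.
Variables (T I : R) (f : R -> R).
Hypotheses (T0 : 0 < T) (mf : (leb R).-integrable `]0, T[ (EFin \o f))
  (f0 : forall t, 0 < t < T -> 0 <= f t)
  (fI : (\int[leb R]_(t in `]0%R, T[) (f t)%:E = I%:E)%E).

Let g : R -> R := f \_ `]0, T[.

Let g0 t : 0 <= g t.
Proof. by rewrite /g patchE; case: ifP => //; rewrite inE/= in_itv/=; exact: f0. Qed.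

Let ig : (leb R).-integrable setT (EFin \o g).
Proof. by rewrite /g -restrict_EFin; apply/integrable_restrict => //; rewrite setTI. Qed.

Let igS (A : set (measurableTypeR R)) : measurable A -> (leb R).-integrable A (EFin \o g).
Proof. by move=> mA; exact: integrableS ig. Qed.

(** Integrating the extension by zero from -oo makes sign, monotonicity and the bound by the total
    integral valid at every real time, with value 0 at time 0. *)
Definition primitive (t : R) : R := Rintegral (leb R) `]-oo, t] g.

Lemma primitiveB l r : l <= r -> primitive r - primitive l = Rintegral (leb R) `]l, r[ g.
Proof.
move=> lr; rewrite /primitive Rintegral_itvB//; last exact: igS.
by rewrite Rintegral_itv_bndo_bndc//; exact: igS.
Qed.

Lemma primitive_nd l r : l <= r -> primitive l <= primitive r.
Proof.
move=> lr; rewrite -subr_ge0 primitiveB//; apply: Rintegral_ge0 => x _; exact: g0.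
Qed.

Lemma primitive0 : primitive 0 = 0.
Proof.
transitivity (Rintegral (leb R) `]-oo, 0] (fun=> 0)); last by rewrite /Rintegral integral0.
apply: eq_Rintegral => x.
rewrite inE/= in_itv/= => x0.
by rewrite /g /patch memNset//= in_itv/= ltNge x0.
Qed.

Lemma primitive_ge0 t : 0 <= primitive t.
Proof. by apply: Rintegral_ge0 => x _; exact: g0. Qed.

Lemma primitive_le t : primitive t <= I.
Proof.
rewrite -lee_fin /primitive fineK; last by apply: integrable_fin_num => //; exact: igS.
rewrite -fI [leRHS]integral_mkcond.
apply: (@le_trans _ _ (\int[leb R]_x (g x)%:E)%E); last first.
  rewrite le_eqVlt; apply/orP; left; apply/eqP; apply: eq_integral => x _.
  by rewrite /g !patchE; case: ifP.
apply: ge0_subset_integral => //; first exact: measurable_int ig.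
by move=> x _; rewrite lee_fin.
Qed.

Lemma primitive_ac : ac T (fun l r => `|primitive r - primitive l|).
Proof.
move=> e e0; have [d [d0 dP]] := integral_normr_continuous ig e0.
exists d => // n l r lr tlr sd.
pose A := \big[setU/set0]_(i < n) `]l i, r i[%classic.
have mA : @measurable _ (measurableTypeR R) A.
  by apply: bigsetU_measurable => i _; exact: measurable_itv.
have muA : leb R A = (\sum_(i < n) (r i - l i))%:E.
  have -> : leb R A = \sum_(i < n) leb R `]l i, r i[%classic.
    by apply: (measure_semi_additive_ord (leb R)) => // i; exact: measurable_itv.
  rewrite -sumEFin; apply: eq_bigr => i _; rewrite lebesgue_measure_itv/= lte_fin.
  have [_ [lri _]] := lr i; case: ltP => // rl; have -> : l i = r i by apply/eqP; rewrite eq_le lri.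
  by rewrite subrr.
have intA : (\int[leb R]_(x in A) (g x)%:E = (\sum_(i < n) `|primitive (r i) - primitive (l i)|)%:E)%E.
  rewrite -sumEFin /A ge0_integral_bigsetU//.
  - apply: eq_bigr => i _; have [_ [lri _]] := lr i.
    rewrite ger0_norm ?subr_ge0 ?primitive_nd// primitiveB// fineK//.
    by apply: integrable_fin_num => //; apply: igS; exact: measurable_itv.
  - exact: index_enum_uniq.
  - by apply: sub_trivIset tlr.
  - by apply: measurable_funTS; exact: measurable_int ig.
  - by move=> x _; rewrite lee_fin.
have := dP A mA; rewrite [X in (X < _)%E -> _]muA lte_fin => /(_ sd); apply: le_lt_trans.
rewrite le_eqVlt; apply/orP; left; apply/eqP.
rewrite -[LHS]/(fine (_)%:E) -intA; congr fine; apply: eq_integral => x _.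
by rewrite ger0_norm.
Qed.

Lemma primitive_derive : {ae leb R, forall t, 0 < t < T -> is_derive t 1 primitive (f t)}.
Proof.
have := FTC1Ny (fun y => igS (measurable_itv _)) (integrable_locally (measurable_itv _) mf).
apply: aeS => t [dt gt] tT; split => //.
by rewrite -derive1E [LHS]gt /g patchE mem_set//= in_itv/=.
Qed.

End Primitive.

Section SpeedBound.
Context {R : realType}.
Notation mP := (measurableTypeR R * measurableTypeR R)%type.
Variables (T IV : R) (v : R -> plane R -> plane R).
Hypotheses (T0 : 0 < T) (mv : lebesgue_measurable_field T v)
  (vIV : (\int[leb R]_(t in `]0%R, T[) Linf_norm (v t) = IV%:E)%E).

Lemma measurable_enorm2 (w : measurableTypeR R * mP -> mP) : measurable_fun setT w ->
  measurable_fun setT (fun p => enorm (w p)).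
Proof.
move=> mw; have me : measurable_fun [set: mP] (fun x : mP => enorm x).
  apply: continuous_measurable2; apply: (@lipschitz_continuous2 _ 1) => x y.
  by rewrite mul1r; exact: enorm_lerB_dist.
by have := measurableT_comp me mw.
Qed.

(** The essential supremum at time [t] exceeds [y] exactly when the section at [t] of the set |w| >
    y is not null, and the measure of sections is measurable in [t]. *)
Lemma measurable_Linf_norm (w : measurableTypeR R * mP -> mP) : measurable_fun setT w ->
  measurable_fun [set: measurableTypeR R] (fun t => Linf_norm (fun x => w (t, x))).
Proof.
move=> mw; have me := measurable_enorm2 mw.
apply: (measurability _ (ErealGenOInfty.measurableE R)) => _ [_ [y ->] <-].
rewrite setTI.
pose A : set (measurableTypeR R * mP) := [set p | y < enorm (w p)].
have mA : measurable A.
  rewrite -[X in measurable X]setTI (_ : A = (fun p => enorm (w p)) @^-1` `]y, +oo[).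
    exact: me.
  by apply/seteqP; split => p; rewrite /A /= in_itv/= andbT.
rewrite (_ : _ @^-1` _ = setT `&` [set t | (@leb2 R \o xsection A) t != 0%E]).
  by apply: emeasurable_neq => //; exact: measurable_fun_xsection.
rewrite setTI; apply/seteqP; split => t /=.
  rewrite in_itv/= andbT => yt; apply/eqP => A0.
  move: yt; rewrite ltNge => /negP; apply; apply/ess_supP.
  exists (xsection A t); split => //; first exact: measurable_xsection.
  by move=> x /= /negP; rewrite lee_fin -ltNge => xy; rewrite /xsection/= inE.
rewrite in_itv/= andbT => A0; rewrite ltNge; apply/negP => /ess_supP [N [mN N0 sN]].
move/eqP: A0; apply; apply/eqP; rewrite -measure_le0 -N0; apply: le_mu => //.
  exact: measurable_xsection.
by move=> x; rewrite /xsection/= inE => Ax; apply: sN => /=; rewrite lee_fin leNgt; apply/negP; rewrite negbK.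
Qed.

(** The Borel version is replaced by 0 where it exceeds its essential supremum, so that the bound
    holds at every point, as [osl_field] demands. Integrability makes the supremum finite at almost
    every time, and [fine] is harmless there. *)
Lemma speed_bound : exists Vm : R -> R, [/\ (leb R).-integrable `]0, T[ (EFin \o Vm),
  forall t, 0 <= Vm t, (\int[leb R]_(t in `]0%R, T[) (Vm t)%:E = IV%:E)%E &
  {ae leb R, forall t, 0 < t < T -> exists u : mP -> mP, [/\ measurable_fun setT u,
     forall x, enorm (u x) <= Vm t & {ae @leb2 R, forall x, v t x = u x}]}].
Proof.
have [w mw vw] := mv.
have mL := measurable_Linf_norm mw.
pose Lw t := Linf_norm (fun x => w (t, x)).
have Lw0 t : (0 <= Lw t)%E.
  (* Over a space of measure zero an essential supremum would be -oo; a unit box shows that the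
     plane is not null. *)
  apply: ess_sup_gee; last by apply: aeW => x; rewrite lee_fin enorm_ge0.
  apply: (@lt_le_trans _ _ (@leb2 R (box 0 1))).
    by rewrite leb2_box// lte_fin exprn_gt0// mulr_gt0.
  by apply: le_mu => //; exact: measurable_box.
have vw' : {ae leb R, forall t, 0 < t < T -> {ae @leb2 R, forall x, v t x = w (t, x)}}.
  apply: aeS (ae_xsection vw) => t H tT; apply: aeS H => x; exact.
have LwIV : (\int[leb R]_(t in `]0%R, T[) Lw t = IV%:E)%E.
  rewrite -vIV; apply: ae_eq_integral_nomeas; apply: aeS vw' => t H.
  rewrite /= in_itv/= => /H{}H; apply: eq_ess_sup; apply: aeS H => x ->//.
have iLw : (leb R).-integrable `]0, T[ Lw.
  apply/integrableP; split; first exact: measurable_funTS.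
  rewrite (_ : (\int[_]_(_ in _) _)%E = IV%:E) ?ltry// -LwIV; apply: eq_integral => t _.
  by rewrite gee0_abs.
have m0T : @measurable _ (measurableTypeR R) `]0, T[ by exact: measurable_itv.
have fLw := integrable_ae m0T iLw.
have fineLw : {ae leb R, forall t, `]0, T[%classic t -> Lw t = (fine (Lw t))%:E}.
  by apply: aeS fLw => t H tT; rewrite fineK// H.
have IE : (\int[leb R]_(t in `]0%R, T[) (fine (Lw t))%:E = IV%:E)%E.
  by rewrite -LwIV; apply: ae_eq_integral_nomeas; apply: aeS fineLw => t H /H.
have mfL : measurable_fun [set: measurableTypeR R] (fun t => fine (Lw t)).
  by apply: measurableT_comp => //; exact: fine_measurable.
exists (fun t => fine (Lw t)); split => //.
- apply/integrableP; split; first by apply/measurable_EFinP; exact: measurable_funTS.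
  rewrite (_ : (\int[_]_(_ in _) _)%E = IV%:E) ?ltry// -IE; apply: eq_integral => t _.
  by rewrite /= ger0_norm// fine_ge0.
- by move=> t; rewrite fine_ge0.
- apply: aeS (aeI vw' fineLw) => t [H1 H2] tT.
  have wL : {ae @leb2 R, forall x, enorm (w (t, x)) <= fine (Lw t)}.
    have := ess_sup_ge (@leb2 R) (fun x => (enorm (w (t, x)))%:E); apply: aeS => x.
    by rewrite -[ess_sup _ _]/(Lw t) H2/= ?lee_fin// in_itv.
  have mwt : measurable_fun [set: mP] (fun x => w (t, x)).
    by have := measurableT_comp mw (pair1_measurable t).
  exists (fun x => if enorm (w (t, x)) <= fine (Lw t) then w (t, x) else 0); split.
  + apply: measurable_fun_ifT => //.
    apply: measurable_fun_ler => //.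
    by have := measurableT_comp (measurable_enorm2 mw) (pair1_measurable t).
  + by move=> x; case: ifP => // _; rewrite enorm0 fine_ge0.
  + by apply: aeS (aeI (H1 tT) wL) => x [-> ->].
Qed.

End SpeedBound.

(** * Lyapunov estimates along the flow and the generators *)

Section AbsolutelyContinuousFunctions.
Context {R : realType}.
Variable T : R.
Hypothesis T0 : 0 < T.
Definition acfun (f : R -> R) : Prop := ac T (fun l r => `|f r - f l|).
Implicit Types f g : R -> R.

(** [f] moves by less than 1 over each step of length [d / 2], and finitely many steps cover [0, T].
    Boundedness is what products of such functions need. *)
Lemma acfun_bounded f : acfun f -> exists M : R, forall t, 0 <= t <= T -> `|f t| <= M.
Proof.
move=> af; have [d d0 dP] := ac_cont af ltr01.
have H n : forall t, 0 <= t <= T -> t <= n%:R * (d / 2) -> `|f t| <= `|f 0| + n%:R.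
  elim: n => [|n IHn] t /andP[t0 tT] tn.
    have -> : t = 0 by apply/eqP; rewrite eq_le t0 andbT; move: tn; rewrite mul0r.
    by rewrite addr0.
  have [td|td] := leP t (d / 2).
    rewrite -[f t](subrK (f 0)) addrC (le_trans (ler_normD _ _))// lerD2l.
    have : `|f t - f 0| < 1 by apply: dP => //; lra.
    by rewrite -natr1; have := ler0n R n; lra.
  have : `|f (t - d / 2)| <= `|f 0| + n%:R.
    apply: IHn; first by apply/andP; split; lra.
    by move: tn; rewrite -natr1 mulrDl mul1r; lra.
  have : `|f t - f (t - d / 2)| < 1 by apply: dP => //; lra.
  have : `|f t| <= `|f t - f (t - d / 2)| + `|f (t - d / 2)|.
    by rewrite (le_trans _ (ler_normD _ _))// subrK.
  by rewrite -natr1; lra.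
exists (`|f 0| + (Num.trunc (T / (d / 2))).+1%:R) => t tT; apply: H => //.
have d20 : 0 < d / 2 by rewrite divr_gt0.
rewrite -ler_pdivrMr//; apply/ltW; apply: le_lt_trans (truncnS_gt _).
by rewrite ler_pM2r ?invr_gt0//; case/andP: tT.
Qed.

Lemma acfun_le2 f g1 g2 (K : R) : 0 <= K -> acfun g1 -> acfun g2 ->
  (forall l r, 0 <= l -> l <= r -> r <= T -> `|f r - f l| <= K * (`|g1 r - g1 l| + `|g2 r - g2 l|)) ->
  acfun f.
Proof. by move=> K0 a1 a2 H; apply: (ac_le H); apply: acZ => //; exact: acD. Qed.

Lemma acfun_le1 f g1 (K : R) : 0 <= K -> acfun g1 ->
  (forall l r, 0 <= l -> l <= r -> r <= T -> `|f r - f l| <= K * `|g1 r - g1 l|) -> acfun f.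
Proof. by move=> K0 a1 H; apply: (ac_le H); apply: acZ. Qed.

Lemma acfun_D f g : acfun f -> acfun g -> acfun (fun t => f t + g t).
Proof.
move=> af ag; apply: (acfun_le2 ler01 af ag) => l r _ _ _; rewrite mul1r.
by rewrite (le_trans _ (ler_normD _ _))// le_eqVlt; apply/orP; left; apply/eqP; congr `|_|; ring.
Qed.

Lemma acfun_Z f (c : R) : acfun f -> acfun (fun t => c * f t).
Proof. by move=> af; apply: (acfun_le1 (normr_ge0 c) af) => l r _ _ _; rewrite -mulrBr normrM. Qed.

Lemma acfun_cst (c : R) : acfun (fun=> c).
Proof.
apply: (@ac_le _ _ _ (fun l r => r - l)); last exact: ac_id.
by move=> l r _ lr _; rewrite subrr normr0 subr_ge0.
Qed.

Lemma acfun_id : acfun id.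
Proof.
apply: (@ac_le _ _ _ (fun l r => r - l)); last exact: ac_id.
by move=> l r _ lr _; rewrite ger0_norm ?subr_ge0.
Qed.

Lemma acfun_B f g : acfun f -> acfun g -> acfun (fun t => f t - g t).
Proof.
move=> af ag; have := acfun_D af (acfun_Z (-1) ag); apply: ac_le => l r _ _ _.
by rewrite !mulN1r.
Qed.

Lemma acfun_M f g : acfun f -> acfun g -> acfun (fun t => f t * g t).
Proof.
move=> af ag; have [M fM] := acfun_bounded af; have [K gK] := acfun_bounded ag.
have M0 : 0 <= M by rewrite (le_trans _ (fM 0 _))// lexx ltW.
have K0 : 0 <= K by rewrite (le_trans _ (gK 0 _))// lexx ltW.
apply: (acfun_le2 (addr_ge0 M0 K0) af ag) => l r l0 lr rT.
have -> : f r * g r - f l * g l = (f r - f l) * g r + f l * (g r - g l) by ring.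
rewrite (le_trans (ler_normD _ _))// !normrM.
have h1 : `|g r| <= K by apply: gK; rewrite rT (le_trans l0).
have h2 : `|f l| <= M by apply: fM; rewrite l0 (le_trans lr).
have := ler_wpM2l (normr_ge0 (f r - f l)) h1; have := ler_wpM2r (normr_ge0 (g r - g l)) h2.
have := mulr_ge0 M0 (normr_ge0 (f r - f l)); have := mulr_ge0 K0 (normr_ge0 (g r - g l)).
lra.
Qed.

Lemma expRN_lip (a b : R) : 0 <= a -> 0 <= b -> `|expR (- a) - expR (- b)| <= `|a - b|.
Proof.
wlog ab : a b / a <= b => [H a0 b0|a0 b0].
  by have [/H|/ltW/H] := leP a b; [exact|rewrite distrC (distrC a); apply].
rewrite ger0_norm ?subr_ge0 ?ler_expR ?lerN2// distrC ger0_norm ?subr_ge0//.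
have -> : expR (- b) = expR (- a) * expR (- (b - a)) by rewrite -expRD; congr expR; ring.
have h1 : 1 + - (b - a) <= expR (- (b - a)) by exact: expR_ge1Dx.
have h2 : expR (- a) <= 1 by rewrite -expR0 ler_expR oppr_le0.
have h3 := expR_gt0 (- a).
have ba : 0 <= b - a by rewrite subr_ge0.
have := ler_wpM2l (ltW h3) h1; have := ler_wpM2r ba h2; lra.
Qed.

Lemma acfun_expN f (c : R) : 0 <= c -> (forall t, 0 <= f t) -> acfun f -> acfun (fun t => expR (- (c * f t))).
Proof.
move=> c0 f0 af; apply: (acfun_le1 c0 af) => l r _ _ _.
by rewrite (le_trans (expRN_lip _ _)) ?mulr_ge0// -mulrBr normrM ger0_norm.
Qed.

(** With a and b the two roots, (a - b)(a + b) is a sum of differences of squares, whose factors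
    [f r + f l] and [g r + g l] are at most a + b in absolute value. *)
Lemma acfun_sqrt (f g : R -> R) (d : R) : 0 <= d -> acfun f -> acfun g ->
  acfun (fun t => Num.sqrt (f t ^+ 2 + g t ^+ 2 + d)).
Proof.
move=> d0 af ag; apply: (acfun_le2 ler01 af ag) => l r _ _ _; rewrite mul1r.
set A := f r ^+ 2 + _ + _; set B := f l ^+ 2 + _ + _.
have fs (x y : R) : `|x| <= Num.sqrt (x ^+ 2 + y ^+ 2 + d) /\ `|y| <= Num.sqrt (x ^+ 2 + y ^+ 2 + d).
  by rewrite -!sqrtr_sqr; split; apply: ler_wsqrtr; have := sqr_ge0 x; have := sqr_ge0 y; lra.
have [fA gA] := fs (f r) (g r); have [fB gB] := fs (f l) (g l).
rewrite -/A -/B in fA gA fB gB *.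
have A0 : 0 <= A by rewrite !addr_ge0 ?sqr_ge0.
have B0 : 0 <= B by rewrite !addr_ge0 ?sqr_ge0.
have sA := sqr_sqrtr A0; have sB := sqr_sqrtr B0.
set a := Num.sqrt A in fA gA sA *; set b := Num.sqrt B in fB gB sB *.
have a0 : 0 <= a by exact: sqrtr_ge0.
have b0 : 0 <= b by exact: sqrtr_ge0.
have [ab0|ab0] := leP (a + b) 0.
  have -> : a - b = 0 by lra.
  by rewrite normr0 addr_ge0.
rewrite -(ler_pM2r ab0) -[X in `|_| * X]ger0_norm ?addr_ge0// -normrM.
have -> : (a - b) * (a + b) = (f r - f l) * (f r + f l) + (g r - g l) * (g r + g l).
  by rewrite -!subr_sqr sA sB /A /B; ring.
rewrite (le_trans (ler_normD _ _))// !normrM mulrDl.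
apply: lerD; apply: ler_wpM2l => //; rewrite (le_trans (ler_normD _ _))//; exact: lerD.
Qed.

Lemma abs_continuous_AC (f : R -> plane R) : abs_continuous 0 T f -> ac T (fun l r => enorm (f r - f l)).
Proof. by []. Qed.

Lemma acfun_fst (f : R -> plane R) : abs_continuous 0 T f -> acfun (fun t => (f t).1).
Proof.
move=> af; apply: (ac_le _ (abs_continuous_AC af)) => l r _ _ _.
exact: (norm1_le_enorm (f r - f l)).
Qed.

Lemma acfun_snd (f : R -> plane R) : abs_continuous 0 T f -> acfun (fun t => (f t).2).
Proof.
move=> af; apply: (ac_le _ (abs_continuous_AC af)) => l r _ _ _.
exact: (norm2_le_enorm (f r - f l)).
Qed.

End AbsolutelyContinuousFunctions.

Section Deriv.
Context {R : realType}.
Implicit Types (f g : R -> R) (t : R).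

Lemma drvD f g t a b : is_derive t 1 f a -> is_derive t 1 g b -> is_derive t 1 (fun s => f s + g s) (a + b).
Proof. by move=> df dg; exact: is_deriveD. Qed.

Lemma drvB f g t a b : is_derive t 1 f a -> is_derive t 1 g b -> is_derive t 1 (fun s => f s - g s) (a - b).
Proof. by move=> df dg; exact: is_deriveB. Qed.

Lemma drv_cst t (c : R) : is_derive t 1 (fun=> c) (0 : R).
Proof. exact: is_derive_cst. Qed.

Lemma drvM f g t a b : is_derive t 1 f a -> is_derive t 1 g b -> is_derive t 1 (fun s => f s * g s) (a * g t + f t * b).
Proof. by move=> df dg; apply: is_derive_eq; rewrite /GRing.scale/=; ring. Qed.

Lemma drvZ f t a (c : R) : is_derive t 1 f a -> is_derive t 1 (fun s => c * f s) (c * a).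
Proof. by move=> df; have := drvM (drv_cst t c) df; rewrite mul0r add0r. Qed.

Lemma drvX2 f t a : is_derive t 1 f a -> is_derive t 1 (fun s => f s ^+ 2) (2 * f t * a).
Proof. by move=> df; have := drvM df df; rewrite (_ : a * f t + f t * a = 2 * f t * a)//; ring. Qed.

Lemma drv_exp f t a : is_derive t 1 f a -> is_derive t 1 (fun s => expR (f s)) (a * expR (f t)).
Proof. by move=> df; have := is_derive1_comp (is_derive_expR (f t)) df; rewrite mulrC. Qed.

Lemma drv_expN f t a (c : R) : is_derive t 1 f a ->
  is_derive t 1 (fun s => expR (- (c * f s))) (- c * a * expR (- (c * f t))).
Proof.
move=> df; have E : (fun s => expR (- (c * f s))) = (fun s => expR (- c * f s)).
  by apply/funext => s; rewrite mulNr.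
by rewrite E -mulNr; exact: drv_exp (drvZ (- c) df).
Qed.

Lemma expR_cancel (a b x y : R) : a <= b -> 0 <= x -> expR (- a) * x <= y -> x <= expR b * y.
Proof.
move=> ab x0 xy; have y0 : 0 <= y by rewrite (le_trans _ xy)// mulr_ge0 ?expR_ge0.
rewrite (@le_trans _ _ (expR a * y))//; last by rewrite ler_wpM2r// ler_expR.
rewrite (@le_trans _ _ (expR a * (expR (- a) * x)))//; last by rewrite ler_wpM2l ?expR_ge0.
by rewrite mulrA -expRD subrr expR0 mul1r.
Qed.

Lemma drv_sqrt f t a : 0 < f t -> is_derive t 1 f a -> is_derive t 1 (fun s => Num.sqrt (f s)) (a / (2 * Num.sqrt (f t))).
Proof. by move=> f0 df; have := is_derive1_comp (is_derive1_sqrt f0) df; rewrite mulrC. Qed.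

Lemma drv_sum (I : finType) (f : I -> R -> R) (a : I -> R) t : (forall i, is_derive t 1 (f i) (a i)) ->
  is_derive t 1 (fun s => \sum_i f i s) (\sum_i a i).
Proof.
move=> df; rewrite -[index_enum I]/(index_enum _).
elim: (index_enum I) => [|i s IHs].
  by under eq_fun do rewrite big_nil; rewrite big_nil; exact: drv_cst.
by under eq_fun do rewrite big_cons; rewrite big_cons; exact: drvD.
Qed.

Lemma drv_fst (f : R -> plane R) t w : is_derive t 1 f w -> is_derive t 1 (fun s => (f s).1) w.1.
Proof.
move=> [df fw].
have H : (fun h : R => h^-1 *: (f (h *: 1 + t) - f t)) @ 0^' --> w by rewrite -fw.
have {}H : (fun h : R => h^-1 *: ((f (h *: 1 + t)).1 - (f t).1)) @ 0^' --> w.1.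
  exact: (cvg_comp _ _ H (@continuous_fst2 R w)).
by split; [apply/cvg_ex; exists w.1|apply/cvg_lim].
Qed.

Lemma drv_snd (f : R -> plane R) t w : is_derive t 1 f w -> is_derive t 1 (fun s => (f s).2) w.2.
Proof.
move=> [df fw].
have H : (fun h : R => h^-1 *: (f (h *: 1 + t) - f t)) @ 0^' --> w by rewrite -fw.
have {}H : (fun h : R => h^-1 *: ((f (h *: 1 + t)).2 - (f t).2)) @ 0^' --> w.2.
  exact: (cvg_comp _ _ H (@continuous_snd2 R w)).
by split; [apply/cvg_ex; exists w.2|apply/cvg_lim].
Qed.

End Deriv.

(** The closing arithmetic of [trajectory_bound], with its long expressions hidden behind variables;
    [a1] stands for the final energy term, which is dropped. *)
Lemma lyapunov_arith (R : realFieldType) (a1 a2 a3 a4 a5 a6 a7 a8 a9 a10 : R) : 0 <= a1 ->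
  a7 - a5 - a3 + a1 + a8 + (a5 + a3) <= a8 + a2 + (a9 + a10) + (a6 + a4) ->
  a7 <= a9 + a10 + a6 + a4 + a2.
Proof. by move=> *; lra. Qed.

Section Dynamics.
Context {R : realType}.
Variables (l1 l2 : plane R) (T IL IV : R) (v : R -> plane R -> plane R) (L Vm : R -> R).
Hypotheses (li : lin_indep l1 l2) (T0 : 0 < T).
Hypotheses (L0 : forall t, 0 < t < T -> 0 <= L t)
  (iL : (leb R).-integrable `]0, T[ (EFin \o L))
  (LIL : (\int[leb R]_(t in `]0%R, T[) (L t)%:E = IL%:E)%E).
Hypotheses (Vm0 : forall t, 0 <= Vm t)
  (iVm : (leb R).-integrable `]0, T[ (EFin \o Vm))
  (VmIV : (\int[leb R]_(t in `]0%R, T[) (Vm t)%:E = IV%:E)%E).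
Hypothesis good : {ae leb R, forall t, 0 < t < T ->
  exists u, osl_field l1 l2 (v t) u (L t) (Vm t)}.

Notation Lam := (primitive T L).
Notation W := (primitive T Vm).

Let Lam_ge0 t : 0 <= Lam t.
Proof. exact: primitive_ge0 L0 t. Qed.

Let Lam_le t : Lam t <= IL.
Proof. exact: primitive_le iL L0 LIL t. Qed.

Let W_le t : W t <= IV.
Proof. by apply: primitive_le => // s _; exact: Vm0. Qed.

Let acfun_Lam : acfun T Lam.
Proof. exact: (primitive_ac iL L0). Qed.

Let acfun_W : acfun T W.
Proof. by apply: primitive_ac => // s _; exact: Vm0. Qed.

Let dLam : {ae leb R, forall t, 0 < t < T -> is_derive t 1 Lam (L t)}.
Proof. exact: (primitive_derive iL). Qed.

Let dW : {ae leb R, forall t, 0 < t < T -> is_derive t 1 W (Vm t)}.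
Proof. exact: (primitive_derive iVm). Qed.

(** Two Filippov velocities satisfy the one-sided condition, so the squared distance weighted by
    exp(- 2 Lam) is nonincreasing. Later this also makes [Phi t] Borel, hence the image of the
    density a measure on the torus. *)
Lemma flow_lipschitz Phi x y t : filippov_flow T v Phi -> 0 <= t <= T ->
  enorm (Phi t x - Phi t y) <= expR IL * enorm (x - y).
Proof.
move=> fl tT; have [x0 [ax dx]] := fl x; have [y0 [ay dy]] := fl y.
pose p1 s := (Phi s x).1 - (Phi s y).1; pose p2 s := (Phi s x).2 - (Phi s y).2.
pose f s := expR (- (2 * Lam s)) * (p1 s ^+ 2 + p2 s ^+ 2).
have pE s : p1 s ^+ 2 + p2 s ^+ 2 = enorm (Phi s x - Phi s y) ^+ 2.
  by rewrite enorm_sqr /dotp /p1 /p2 /= !expr2.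
have Ap1 : acfun T p1 by apply: acfun_B; exact: acfun_fst.
have Ap2 : acfun T p2 by apply: acfun_B; exact: acfun_snd.
have Af : acfun T f.
  apply: acfun_M => //; first exact: acfun_expN.
  by apply: acfun_D; under eq_fun do rewrite expr2; exact: acfun_M.
have ft : f t <= f 0.
  apply: (ac_nonincreasing T0 Af) tT.
  apply: aeS (aeI good (aeI dLam (aeI dx dy))) => s [gs [ds [dxs dys]]] sT.
  have [u us] := gs sT; have [w1 dw1 fw1] := dxs sT; have [w2 dw2 fw2] := dys sT.
  have d1 : is_derive s 1 p1 (w1.1 - w2.1) by apply: drvB; exact: drv_fst.
  have d2 : is_derive s 1 p2 (w1.2 - w2.2) by apply: drvB; exact: drv_snd.
  have df := drvM (drv_expN 2 (ds sT)) (drvD (drvX2 d1) (drvX2 d2)).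
  exists f; eexists; split; [by []|by []|exact: df|].
  have := filippov_monotone us erefl fw1 fw2.
  rewrite -pE /dotp /= -/(p1 s) -/(p2 s) => H.
  have e0 := expR_gt0 (- (2 * Lam s)).
  have := ler_wpM2l (ltW e0) H; lra.
move: ft; rewrite /f primitive0 mulr0 oppr0 expR0 mul1r !pE x0 y0 => ft.
rewrite -(@ler_pXn2r _ 2)// ?nnegrE ?mulr_ge0 ?enorm_ge0 ?expR_ge0//.
rewrite exprMn -expRM_natl -[2%:R]/(2 : R).
by apply: expR_cancel ft; rewrite ?sqr_ge0// ler_wpM2l.
Qed.

Section Generators.
Variables (N : nat) (X0 : 'I_N -> plane R) (eps : R) (eta : plane R -> R) (X : R -> 'I_N -> plane R).
Hypotheses (N0 : (0 < N)%N) (eps01 : 0 < eps <= 1) (meta : mollifier eps eta)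
  (sol : generator_solution l1 l2 T (mollify eta v) X0 X).
Notation H := (mesh_size l1 l2 N `^ (5 / 2)).
Hypothesis H0 : 0 < H.
Notation E t := (energy l1 l2 (X t)).
Notation G t := (centroid_defect l1 l2 (X t)).
Notation d t i := (centroid_disp l1 l2 (X t) i).

Let dX t : 0 <= t <= T -> distinct l1 l2 (X t).
Proof. by case: sol => _ + _ _; apply. Qed.

Let aX i : abs_continuous 0 T (fun t => X t i).
Proof. by case: sol. Qed.

Let derX : {ae leb R, forall t : R, 0 < t < T -> forall i,
  is_derive t 1 (fun s => X s i) (mollify eta v t (X t i) + (G t / H) *: d t i)}.
Proof. by case: sol. Qed.

Lemma centroid_defect_ge0 t : 0 <= t <= T -> 0 <= G t.
Proof.
move=> tT; apply: sumr_ge0 => i _; rewrite mulr_ge0 ?sqr_ge0// ltW//.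
by apply: cell_vol_gt0 => //; exact: dX.
Qed.

Let acfun_E : acfun T (fun t => E t).
Proof.
apply: (@ac_le _ _ _ (fun l r => 2 * cover_radius l1 l2 * fine (@leb2 R (fundamental_domain l1 l2)) *
  \sum_i enorm (X r i - X l i))).
  by move=> l r _ _ _; exact: energy_lipschitz.
apply: acZ; last by apply: ac_sum => i; exact: aX.
by rewrite mulr_ge0 ?fine_ge0// mulr_ge0 ?cover_radius_ge0.
Qed.

(* The energy need not be differentiable: [Q] is the energy of frozen cells. *)
Let energy_upper : {ae leb R, forall t, 0 < t < T -> exists Q c,
  [/\ forall s, E s <= Q s, Q t = E t, is_derive t 1 Q c & c <= 4 * L t * E t - 2 * G t ^+ 2 / H]}.
Proof.
apply: aeS (aeI good derX) => t [gt dt] tT; have [u ut] := gt tT.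
have tT' : 0 <= t <= T by case/andP: tT => ? ?; rewrite !ltW.
have dxt := dX tT'.
pose V i := cell_vol l1 l2 (X t) i.
pose q1 i s := (X s i).1 - (X t i).1; pose q2 i s := (X s i).2 - (X t i).2.
pose Q s := E t - 2 * (\sum_i V i * ((d t i).1 * q1 i s + (d t i).2 * q2 i s)) +
   \sum_i V i * (q1 i s ^+ 2 + q2 i s ^+ 2).
pose xd i := mollify eta v t (X t i) + (G t / H) *: d t i.
have dq1 i : is_derive t 1 (q1 i) (xd i).1.
  by have := drvB (drv_fst (dt tT i)) (drv_cst t (X t i).1); rewrite subr0.
have dq2 i : is_derive t 1 (q2 i) (xd i).2.
  by have := drvB (drv_snd (dt tT i)) (drv_cst t (X t i).2); rewrite subr0.
have q10 i : q1 i t = 0 by rewrite /q1 subrr.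
have q20 i : q2 i t = 0 by rewrite /q2 subrr.
have dQ := drvD (drvB (drv_cst t (E t)) (drvZ 2 (drv_sum (fun i => drvZ (V i) (drvD (drvZ (d t i).1 (dq1 i)) (drvZ (d t i).2 (dq2 i)))))))
  (drv_sum (fun i => drvZ (V i) (drvD (drvX2 (dq1 i)) (drvX2 (dq2 i))))).
exists Q; eexists; split; [| |exact: dQ|].
- move=> s; rewrite (le_trans (energy_envelope li N0 (X s) dxt))// /Q le_eqVlt; apply/orP; left; apply/eqP.
  congr (_ - _ * _ + _); apply: eq_bigr => i _.
  by rewrite enorm_sqr /dotp /q1 /q2 /= !expr2.
- rewrite /Q !big1 ?mulr0 ?subr0 ?addr0// => i _; rewrite q10 q20; first by rewrite expr0n/= addr0 mulr0.
  by rewrite !mulr0 addr0 mulr0.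
(* The quadratic part of [Q] has derivative 0 at [t], where [q1] and [q2] vanish. In the linear part
   the field costs 4 L E by [mollify_energy], and the centroid velocity pairs with itself to give
   exactly G. *)
- rewrite sub0r [X in _ + X]big1 ?addr0; last first.
    by move=> i _; rewrite q10 q20 !mulr0 !mul0r addr0 mulr0.
  have key i : V i * ((d t i).1 * (xd i).1 + (d t i).2 * (xd i).2) =
      V i * dotp (d t i) (mollify eta v t (X t i)) + G t / H * (V i * enorm (d t i) ^+ 2).
    rewrite enorm_sqr /xd; move: (G t / H) (d t i) (mollify _ _ _ _) => g dd m.
    by rewrite /dotp /= /GRing.scale/=; ring.
  rewrite (eq_bigr _ (fun i _ => key i)).
  have -> : \sum_i (V i * dotp (d t i) (mollify eta v t (X t i)) + G t / H * (V i * enorm (d t i) ^+ 2)) =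
    \sum_i V i * dotp (d t i) (mollify eta v t (X t i)) + G t / H * G t.
    by rewrite big_split -mulr_sumr.
  have := mollify_energy li meta N0 dxt ut; rewrite -/(mollify eta v t _) => me.
  have {}me : - (2 * L t * E t) <= \sum_i V i * dotp (d t i) (mollify eta v t (X t i)) by exact: me.
  by rewrite expr2; lra.
Qed.

Lemma energy_bound t : 0 <= t <= T -> E t <= expR (4 * IL) * E 0.
Proof.
move=> tT; pose f s := expR (- (4 * Lam s)) * E s.
have Af : acfun T f by apply: acfun_M => //; exact: acfun_expN.
have ft : f t <= f 0.
  apply: (ac_nonincreasing T0 Af) tT.
  apply: aeS (aeI dLam energy_upper) => s [ds es] sT.
  have [Q [c [EQ QE dQ cle]]] := es sT.
  exists (fun s' => expR (- (4 * Lam s')) * Q s'); eexists; split.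
  - by move=> s' _; rewrite /f ler_wpM2l ?expR_ge0.
  - by rewrite /f QE.
  - exact: (drvM (drv_expN 4 (ds sT)) dQ).
  - rewrite QE; have e0 := expR_gt0 (- (4 * Lam s)).
    have := ler_wpM2l (ltW e0) cle.
    have : 0 <= expR (- (4 * Lam s)) * (2 * G s ^+ 2 / H).
      by apply: mulr_ge0; [exact: ltW|apply: divr_ge0; [rewrite mulr_ge0 ?sqr_ge0|exact: ltW]].
    lra.
move: ft; rewrite /f primitive0 mulr0 oppr0 expR0 mul1r => ft.
by apply: expR_cancel ft; rewrite ?energy_ge0// ler_wpM2l.
Qed.

(* The forcing by the centroids is absorbed, through Young's inequality, in the dissipation
   [2 G ^ 2 / H] of the quantization energy. *)
Lemma trajectory_bound Phi x i k (rho lambda : R) : filippov_flow T v Phi -> lattice l1 l2 k ->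
  0 < lambda -> 0 <= rho -> (forall t, 0 <= t <= T -> enorm (d t i) <= rho) ->
  forall t, 0 <= t <= T ->
  expR (- (2 * IL)) * enorm (Phi t x - X t i - k) <= enorm (x - X0 i - k) + Num.sqrt eps + 2 * Num.sqrt eps * IV +
    rho * lambda / (2 * H) * T + rho * expR (4 * IL) / (4 * lambda) * E 0.
Proof.
move=> fl kl la0 rho0 drho t tT.
have [x0 [ax dx]] := fl x.
pose p s := Phi s x - X s i - k.
pose p1 s := (Phi s x).1 - (X s i).1 - k.1; pose p2 s := (Phi s x).2 - (X s i).2 - k.2.
pose sg s := Num.sqrt (p1 s ^+ 2 + p2 s ^+ 2 + eps).
have /andP[eps0 eps1] := eps01.
have pE s : p1 s ^+ 2 + p2 s ^+ 2 = enorm (p s) ^+ 2.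
  by rewrite enorm_sqr /dotp /p1 /p2 /p /= !expr2.
have ppos s : 0 < p1 s ^+ 2 + p2 s ^+ 2 + eps by rewrite ltr_wpDl// addr_ge0 ?sqr_ge0.
have sg2 s : sg s ^+ 2 = enorm (p s) ^+ 2 + eps by rewrite sqr_sqrtr ?pE// -pE ltW.
have sgp s : 0 < sg s by rewrite sqrtr_gt0.
have sgeps s : Num.sqrt eps <= sg s by apply: ler_wsqrtr; rewrite lerDr addr_ge0 ?sqr_ge0.
have sgn s : enorm (p s) <= sg s.
  by rewrite -(@ler_pXn2r _ 2)// ?nnegrE ?enorm_ge0 ?(ltW (sgp s))// sg2 lerDl ltW.
set se := Num.sqrt eps.
have se0 : 0 < se by rewrite sqrtr_gt0.
have se2 : se ^+ 2 = eps by rewrite sqr_sqrtr ?ltW.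
(* Young's inequality reads rho G / H <= b + rho G^2 / (2 lambda H). The factor [kap] is chosen so
   that the dissipation of [kap] times the energy, even with the least weight exp(- 4 IL), pays for
   the last term. *)
pose b := rho * lambda / (2 * H); pose kap := rho * expR (4 * IL) / (4 * lambda).
have kap0 : 0 <= kap by rewrite divr_ge0 ?mulr_ge0 ?expR_ge0// ltW.
(* [sg] regularizes the distance at scale [se], which absorbs the mollification error. *)
pose J s := expR (- (2 * Lam s)) * sg s - 2 * se * W s - b * s + kap * (expR (- (4 * Lam s)) * E s).
have Ap1 : acfun T p1 by apply: acfun_B; [apply: acfun_B; [exact: acfun_fst|exact: (acfun_fst (aX i))]|exact: acfun_cst].
have Ap2 : acfun T p2 by apply: acfun_B; [apply: acfun_B; [exact: acfun_snd|exact: (acfun_snd (aX i))]|exact: acfun_cst].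
have AJ : acfun T J.
  apply: acfun_D; last by apply: acfun_Z; apply: acfun_M => //; exact: acfun_expN.
  apply: acfun_B; last by apply: acfun_Z; exact: acfun_id.
  apply: acfun_B; last by apply: acfun_Z.
  by apply: acfun_M => //; [exact: acfun_expN|apply: acfun_sqrt => //; exact: ltW].
have Jt : J t <= J 0.
  apply: (ac_nonincreasing T0 AJ) tT.
  apply: aeS (aeI good (aeI (aeI dLam dW) (aeI (aeI dx derX) energy_upper))) => s [gs [[dLs dWs] [[dxs dXs] es]]] sT.
  have sT' : 0 <= s <= T by case/andP: sT => ? ?; rewrite !ltW.
  have [u us] := gs sT; have [w dw fw] := dxs sT; have [Q [c [EQ QE dQ cle]]] := es sT.
  pose xd := mollify eta v s (X s i) + (G s / H) *: d s i.
  have d1 : is_derive s 1 p1 (w.1 - xd.1).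
    by have := drvB (drvB (drv_fst dw) (drv_fst (dXs sT i))) (drv_cst s k.1); rewrite subr0.
  have d2 : is_derive s 1 p2 (w.2 - xd.2).
    by have := drvB (drvB (drv_snd dw) (drv_snd (dXs sT i))) (drv_cst s k.2); rewrite subr0.
  have dsg := @drv_sqrt _ (fun s => p1 s ^+ 2 + p2 s ^+ 2 + eps) _ _ (ppos s) (drvD (drvD (drvX2 d1) (drvX2 d2)) (drv_cst s eps)).
  have did : is_derive s 1 (fun s : R => s) (1 : R) by exact: is_derive_id.
  have dR := drvD (drvB (drvB (drvM (drv_expN 2 (dLs sT)) dsg) (drvZ (2 * se) (dWs sT))) (drvZ b did))
     (drvZ kap (drvM (drv_expN 4 (dLs sT)) dQ)).
  eexists; eexists; split; [| |exact: dR|].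
  - by move=> s' _; rewrite /J lerD2l ler_wpM2l// ler_wpM2l ?expR_ge0.
  - by rewrite /J QE.
  rewrite -/(sg s) QE; set e2 := expR (- (2 * Lam s)); set e4 := expR (- (4 * Lam s)).
  have e20 : 0 < e2 by exact: expR_gt0.
  have e21 : e2 <= 1 by rewrite /e2 -expR0 ler_expR oppr_le0 mulr_ge0.
  have e4IL : expR (- (4 * IL)) <= e4 by rewrite ler_expR lerN2 ler_wpM2l.
  have [_ _ _ _ [_ [Ls0 Vs0]]] := us.
  have G0 := centroid_defect_ge0 sT'.
  set dsv := (_ / (2 * sg s)).
  pose a := G s / H * enorm (d s i).
  have a0 : 0 <= a by rewrite mulr_ge0 ?enorm_ge0// divr_ge0// ltW.
  have dsvle : dsv <= 2 * L s * sg s + 2 * Vm s * se + a.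
    have := mollify_filippov meta (X s i) us erefl kl (ltW eps0) fw.
    rewrite -/(p s) -/(mollify eta v s (X s i)) => mf.
    have mf' : dotp (w - mollify eta v s (X s i)) (p s) <= 2 * L s * (enorm (p s) ^+ 2 + eps ^+ 2) + 2 * Vm s * eps by exact: mf.
    have dE : dsv = dotp (w - xd) (p s) / sg s.
      rewrite /dsv /dotp /p /= -/(p1 s) -/(p2 s); field; exact: lt0r_neq0.
    rewrite dE ler_pdivrMr//.
    have -> : dotp (w - xd) (p s) = dotp (w - mollify eta v s (X s i)) (p s) + G s / H * dotp (- d s i) (p s).
      by rewrite /xd /dotp /= /GRing.scale/=; ring.
    have h1 : G s / H * dotp (- d s i) (p s) <= a * sg s.
      rewrite /a -[leRHS]mulrA; apply: ler_wpM2l; first by rewrite divr_ge0 ?(ltW H0).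
      by rewrite (le_trans (dotp_le _ _))// enormN ler_wpM2l ?enorm_ge0.
    (* Here the scale [se] is decisive: eps^2 <= eps completes |p|^2 to at most sg^2, and eps = se^2
       <= se sg leaves, after division by [sg], an error of order [se] times the speed. *)
    have ee : eps ^+ 2 <= eps by rewrite expr2 ler_piMl// ltW.
    have h2 : 2 * L s * (enorm (p s) ^+ 2 + eps ^+ 2) <= 2 * L s * (sg s * sg s).
      by rewrite ler_wpM2l ?mulr_ge0// -expr2 sg2 lerD2l.
    have h3 : 2 * Vm s * eps <= 2 * Vm s * se * sg s.
      rewrite -[leRHS]mulrA; apply: ler_wpM2l; first exact: mulr_ge0.
      by rewrite -se2 expr2; apply: ler_wpM2l => //; exact: ltW.
    lra.
  have aG : a <= rho / H * G s.
    rewrite /a mulrAC (mulrAC rho) ler_wpM2r ?invr_ge0 ?(ltW H0)// mulrC ler_wpM2r//.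
    exact: drho.
  have young : rho / H * G s - b - rho / (2 * lambda * H) * G s ^+ 2 <= 0.
    have -> : rho / H * G s - b - rho / (2 * lambda * H) * G s ^+ 2 = - (rho / (2 * lambda * H) * (G s - lambda) ^+ 2).
      by rewrite /b; field; rewrite !lt0r_neq0.
    by rewrite oppr_le0 mulr_ge0 ?sqr_ge0// divr_ge0// !mulr_ge0// ltW.
  have kG : kap * (expR (- (4 * IL)) * (2 * G s ^+ 2 / H)) = rho / (2 * lambda * H) * G s ^+ 2.
    have ee : expR (4 * IL) * expR (- (4 * IL)) = 1 by rewrite -expRD subrr expR0.
    have -> : kap * (expR (- (4 * IL)) * (2 * G s ^+ 2 / H)) = (expR (4 * IL) * expR (- (4 * IL))) * (rho / (4 * lambda) * (2 * G s ^+ 2 / H)).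
      by rewrite /kap; ring.
    by rewrite ee mul1r; field; rewrite !lt0r_neq0.
  have k1 : kap * (e4 * c - 4 * L s * e4 * E s) <= - (rho / (2 * lambda * H) * G s ^+ 2).
    rewrite -kG -(mulrN kap); apply: ler_wpM2l => //.
    have g0 : 0 <= 2 * G s ^+ 2 / H by rewrite divr_ge0 ?mulr_ge0 ?sqr_ge0// ltW.
    have := ler_wpM2l (ltW (expR_gt0 (- (4 * Lam s)))) cle; rewrite -/e4.
    have := ler_wpM2r g0 e4IL; lra.
  have k2 : e2 * dsv - 2 * L s * e2 * sg s <= 2 * Vm s * se + a.
    have z0 : 0 <= 2 * Vm s * se + a by rewrite addr_ge0// !mulr_ge0// ltW.
    have := ler_wpM2l (ltW e20) dsvle; have := ler_wpM2r z0 e21; lra.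
  rewrite mulr1; lra.
have J0 : J 0 = sg 0 + kap * E 0.
  by rewrite /J !primitive0 !mulr0 !oppr0 !expR0 !mul1r; ring.
have sg0 : sg 0 <= enorm (x - X0 i - k) + se.
  have p0 : p 0 = x - X0 i - k by rewrite /p x0; case: sol => ->.
  rewrite -(@ler_pXn2r _ 2)// ?nnegrE ?addr_ge0 ?enorm_ge0 ?(ltW se0) ?(ltW (sgp 0))//.
  rewrite sg2 p0 sqrrD se2 lerD2r lerDl mulrn_wge0// mulr_ge0 ?enorm_ge0 ?(ltW se0)//.
have Wt : 2 * se * W t <= 2 * se * IV by rewrite ler_wpM2l ?mulr_ge0// ltW.
have bt : b * t <= b * T.
  by case/andP: tT => _ tT; rewrite ler_wpM2l// divr_ge0 ?mulr_ge0// ltW.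
have kE : 0 <= kap * (expR (- (4 * Lam t)) * E t).
  by rewrite mulr_ge0// mulr_ge0 ?expR_ge0 ?energy_ge0.
have eL : expR (- (2 * IL)) * enorm (p t) <= expR (- (2 * Lam t)) * sg t.
  by apply: ler_pM; rewrite ?expR_ge0 ?enorm_ge0// ler_expR lerN2 ler_wpM2l.
move: Jt; rewrite J0 {1}/J -/b -/kap -/(p t).
move=> Jt'; apply: le_trans eL _.
exact: lyapunov_arith kE (lerD (lerD Jt' sg0) (lerD Wt bt)).
Qed.

End Generators.
End Dynamics.

(** * The coupling *)

Section WeightedImage.
Context d1 d2 (T1 : measurableType d1) (T2 : measurableType d2) (R : realType).
Variables (m : {measure set T1 -> \bar R}) (w : T1 -> R) (h : T1 -> T2).
Hypotheses (w0 : forall x, 0 <= w x) (mw : measurable_fun setT w) (mh : measurable_fun setT h).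

(** As an existence statement, it lets the coupling be used through its integral formula alone. *)
Lemma weighted_image : exists pi : {measure set T2 -> \bar R},
  forall A, pi A = (\int[m]_(x in h @^-1` A) (w x)%:E)%E.
Proof.
pose p (A : set T2) := (\int[m]_(x in h @^-1` A) (w x)%:E)%E.
have p0 : p set0 = 0%E by rewrite /p preimage_set0 integral_set0.
have pge0 A : (0 <= p A)%E by apply: integral_ge0 => x _; rewrite lee_fin.
have psa : semi_sigma_additive p.
  move=> F mF tF mUF; rewrite /p preimage_bigcup ge0_integral_bigcup//=.
  - by apply: is_cvg_ereal_nneg_natsum_cond => // n _ _; exact: pge0.
  - by move=> k; rewrite -[X in measurable X]setTI; exact: mh.
  - by apply/measurable_EFinP; exact: measurable_funTS.
  - by move=> x _; rewrite lee_fin.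
  - apply/trivIsetP => /= i j _ _ ij; rewrite -preimage_setI.
    by move/trivIsetP : tF => /(_ _ _ _ _ ij) ->//; rewrite preimage_set0.
by exists (HB.pack_for {measure set T2 -> \bar R} p (isMeasure.Build _ _ _ p p0 pge0 psa)).
Qed.

End WeightedImage.

Lemma measurable_tensor d1 d2 (T1 : measurableType d1) (T2 : measurableType d2) (R : realType)
    (f : T1 -> R) (g : T2 -> R) : measurable_fun setT f -> measurable_fun setT g ->
  measurable_fun setT (fun p : T1 * T2 => f p.1 * g p.2).
Proof.
move=> mf mg; apply: measurable_funM.
  exact: (measurableT_comp mf measurable_fst).
exact: (measurableT_comp mg measurable_snd).
Qed.

Lemma integral_tensor d1 d2 (T1 : measurableType d1) (T2 : measurableType d2) (R : realType)
    (m1 : {sigma_finite_measure set T1 -> \bar R}) (m2 : {sigma_finite_measure set T2 -> \bar R})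
    (f : T1 -> R) (g : T2 -> R) : (forall x, 0 <= f x) -> (forall y, 0 <= g y) ->
  measurable_fun setT f -> measurable_fun setT g ->
  (\int[m1 \x m2]_p (f p.1 * g p.2)%:E = (\int[m1]_x (f x)%:E) * \int[m2]_y (g y)%:E)%E.
Proof.
move=> f0 g0 mf mg; rewrite fubini_tonelli1/=; last 2 first.
- by apply/measurable_EFinP; exact: measurable_tensor.
- by move=> p; rewrite lee_fin mulr_ge0.
rewrite -ge0_integralZr//; last 3 first.
- exact/measurable_EFinP.
- by move=> x _; rewrite lee_fin.
- by apply: integral_ge0 => y _; rewrite lee_fin.
apply: eq_integral => x _; rewrite /fubini_F -ge0_integralZl//.
- exact/measurable_EFinP.
- by move=> y _; rewrite lee_fin.
- by rewrite lee_fin.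
Qed.

Section Coupling.
Context {R : realType}.
Notation mP := (measurableTypeR R * measurableTypeR R)%type.
Variables l1 l2 : plane R.
Hypothesis li : lin_indep l1 l2.
Notation lat := (lattice l1 l2).
Notation FD := (fundamental_domain l1 l2).
Notation td := (tdist l1 l2).
Notation torus := (torus l1 l2).

(** The sigma-algebra of [torus] is generated by Borel sets of the plane, so Borel maps stay
    measurable. *)
Lemma measurable_to_torus d (T : measurableType d) (F : T -> mP) : measurable_fun setT F ->
  measurable_fun setT (F : T -> torus).
Proof.
move=> mF; apply: (@measurability _ _ _ torus setT F (periodic_borel l1 l2)) => // _ [B [mB _] <-].
exact: mF.
Qed.

Lemma torus_measurable (A : set torus) : measurable A -> @measurable _ mP A.
Proof.
move=> mA; rewrite -[X in measurable X]setTI.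
exact: (measurable_to_torus (@measurable_id _ mP setT) measurableT mA).
Qed.

Lemma lipschitz_measurable2 (K : R) (F : mP -> mP) :
  (forall x y, enorm (F x - F y) <= K * enorm ((x : plane R) - y)) -> measurable_fun setT F.
Proof.
move=> FK; apply/measurable_fun_pairP; split.
  apply: continuous_measurable2; apply: (@lipschitz_continuous2 _ K) => x y.
  by rewrite (le_trans _ (FK x y))// (norm1_le_enorm (F x - F y)).
apply: continuous_measurable2; apply: (@lipschitz_continuous2 _ K) => x y.
by rewrite (le_trans _ (FK x y))// (norm2_le_enorm (F x - F y)).
Qed.

(** The coupling will be concentrated on a finite union of products of such balls; their
    measurability is all that the cost estimate requires. *)
Lemma measurable_tball (a : plane R) (r : R) : @measurable _ torus [set x : plane R | td x a <= r].
Proof.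
apply: sub_sigma_algebra; split; last by move=> x k kl; rewrite /= tdistDl.
rewrite (_ : mkset _ = (fun x : plane R => td x a) @^-1` `]-oo, r]).
  by apply: measurable_preimage2 => //; exact: continuous_tdist.
by apply/seteqP; split => x; rewrite /= in_itv.
Qed.

Variables (N : nat) (X0 Y : 'I_N -> plane R) (F : plane R -> plane R) (rho0 : plane R -> R) (K r B : R).
Hypotheses (N0 : (0 < N)%N) (dX0 : distinct l1 l2 X0) (dY : distinct l1 l2 Y)
  (rho00 : forall x, 0 <= rho0 x)
  (irho : (@leb2 R).-integrable FD (EFin \o rho0))
  (FK : forall x y, enorm (F x - F y) <= K * enorm (x - y))
  (Yr : forall x i, cell l1 l2 Y i x -> td x (Y i) <= r)
  (FB : forall x i, cell l1 l2 X0 i x -> td (F x) (Y i) <= B).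

Notation hist := (histogram l1 l2 rho0 X0 Y).
Notation C i := (cell l1 l2 Y i `&` FD).
Notation D i := (cell l1 l2 X0 i).
Let g : mP -> R := rho0 \_ FD.
Let vol i := cell_vol l1 l2 Y i.
Let a i (x : mP) : R := \1_(C i) x / vol i.
Let b i (y : mP) : R := \1_(D i) y * g y.
(* The [rho0]-mass of the initial cell [i] is spread uniformly over the final cell [i] and
   coupled with its image under [F]. *)
Let w (p : mP * mP) : R := \sum_i a i p.1 * b i p.2.
Let h (p : mP * mP) : torus * torus := (p.1, F p.2).

Let g0 y : 0 <= g y.
Proof. by rewrite /g patchE; case: ifP. Qed.

Let mg : measurable_fun setT g.
Proof.
apply/measurable_EFinP; rewrite (_ : EFin \o g = (EFin \o rho0) \_ FD); last first.
  by rewrite /g restrict_EFin.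
apply/(measurable_restrictT _ (measurable_FD li)); exact: measurable_int irho.
Qed.

Let vol0 i : 0 < vol i.
Proof. exact: cell_vol_gt0. Qed.

Let mC i : @measurable _ mP (C i).
Proof. by apply: measurableI; [exact: measurable_cell|exact: measurable_FD]. Qed.

Let a0 i x : 0 <= a i x.
Proof. by rewrite divr_ge0// ltW. Qed.

Let b0 i x : 0 <= b i x.
Proof. by rewrite mulr_ge0. Qed.

Let ma i : measurable_fun setT (a i).
Proof. by apply: measurable_funM => //; exact: measurable_indic. Qed.

Let mb i : measurable_fun setT (b i).
Proof. by apply: measurable_funM => //; apply: measurable_indic; exact: measurable_cell. Qed.

Let w0 p : 0 <= w p.
Proof. by apply: sumr_ge0 => i _; rewrite mulr_ge0. Qed.

Let mab i : measurable_fun setT (fun p : mP * mP => a i p.1 * b i p.2).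
Proof. exact: measurable_tensor. Qed.

Let mw : measurable_fun setT w.
Proof. by apply: measurable_sum => i; exact: mab. Qed.

Let mF : measurable_fun setT (F : mP -> torus).
Proof. by apply: measurable_to_torus; exact: (lipschitz_measurable2 FK). Qed.

Let mh : measurable_fun setT h.
Proof.
apply/measurable_fun_pairP; split; first exact: (measurable_to_torus measurable_fst).
by apply: (measurableT_comp mF); exact: measurable_snd.
Qed.

Let pi := sval (cid (weighted_image (@leb2 R \x @leb2 R)%E w0 mw mh)).

Let piE A : pi A = (\int[(@leb2 R \x @leb2 R)%E]_(x in h @^-1` A) (w x)%:E)%E.
Proof. exact: (svalP (cid (weighted_image (@leb2 R \x @leb2 R)%E w0 mw mh))). Qed.

Let Ia i (A : set mP) : measurable A ->
  (\int[@leb2 R]_x (\1_A x * a i x)%:E = ((vol i)^-1)%:E * @leb2 R (A `&` C i))%E.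
Proof.
move=> mA; have -> : @leb2 R (A `&` C i) = (\int[@leb2 R]_x (\1_(A `&` C i) x)%:E)%E.
  by rewrite integral_indic// ?setIT//; exact: measurableI mA (mC i).
rewrite -ge0_integralZl//; first last.
- by rewrite lee_fin invr_ge0 ltW.
- by apply/measurable_EFinP; apply: measurable_indic; exact: measurableI.
apply: eq_integral => x _; rewrite -EFinM /a.
have -> : \1_(A `&` C i) x = \1_A x * \1_(C i) x :> R by rewrite indicI.
by rewrite mulrA [in RHS]mulrC.
Qed.

Let Ib i (A : set mP) : measurable A ->
  (\int[@leb2 R]_x (\1_A x * b i x)%:E = \int[@leb2 R]_(x in D i `&` FD) (\1_A x * rho0 x)%:E)%E.
Proof.
move=> mA; rewrite [RHS]integral_mkcond; apply: eq_integral => x _.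
rewrite /b /g !patchE in_setI !indicE; case: (x \in D i); case: (x \in FD) => //=; rewrite ?mul1r ?mul0r ?mulr0//.
Qed.

Let piX (A B' : set mP) : measurable A -> measurable B' ->
  (\int[(@leb2 R \x @leb2 R)%E]_(x in A `*` B') (w x)%:E =
   \sum_i (((vol i)^-1)%:E * @leb2 R (A `&` C i)) * \int[@leb2 R]_(x in D i `&` FD) (\1_B' x * rho0 x)%:E)%E.
Proof.
move=> mA mB.
transitivity (\int[(@leb2 R \x @leb2 R)%E]_p (\sum_i ((\1_A p.1 * a i p.1) * (\1_B' p.2 * b i p.2))%:E))%E.
  rewrite integral_mkcond; apply: eq_integral => p _.
  rewrite patchE in_setX sumEFin !indicE /w; case: (p.1 \in A); case: (p.2 \in B') => /=; congr EFin.
  - by apply: eq_bigr => i _; rewrite !mul1r.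
  - by rewrite big1// => i _; rewrite !mul0r mulr0.
  - by rewrite big1// => i _; rewrite !mul0r.
  - by rewrite big1// => i _; rewrite !mul0r.
have mAa i : measurable_fun setT (fun x : mP => \1_A x * a i x).
  by apply: measurable_funM => //; exact: measurable_indic.
have mBb i : measurable_fun setT (fun x : mP => \1_B' x * b i x).
  by apply: measurable_funM => //; exact: measurable_indic.
rewrite ge0_integral_sum//.
- apply: eq_bigr => i _; rewrite (integral_tensor _ _ _ _ (mAa i) (mBb i)) ?Ia ?Ib// => x; exact: mulr_ge0.
- by move=> i; apply/measurable_EFinP; exact: (measurable_tensor (mAa i) (mBb i)).
- by move=> i p _; rewrite lee_fin; apply: mulr_ge0; apply: mulr_ge0.
Qed.

Let irhoD i : (\int[@leb2 R]_(x in D i `&` FD) (rho0 x)%:E = (tintegral l1 l2 (D i) rho0)%:E)%E.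
Proof.
rewrite /tintegral fineK//; apply: integrable_fin_num.
  by apply: measurableI; [exact: measurable_cell|exact: measurable_FD].
apply: integrableS irho; [exact: measurable_FD| |by move=> x []].
by apply: measurableI; [exact: measurable_cell|exact: measurable_FD].
Qed.

Let volE i : (@leb2 R (C i) = (vol i)%:E)%E.
Proof.
rewrite /vol /cell_vol /tvol fineK// ge0_fin_numE//.
apply: le_lt_trans (FD_lty li); apply: le_mu; [exact: mC|exact: measurable_FD|by move=> x []].
Qed.

(** In the first marginal, the mass of each initial cell is weighted by the fraction of the final
    cell lying in [A]. In the second, this fraction is 1 and the initial cells cover the torus up to
    a null set. *)
Let coupling_pi : coupling (density_measure l1 l2 hist)
  (pushforward (density_measure l1 l2 rho0) (F : torus -> torus)) pi.
Proof.
move=> A mA; have mA2 := torus_measurable mA; split.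
  rewrite piE (_ : h @^-1` _ = A `*` setT); last by apply/seteqP; split => p [].
  rewrite piX// /density_measure.
  transitivity (\int[@leb2 R]_(x in A `&` FD) \sum_i (tintegral l1 l2 (D i) rho0 / vol i * \1_(cell l1 l2 Y i) x)%:E)%E; last first.
    by apply: eq_integral => x _; rewrite sumEFin.
  have mAF : @measurable _ mP (A `&` FD) by apply: measurableI => //; exact: measurable_FD.
  have t0 i : 0 <= tintegral l1 l2 (D i) rho0 by rewrite fine_ge0// integral_ge0// => x _; rewrite lee_fin.
  rewrite ge0_integral_sum//; last 2 first.
  - move=> i; apply/measurable_EFinP; apply: measurable_funM => //; apply: measurable_indic; exact: measurable_cell.
  - by move=> i x _; rewrite lee_fin mulr_ge0// divr_ge0// ltW.
  apply: eq_bigr => i _.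
  have -> : (\int[@leb2 R]_(x in D i `&` FD) (\1_[set: mP] x * rho0 x)%:E = (tintegral l1 l2 (D i) rho0)%:E)%E.
    by rewrite -irhoD; apply: eq_integral => x _; rewrite indicE in_setT mul1r.
  under [RHS]eq_integral do rewrite EFinM.
  rewrite ge0_integralZl//; last 2 first.
  - by apply/measurable_EFinP; apply: measurable_indic; exact: measurable_cell.
  - by rewrite lee_fin divr_ge0// ltW.
  rewrite integral_indic//; last exact: measurable_cell.
  rewrite EFinM [LHS]muleC muleA; congr (_ * _)%E.
  by rewrite -[RHS]/(@leb2 R _); congr (@leb2 R _); rewrite setICA.
rewrite piE (_ : h @^-1` _ = setT `*` (F @^-1` A)); last by apply/seteqP; split => p [].
have mFA : @measurable _ mP (F @^-1` A) by rewrite -[X in measurable X]setTI; exact: mF.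
rewrite piX//.
transitivity (\sum_i \int[@leb2 R]_(x in D i `&` FD) (\1_(F @^-1` A) x * rho0 x)%:E)%E.
  apply: eq_bigr => i _; rewrite setTI volE -EFinM mulVf ?mul1e//.
  exact: lt0r_neq0.
rewrite (ge0_integral_cells li N0 dX0)//.
- rewrite /pushforward /density_measure setIC [RHS]integral_mkcondr; apply: eq_integral => x _.
  by rewrite patchE indicE; case: ifP; rewrite ?mul1r ?mul0r.
- apply/measurable_EFinP; apply: measurable_funM; last by apply/measurable_EFinP; exact: measurable_int irho.
  by apply: measurable_funTS; exact: measurable_indic.
- by move=> x _; rewrite lee_fin mulr_ge0.
Qed.

Lemma W1_cells : (W1 l1 l2 (density_measure l1 l2 hist)
    (pushforward (density_measure l1 l2 rho0) (F : torus -> torus)) <=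
  ((r + B) * tintegral l1 l2 setT rho0)%:E)%E.
Proof.
(* The hypotheses on [r] and [B] speak only of points in cells. Generic points have full measure in
   a plane that is not null, and one of them lies in a cell of each tessellation. *)
have r0 : 0 <= r + B.
  have [x gx] : exists x, generic l1 l2 X0 x /\ generic l1 l2 Y x.
    have := aeI (ae_generic l1 l2 X0) (ae_generic l1 l2 Y).
    move=> H; apply: contrapT => nx.
    have : (@leb2 R (box (0%R : plane R) 1%R) <= 0)%E.
      case: H => Z [mZ Z0 sZ]; rewrite -Z0; apply: le_mu => //; first exact: measurable_box.
      by move=> x _; apply: sZ => /= gx; apply: nx; exists x.
    by rewrite leb2_box// lee_fin leNgt exprn_gt0// mulr_gt0.
  have [i ci] := generic_cover li N0 dX0 gx.1; have [j cj] := generic_cover li N0 dY gx.2.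
  by apply: addr_ge0; [exact: le_trans (tdist_ge0 _ _ _ _) (Yr cj)|exact: le_trans (tdist_ge0 _ _ _ _) (FB ci)].
(* On [S] the triangle inequality through the generator [Y i] bounds the cost by [r + B], and the
   coupling does not charge the complement. *)
pose S : set (torus * torus) := \bigcup_(i : 'I_N) ([set x : plane R | td x (Y i) <= r] `*` [set x : plane R | td x (Y i) <= B]).
have mS : measurable S.
  by apply: countable_bigcupT_measurable => // i; apply: measurableX; exact: measurable_tball.
have piS : pi (~` S) = 0%E.
  rewrite piE; apply: integral0_eq => p /= Sp; congr EFin; apply: big1 => i _.
  have [pC|pC] := boolP (p.1 \in C i); last by rewrite /a indicE (negbTE pC) !mul0r.
  have [pD|pD] := boolP (p.2 \in D i); last by rewrite /b indicE (negbTE pD) mul0r mulr0.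
  move: pC pD; rewrite !inE => -[pC _] pD; exfalso; apply: Sp; exists i => //.
  by split => /=; [exact: Yr|exact: FB].
apply: (@le_trans _ _ (\int[pi]_p (tdist l1 l2 p.1 p.2)%:E)%E).
  by apply: ereal_inf_lbound; exists pi => //; exact: coupling_pi.
apply: (@le_trans _ _ (\int[pi]_p (r + B)%:E)%E).
  apply: ge0_le_integral_nomeas => [p|p|]; rewrite ?lee_fin ?tdist_ge0//.
  exists (~` S); split => //; first exact: measurableC.
  move=> p /= np [i _ [/= p1 p2]]; apply: np; rewrite lee_fin.
  by rewrite (le_trans (tdist_triangle li (Y i) _ _))// lerD// tdistC.
rewrite integral_cst// EFinM lee_wpmul2l ?lee_fin//.
have [_] := coupling_pi measurableT; rewrite setXTT => ->.
rewrite /pushforward preimage_setT /density_measure le_eqVlt; apply/orP; left; apply/eqP.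
by rewrite /tintegral setTI fineK//; apply: integrable_fin_num => //; exact: measurable_FD.
Qed.

End Coupling.

(** * Powers of the mesh size and assembly of the estimates *)

Section FinalArith.
Context {R : realType}.

(** With q = h^(1/4) every power of h in the estimates is a natural power of q, within reach of
    [field] and [lra]. *)
Lemma powR_quarter (h : R) : 0 <= h ->
  [/\ h = (h `^ (1 / 4)) ^+ 4, h `^ (5 / 2) = (h `^ (1 / 4)) ^+ 10 & (h <= 1 -> h `^ (1 / 4) <= 1)].
Proof.
move=> h0; split.
- by rewrite -powR_mulrn ?powR_ge0// -powRrM (_ : 1 / 4 * 4%:R = 1) ?powRr1//; field.
- by rewrite -powR_mulrn ?powR_ge0// -powRrM; congr (_ `^ _); field.
- by move=> h1; have := @ge0_ler_powR R (1 / 4) _ h 1; rewrite powR1; apply; rewrite ?nnegrE ?divr_ge0.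
Qed.

Lemma fourth_root_le (c x E : R) : 0 < c -> 0 <= x -> c ^+ 2 * x ^+ 4 <= E ->
  x <= Num.sqrt (Num.sqrt E / c).
Proof.
move=> c0 x0 xE.
have E0 : 0 <= E by rewrite (le_trans _ xE)// mulr_ge0 ?exprn_ge0// ltW.
rewrite -(@ler_pXn2r _ 2) ?nnegrE ?sqrtr_ge0// sqr_sqrtr; last by rewrite divr_ge0 ?sqrtr_ge0// ltW.
rewrite ler_pdivlMr// -(@ler_pXn2r _ 2) ?nnegrE ?sqrtr_ge0 ?mulr_ge0 ?sqr_ge0 ?(ltW c0)//.
by rewrite sqr_sqrtr// exprMn -exprM mulrC.
Qed.

End FinalArith.

(* [q] is [h ^ (1 / 4)]; the choice [lambda = q ^ 9] in [trajectory_bound] makes both centroid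
   terms of order [q]. *)
Lemma coupling_radius_arith (R : realFieldType) (C3 e2 e4 C1 T IV q s z : R) : 0 <= C3 -> 0 <= e2 -> 0 <= e4 ->
  0 <= C1 -> 0 < T -> 0 <= IV -> 0 < q -> q <= 1 -> 0 <= s ->
  z <= C3 * q ^+ 2 + s + 2 * s * IV + C3 * q ^+ 2 * q ^+ 9 / (2 * q ^+ 10) * T +
    C3 * q ^+ 2 * e4 / (4 * q ^+ 9) * (C1 * q ^+ 8) ->
  C3 * q ^+ 2 + e2 * z <=
  (C3 + e2 * (C3 * (1 + T / 2 + e4 * C1 / 4) + (1 + 2 * IV))) * (q + s).
Proof.
move=> C30 e20 e40 C10 T0 IV0 q0 q1 s0.
have -> : C3 * q ^+ 2 * q ^+ 9 / (2 * q ^+ 10) * T = C3 * (T / 2) * q by field; rewrite gt_eqF.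
have -> : C3 * q ^+ 2 * e4 / (4 * q ^+ 9) * (C1 * q ^+ 8) = C3 * (e4 * C1 / 4) * q by field; rewrite gt_eqF.
have qq : C3 * q ^+ 2 <= C3 * q by rewrite ler_wpM2l// expr2 ler_piMl// ltW.
set A := C3 * (1 + T / 2 + e4 * C1 / 4); set B := 1 + 2 * IV => zle.
have A0 : 0 <= A by rewrite mulr_ge0// !addr_ge0// ?divr_ge0 ?mulr_ge0// ltW.
have B0 : 0 <= B by rewrite addr_ge0// mulr_ge0.
have {}zle : z <= A * q + B * s by rewrite /A /B; lra.
have h1 := ler_wpM2l e20 zle.
have h2 := mulr_ge0 C30 s0; have h3 := mulr_ge0 (mulr_ge0 e20 A0) s0.
have h4 := mulr_ge0 (mulr_ge0 e20 B0) (ltW q0).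
clear -qq h1 h2 h3 h4; lra.
Qed.

Section Assembly.
Context {R : realType}.
Variables (l1 l2 : plane R) (T : R) (v : R -> plane R -> plane R) (L : R -> R).
Hypothesis li : lin_indep l1 l2.

Lemma osl_field_ae (Vm : R -> R) :
  (forall t, 0 < t < T -> lattice_periodic l1 l2 (v t)) ->
  (forall t, 0 < t < T -> 0 <= L t) -> (forall t, 0 <= Vm t) ->
  one_sided_lipschitz T v L ->
  {ae leb R, forall t, 0 < t < T -> exists u, [/\ measurable_fun setT u,
     forall x, enorm (u x) <= Vm t & {ae @leb2 R, forall x, v t x = u x}]} ->
  {ae leb R, forall t, 0 < t < T -> exists u, osl_field l1 l2 (v t) u (L t) (Vm t)}.
Proof.
move=> vp L0 Vm0 vL vu; apply: aeS (aeI vL vu) => t [tL tu] tT.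
have [u [mu uV vuE]] := tu tT; exists u; split => //; [exact: vp|exact: tL|].
by split => //; split; [exact: L0|exact: Vm0].
Qed.

Lemma cell_tdist N (N0 : (0 < N)%N) (X : 'I_N -> plane R) x i : cell l1 l2 X i x -> tdist l1 l2 x (X i) <= vdist l1 l2 X x.
Proof.
move=> cx; apply: (le_vdist N0) => j.
by have [->//|ji] := eqVneq j i; rewrite ltW// cx.
Qed.

Lemma mesh_size_gt0 N : (0 < N)%N -> 0 < mesh_size l1 l2 N.
Proof.
move=> N0; rewrite sqrtr_gt0 divr_gt0 ?ltr0n// /tvol setTI fine_gt0//.
by rewrite FD_gt0// FD_lty.
Qed.

End Assembly.

Theorem mainTheorem5 (R : realType) (l1 l2 : plane R) (T C1 IL IV : R) :
  lin_indep l1 l2 -> 0 < T ->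
  exists C : R,
  forall (v : R -> plane R -> plane R) (L : R -> R)
         (Phi : R -> plane R -> plane R) (rho0 : plane R -> R),
    (* v : a one-sided Lipschitz field in L^1((0,T); L^oo(torus)) *)
    (forall t : R, 0 < t < T -> lattice_periodic l1 l2 (v t)) ->
    lebesgue_measurable_field T v ->
    (\int[leb R]_(t in `]0%R, T[) Linf_norm (v t) = IV%:E)%E ->
    (forall t : R, 0 < t < T -> 0 <= L t) ->
    (leb R).-integrable `]0, T[ (EFin \o L) ->
    (\int[leb R]_(t in `]0%R, T[) (L t)%:E = IL%:E)%E ->
    one_sided_lipschitz T v L ->
    filippov_flow T v Phi ->
    (* rho0 : a nonnegative density in L^1(torus) *)
    lattice_periodic l1 l2 rho0 ->
    (forall x, 0 <= rho0 x) ->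
    (@leb2 R).-integrable (fundamental_domain l1 l2) (EFin \o rho0) ->
  forall (N : nat) (X0 : 'I_N -> plane R),
    (2 <= N)%N ->
    mesh_size l1 l2 N <= 1 ->
    distinct l1 l2 X0 ->
    quantization_energy l1 l2 X0 <= C1 * mesh_size l1 l2 N ^+ 2 ->
  forall (eps : R) (eta : plane R -> R) (X : R -> 'I_N -> plane R),
    0 < eps <= 1 ->
    mollifier eps eta ->
    generator_solution l1 l2 T (mollify eta v) X0 X ->
    (ereal_sup
       [set W1 l1 l2
               (density_measure l1 l2 (histogram l1 l2 rho0 X0 (X t)))
               (pushforward (density_measure l1 l2 rho0)
                            (Phi t : torus l1 l2 -> torus l1 l2))
       | t in `[0%R, T] ]
     <= (C * tintegral l1 l2 setT rho0
           * (mesh_size l1 l2 N `^ (1 / 4) + eps `^ (1 / 2)))%:E)%E.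
Proof.
move=> li T0.
(* The constant in the cell radius C3 h^(1/2): it solves radius_cst^2 C3^4 = exp(4 IL) C1, which
   combines [vdist_energy] with [energy_bound]. *)
pose C3 := Num.sqrt (Num.sqrt (expR (4 * IL) * C1) / radius_cst l1 l2).
exists (C3 + expR (2 * IL) * (C3 * (1 + T / 2 + expR (4 * IL) * C1 / 4) + (1 + 2 * IV))).
move=> v L Phi rho0 vp mv vIV L0 iL LIL vL fl _ rho00 irho N X0 N2 h1 dX0 E0 eps eta X eps01 meta sol.
have N0 : (0 < N)%N by exact: ltnW.
have [Vm [iVm Vm0 VmIV vu]] := speed_bound mv vIV.
have good := osl_field_ae vp L0 Vm0 vL vu.
have h0 := mesh_size_gt0 li N0.
have [hq Hq /(_ h1) q1] := powR_quarter (ltW h0).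
have H0 : 0 < mesh_size l1 l2 N `^ (5 / 2) by exact: powR_gt0.
have q0 : 0 < mesh_size l1 l2 N `^ (1 / 4) by exact: powR_gt0.
move: hq Hq q1 q0; set q := _ `^ (1 / 4) => hq Hq q1 q0.
have q20 : 0 < q ^+ 2 by exact: exprn_gt0.
have q80 : 0 < q ^+ 8 by exact: exprn_gt0.
have X00 : X 0 = X0 by case: sol.
have {}E0 : energy l1 l2 (X 0) <= C1 * q ^+ 8.
  by rewrite X00 -(quantization_energyE li N0 dX0) (le_trans E0)// hq -exprM.
(* The sign of [C1] is forced by the energy bound at time 0. *)
have C10 : 0 <= C1.
  by rewrite -(pmulr_lge0 _ q80) (le_trans (energy_ge0 _ _ _) E0).
have IV0 : 0 <= IV by rewrite -lee_fin -VmIV integral_ge0// => t _; rewrite lee_fin.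
have C30 : 0 <= C3 by exact: sqrtr_ge0.
have dX t : 0 <= t <= T -> distinct l1 l2 (X t) by case: sol => _ + _ _; apply.
have radius t y : 0 <= t <= T -> vdist l1 l2 (X t) y <= C3 * q ^+ 2.
  move=> tT; rewrite -ler_pdivrMr//; apply: fourth_root_le; first exact: radius_cst_gt0.
    by rewrite divr_ge0 ?(ltW q20)// vdist_ge0.
  rewrite expr_div_n -exprM mulrA ler_pdivrMr//.
  rewrite (le_trans (vdist_energy li N0 _ _))//.
  rewrite (le_trans (energy_bound li T0 L0 iL LIL good N0 meta sol H0 tT))//.
  by rewrite -mulrA ler_wpM2l ?expR_ge0.
have rho0' : 0 <= C3 * q ^+ 2 by rewrite mulr_ge0// ltW.
have disp i t : 0 <= t <= T -> enorm (centroid_disp l1 l2 (X t) i) <= C3 * q ^+ 2.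
  move=> tT; apply: (centroid_disp_le li N0 (dX t tT)) => // y Py.
  by rewrite -(planar_cell_vdist N0 Py) radius.
have /andP[eps0 _] := eps01.
have -> : eps `^ (1 / 2) = Num.sqrt eps by rewrite div1r powR12_sqrt// ltW.
apply: ge_ereal_sup => _ [t tT <-]; move: tT; rewrite /= in_itv/= => tT.
pose z := C3 * q ^+ 2 + Num.sqrt eps + 2 * Num.sqrt eps * IV +
    C3 * q ^+ 2 * q ^+ 9 / (2 * q ^+ 10) * T + C3 * q ^+ 2 * expR (4 * IL) / (4 * q ^+ 9) * (C1 * q ^+ 8).
have zP x i : cell l1 l2 X0 i x -> tdist l1 l2 (Phi t x) (X t i) <= expR (2 * IL) * z.
  (* The lift of the generator that is nearest to [x] at time 0 is followed for all times. At time
     [t] it may no longer be the nearest one, but its distance still dominates the torus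
     distance. *)
  move=> cx; have [k kl tk] := tdist_attained li x (X0 i).
  apply: le_trans (tdist_le _ _ kl) _.
  apply: (@expR_cancel _ (2 * IL)) => //; first exact: enorm_ge0.
  have q90 : 0 < q ^+ 9 by exact: exprn_gt0.
  have tb := trajectory_bound li T0 L0 iL LIL Vm0 iVm VmIV good N0 eps01 meta sol H0 x fl kl q90 rho0' (disp i) tT.
  apply: le_trans tb _; rewrite Hq /z; apply: lerD; last first.
    by rewrite ler_wpM2l// divr_ge0 ?mulr_ge0 ?expR_ge0// ltW.
  rewrite !lerD2r -tk (le_trans (cell_tdist N0 cx))// -X00; apply: radius.
  by rewrite lexx ltW.
have := W1_cells li N0 dX0 (dX t tT) rho00 irho (fun x y => flow_lipschitz T0 L0 iL LIL good x y fl tT)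
  (fun x i cx => le_trans (cell_tdist N0 cx) (radius t x tT)) zP.
move=> /le_trans; apply; rewrite lee_fin mulrAC ler_wpM2r//.
  by rewrite fine_ge0// integral_ge0// => x _; rewrite lee_fin.
by apply: coupling_radius_arith; rewrite ?expR_ge0 ?sqrtr_ge0.
Qed.
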